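(* In every case (beam or shallow arch, with or without cracks), $U_b$ is a convex, lower-semicontinuous function on $V$, and $U_a$ is a convex, lower-semicontinuous function on $H_0^1$; therefore they admit subdifferentials $\partial U_b$ on $V$ and $\partial U_a$ on $H_0^1$, with $\partial U_b:V\to V'$ and $\partial U_a:H_0^1\to (H_0^1)'$. If $y$ is a motion of the system according to the Extended Hamilton's Principle, i.e. the action $I$ has a stationary value at $y$, meaning $\nabla I(y)=0$ in $W'$, then $$\ddot y+\partial U_b(y)+\partial U_a(y)+c_d\,\dot y=p$$ in $V'$, for a.e. $t\in[0,T]$. That is, this is the abstract governing equation of the system.
   Context: A beam or shallow arch on $[0,\pi]$ (nondimensional variables) with transverse deflection $y=y(x,t)$ has $m$ cracks at $0=x_0<x_1<\dots<x_m<x_{m+1}=\pi$ with flexibilities $\theta_i>0$ (in the absence of cracks, $m=0$ and the crack sums are absent). Let $T>0$ be the final time, $c_d\ge 0$ the damping coefficient, $p=p(x,t)$ the transverse load, $\beta\in\mathbb{R}$ the renormalized initial axial force. Put $l_i=(x_{i-1},x_i)$, $i=1,\dots,m+1$, and $J[u](x)=u(x^+)-u(x^-)$. Spaces: $H=\bigoplus_{i=1}^{m+1}L^2(l_i)$ with $(u,v)_H=\sum_{i=1}^{m+1}(u,v)_i$, where $(\cdot,\cdot)_i$ is the $L^2(l_i)$ inner product, and $|u|_H^2=(u,u)_H$; $H_0^1=H_0^1(0,\pi)$ with inner product $(u',v')_H$; $$V=\Big\{u\in\bigoplus_{i=1}^{m+1}H^2(l_i): u(0)=u(\pi)=0,\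 J[u](x_i)=0,\ i=1,\dots,m\Big\}$$ with inner product $\sum_{i=1}^{m+1}(u'',v'')_i+\sum_{i=1}^m J[u'](x_i)J[v'](x_i)$, second derivatives being taken on each $l_i$. These are Hilbert spaces and $V\subset H_0^1\subset H\subset(H_0^1)'\subset V'$ with continuous dense embeddings; the pairing $\langle\cdot,\cdot\rangle_V$ between $V'$ and $V$ extends $(\cdot,\cdot)_H$. Further, $$W=\{y: y\in L^2(0,T;V),\ \dot y\in L^2(0,T;H),\ \ddot y\in L^2(0,T;V')\},$$ with dots denoting time derivatives in the sense of distributions; $W$ is a Hilbert space with the standard inner product. Subdifferential: for a proper, convex, lower-semicontinuous function $\phi$ on a Hilbert space $X$, $\partial\phi(x)=\{x^*\in X': \phi(z)\ge\phi(x)+\langle x^*,z-x\rangle\ \text{for any } z\in X\}$. If $\phi$ is convex and Gâteaux differentiable at $x$, then $\partial\phi(x)$ is a singleton, equal to the Gâteaux derivative $\nabla\phi(x)$. Energies and work: kinetic energy $T_k(y)=\frac12|\dot y|_H^2$; bending potential energy $U_b(y)=\frac12\big(|y''|_H^2+\sum_{i=1}^m\frac1{\theta_i}|J[y'](x_i)|^2\big)$; axial potential energy $U_a(y)=\frac1{2\pi}\big(\beta+\frac12|y'|_H^2\big)^2$ for an arch, while for a beam the influence of the axial force is neglected and $U_a=0$; external work $\mathcal{W}_{ext}(y)=(p,y)_H$; dissipative work $\mathcal{W}_d(y)=-c_d(\dot y,y)_H$ of the viscous damping force $-c_d\dot y$. Action: with $t_1<t_2$ the time limits of the action, $$I(y)=\int_{t_1}^{t_2}\big(T_k(y)-U_b(y)-U_a(y)+\mathcal{W}_d(y)+\mathcal{W}_{ext}(y)\big)\,dt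 .$$ Its Gâteaux derivative $\nabla I(y)\in W'$ is defined by $\langle\nabla I(y),\eta\rangle_W=I'(y,\eta)$ for any $\eta\in W$, where $I'(y,\eta)=\lim_{\alpha\to0+}\frac{I(y+\alpha\eta)-I(y)}{\alpha}$ is the directional derivative, except that the contribution of the non-conservative damping work is defined in a non-variational manner (Rayleigh's dissipation functional): for $\eta(x,t)=\zeta(t)v(x)$, with $v\in V$ and $\zeta$ smooth on $[t_1,t_2]$, $\zeta(t_1)=\zeta(t_2)=0$, it is $\mathcal{W}_d'(y,\eta)=-c_d\int_{t_1}^{t_2}(\dot y(t),v)_H\,\zeta(t)\,dt$.
   Formalization: For an arch with β<0, U_a is not convex and its subdifferential is empty at 0, so convexity of U_a and the map ∂U_a are stated only for a beam or an arch with β≥0; for β<0 the governing equation uses the Gâteaux derivative of U_a in place of ∂U_a. *)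

(* Defs.v *)
From HB Require Import structures.
From mathcomp Require Import all_boot all_order all_algebra.
From mathcomp Require Import all_classical all_reals all_analysis.
Set Implicit Arguments.
Unset Strict Implicit.
Unset Printing Implicit Defensive.
Import Order.TTheory GRing.Theory Num.Theory.
Import numFieldNormedType.Exports.
Local Open Scope classical_set_scope.
Local Open Scope ring_scope.

(* A normed space given by representatives: its points are the elements of
   [elts], two of them being identified when the norm of their difference is 0.
   For spaces of functions this is equality almost everywhere. *)
Record nspace (R : realType) := NSpace {
  rep : lmodType R;
  elts : set rep;
  nrm : rep -> R }.
Arguments elts {R} _.
Arguments nrm {R _} _.

Section FunctionalAnalysis.
Context {R : realType}.
Implicit Types X : nspace R.

(* The topological dual X', with the dual norm.  Two functionals are equal in
   X' when they agree on [elts X]; their values elsewhere are irrelevant. *)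
Definition dual X : nspace R := {|
  rep := (rep X -> R : lmodType R);
  elts := [set f | (forall (a : R) u v, elts X u -> elts X v ->
                     f (a *: u + v) = a * f u + f v) /\
                  (exists C : R, forall u, elts X u -> `|f u| <= C * nrm u)];
  nrm := fun f => sup [set `|f u| | u in [set u | elts X u /\ nrm u <= 1]] |}.

Definition dual_eq X (f g : rep X -> R) := forall v, elts X v -> f v = g v.

Definition lsc_on X (phi : rep X -> R) :=
  forall u, elts X u -> forall e : R, 0 < e -> exists d : R, 0 < d /\
    forall v, elts X v -> nrm (v - u) < d -> phi u - e < phi v.

Definition convex_on X (phi : rep X -> R) :=
  @convex_function R (rep X) (elts X) phi.

Definition subdiff X (phi : rep X -> R) (u : rep X) : set (rep (dual X)) :=
  [set g | elts (dual X) g /\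
           forall z, elts X z -> phi u + g (z - u) <= phi z].

(* The directional derivative phi'(u, eta) exists and equals l. *)
Definition is_dirderiv X (phi : rep X -> R) (u eta : rep X) (l : R) :=
  (phi (u + alpha *: eta) - phi u) / alpha @[alpha --> (0:R)^'+] --> l.

(* The subdifferential is a map X -> X', i.e. a singleton at each point. *)
Definition subdiff_map X (phi : rep X -> R) :=
  forall u, elts X u -> exists g, subdiff phi u g /\
    forall g', subdiff phi u g' -> dual_eq g' g.

Definition is_gateaux X (phi : rep X -> R) (u : rep X) (g : rep (dual X)) :=
  elts (dual X) g /\ forall eta, elts X eta -> is_dirderiv phi u eta (g eta).

End FunctionalAnalysis.

Section Sobolev.
Context {R : realType}.
Notation mu := (@lebesgue_measure R).
Implicit Types u g phi : R -> R.

Definition smooth phi := forall n t, derivable (derive1n n phi) t 1.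

(* C_c^\infty(]a, b[) *)
Definition test_function (a b : R) phi := smooth phi /\
  exists c d : R, [/\ a < c, d < b & forall t, ~ (c <= t <= d) -> phi t = 0].

Definition L2 (D : set R) u :=
  measurable_fun D u /\ mu.-integrable D (fun t => (u t ^+ 2)%:E).

Definition weak_deriv (a b : R) u g := forall phi, test_function a b phi ->
  \int[mu]_(t in `]a, b[) (u t * derive1 phi t) =
  - \int[mu]_(t in `]a, b[) (g t * phi t).

Definition sobolev1 (a b : R) u :=
  L2 `]a, b[ u /\ exists g, L2 `]a, b[ g /\ weak_deriv a b u g.

(* The weak derivative on ]a, b[ of u in H^1(a, b); it is determined up to
   equality a.e. on ]a, b[. *)
Definition wder (a b : R) u : R -> R :=
  xget (fun=> 0) [set g | L2 `]a, b[ g /\ weak_deriv a b u g].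

Definition sobolev2 (a b : R) u := sobolev1 a b u /\ sobolev1 a b (wder a b u).

(* One-sided limits u(z^+) and u(z^-) of an a.e.-class, i.e. those of its
   representative that is continuous on the side considered. *)
Definition rlim u (z : R) : R := xget 0 [set c : R | forall e : R, 0 < e ->
  exists d : R, 0 < d /\ {ae mu, forall t, z < t < z + d -> `|u t - c| < e}].

Definition llim u (z : R) : R := xget 0 [set c : R | forall e : R, 0 < e ->
  exists d : R, 0 < d /\ {ae mu, forall t, z - d < t < z -> `|u t - c| < e}].

Definition jump u (z : R) : R := rlim u z - llim u z.

End Sobolev.

(* Spaces of functions on ]0, pi[ with cracks at x 1 < ... < x m.  The sequence
   x is meant to satisfy x 0 = 0 and x m.+1 = pi; the uncracked pieces are
   the intervals ]x i, x i.+1[, for i < m.+1. *)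
Section CrackedSpaces.
Context {R : realType} (m : nat) (x : nat -> R).
Notation mu := (@lebesgue_measure R).
Implicit Types u v : R -> R.

(* The function equal on each ]x i, x i.+1[ to the weak derivative there. *)
Definition pder u : R -> R :=
  fun t => \sum_(i < m.+1) \1_(`]x i, x i.+1[) t * wder (x i) (x i.+1) u t.

Definition ipH u v : R :=
  \sum_(i < m.+1) \int[mu]_(t in `]x i, x i.+1[) (u t * v t).

Definition spH : nspace R := {|
  rep := (R -> R : lmodType R);
  elts := [set u | forall i, (i < m.+1)%N -> L2 `]x i, x i.+1[ u];
  nrm := fun u => Num.sqrt (ipH u u) |}.

(* u' is the derivative on the whole of ]0, pi[, with no contribution of the
   kinks of u at the cracks. *)
Definition ipH01 u v : R := ipH (wder 0 pi u) (wder 0 pi v).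

Definition spH01 : nspace R := {|
  rep := (R -> R : lmodType R);
  elts := [set u | [/\ sobolev1 0 pi u, rlim u 0 = 0 & llim u pi = 0]];
  nrm := fun u => Num.sqrt (ipH01 u u) |}.

Definition ipV u v : R :=
  ipH (pder (pder u)) (pder (pder v)) +
  \sum_(i < m) jump (pder u) (x i.+1) * jump (pder v) (x i.+1).

Definition spV : nspace R := {|
  rep := (R -> R : lmodType R);
  elts := [set u | [/\ forall i, (i < m.+1)%N -> sobolev2 (x i) (x i.+1) u,
                      rlim u 0 = 0, llim u pi = 0
                    & forall i, (i < m)%N -> jump u (x i.+1) = 0]];
  nrm := fun u => Num.sqrt (ipV u u) |}.

(* The embedding of H into V'. *)
Definition embH u : rep (dual spV) := fun v => ipH u v.

End CrackedSpaces.
Arguments embH {R} m x u.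
Arguments pder {R} m x u.
Arguments ipH {R} m x u v.

Section Bochner.
Context {R : realType}.
Notation mu := (@lebesgue_measure R).

Definition simple_into (X : nspace R) (s : R -> rep X) :=
  exists (n : nat) (A : nat -> set R) (c : nat -> rep X),
    (forall k, (k < n)%N -> measurable (A k) /\ elts X (c k)) /\
    (forall t, s t = \sum_(k < n) (\1_(A k) t : R) *: c k).

Definition strongly_measurable (T : R) (X : nspace R) (f : R -> rep X) :=
  exists s : nat -> R -> rep X, (forall n, simple_into (s n)) /\
    {ae mu, forall t, 0 < t < T -> nrm (s n t - f t) @[n --> \oo] --> (0 : R)}.

(* L^2(0, T; X) *)
Definition L2B (T : R) (X : nspace R) (f : R -> rep X) :=
  [/\ {ae mu, forall t, 0 < t < T -> elts X (f t)},
      strongly_measurable T f &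
      (\int[mu]_(t in `]0%R, T[) ((nrm (f t)) ^+ 2)%:E < +oo)%E].

Definition normL2B (T : R) (X : nspace R) (f : R -> rep X) : R :=
  Num.sqrt (\int[mu]_(t in `]0, T[) (nrm (f t) ^+ 2)).

(* G is the derivative of F in the sense of V'-valued distributions on
   ]0, T[, for V' = dual X. *)
Definition dist_deriv (T : R) (X : nspace R) (F G : R -> rep (dual X)) :=
  forall (phi : R -> R) (v : rep X), test_function 0 T phi -> elts X v ->
  \int[mu]_(t in `]0, T[) (derive1 phi t * F t v) =
  - \int[mu]_(t in `]0, T[) (phi t * G t v).

End Bochner.

Inductive axial_model (R : Type) := Beam | Arch of R.
Arguments Beam {R}.

Section Hamilton.
Context {R : realType} (m : nat) (x theta : nat -> R) (T : R).
Notation mu := (@lebesgue_measure R).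
Local Notation V := (spV m x).
Local Notation H := (spH m x).
Local Notation H01 := (spH01 m x).

(* An element of W is represented by the triple of y and its first two time
   derivatives. *)
Definition Wrep : lmodType R :=
  ((R -> rep V) * (R -> rep H) * (R -> rep (dual V)))%type.

Definition pos (w : Wrep) : R -> rep V := w.1.1.
Definition vel (w : Wrep) : R -> rep H := w.1.2.
Definition acc (w : Wrep) : R -> rep (dual V) := w.2.

Definition spW : nspace R := {|
  rep := Wrep;
  elts := [set w : Wrep |
    [/\ L2B T (X := V) (pos w), L2B T (X := H) (vel w),
        L2B T (X := dual V) (acc w),
        dist_deriv T (X := V) (fun t => embH m x (pos w t))
                              (fun t => embH m x (vel w t)) &
        dist_deriv T (X := V) (fun t => embH m x (vel w t)) (acc w)]];
  nrm := fun w : Wrep => Num.sqrt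
    (normL2B T (X := V) (pos w) ^+ 2 + normL2B T (X := H) (vel w) ^+ 2 +
     normL2B T (X := dual V) (acc w) ^+ 2)
  |}.

(* eta(t) = zeta(t) v *)
Definition separated (zeta : R -> R) (v : rep V) : rep spW :=
  ((fun t => zeta t *: v),
   (fun t => derive1 zeta t *: v),
   (fun t => derive1n 2 zeta t *: embH m x v)).

(* theta i.+1 is the flexibility of the crack at x i.+1, for i < m. *)
Definition Ub (u : rep V) : R :=
  2^-1 * (ipH m x (pder m x (pder m x u)) (pder m x (pder m x u)) +
    \sum_(i < m) (theta i.+1)^-1 * `|jump (pder m x u) (x i.+1)| ^+ 2).

Definition Ua (s : axial_model R) (u : rep H01) : R :=
  match s with
  | Beam => 0
  | Arch beta => (2 * pi)^-1 *
      (beta + 2^-1 * ipH m x (wder 0 pi u) (wder 0 pi u)) ^+ 2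
  end.

(* For an arch, Ua is convex on H01 exactly when 0 <= beta: if beta < 0 and
   |u'|_H^2 = - 2 * beta, then Ua u = Ua (- u) = 0 < Ua 0. *)
Definition axial_nonneg (s : axial_model R) : Prop :=
  match s with Beam => True | Arch beta => 0 <= beta end.

Definition Tk (w : rep spW) (t : R) : R := 2^-1 * ipH m x (vel w t) (vel w t).

Definition Wext (p : R -> rep H) (w : rep spW) (t : R) : R :=
  ipH m x (p t) (pos w t).

Definition Wd (cd : R) (w : rep spW) (t : R) : R :=
  - cd * ipH m x (vel w t) (pos w t).

Definition action (s : axial_model R) (p : R -> rep H) (cd t1 t2 : R)
    (w : rep spW) : R :=
  \int[mu]_(t in `[t1, t2])
    (Tk w t - Ub (pos w t) - Ua s (pos w t) + Wd cd w t + Wext p w t).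

(* Rayleigh's prescription for the contribution of the damping work; it only
   specifies the functional on the separated variations vanishing at t1, t2. *)
Definition damping_contribution (cd t1 t2 : R) (w : rep spW)
    (d : rep (dual spW)) :=
  elts (dual spW) d /\
  forall (zeta : R -> R) (v : rep V),
    smooth zeta -> zeta t1 = 0 -> zeta t2 = 0 -> elts V v ->
    d (separated zeta v) =
    - cd * \int[mu]_(t in `[t1, t2]) (ipH m x (vel w t) v * zeta t).

(* g is a gradient of the action at w: the sum of the Gateaux derivative of the
   action without the damping work (cd = 0) and of a damping contribution. *)
Definition action_gradient (s : axial_model R) (p : R -> rep H) (cd t1 t2 : R)
    (w : rep spW) (g : rep (dual spW)) :=
  exists c d : rep (dual spW),
    [/\ is_gateaux (X := spW) (action s p 0 t1 t2) w c,
        damping_contribution cd t1 t2 w d &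
        dual_eq (X := spW) g (fun eta => c eta + d eta)].

Definition stationary (s : axial_model R) (p : R -> rep H) (cd t1 t2 : R)
    (w : rep spW) :=
  elts spW w /\ action_gradient s p cd t1 t2 w (fun=> 0).

(* The equation y'' + b + a + cd y' = p in V' at time t. *)
Definition balance (p : R -> rep H) (cd : R) (w : rep spW) (t : R)
    (b : rep (dual V)) (a : rep (dual H01)) :=
  dual_eq (X := V) (fun v => acc w t v + b v + a v + cd * embH m x (vel w t) v)
                   (embH m x (p t)).

(* The equation at time t, with a the Gateaux derivative of Ua, which is the
   element of the subdifferential whenever Ua is convex. *)
Definition governing_equation (s : axial_model R) (p : R -> rep H) (cd : R)
    (w : rep spW) (t : R) :=
  exists (b : rep (dual V)) (a : rep (dual H01)),
    [/\ subdiff (X := V) Ub (pos w t) b,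
        is_gateaux (X := H01) (Ua s) (pos w t) a,
        axial_nonneg s -> subdiff (X := H01) (Ua s) (pos w t) a &
        balance p cd w t b a].

End Hamilton.

(* Main.v *)
Require Import Defs.
From HB Require Import structures.
From mathcomp Require Import all_boot all_order all_algebra.
From mathcomp Require Import all_classical all_reals all_analysis.
From mathcomp Require Import measurable_realfun.
From mathcomp Require Import ring lra.
Set Implicit Arguments.
Unset Strict Implicit.
Unset Printing Implicit Defensive.
Import Order.TTheory GRing.Theory Num.Theory.
Import numFieldNormedType.Exports.
Local Open Scope classical_set_scope.
Local Open Scope ring_scope.

(** The static claims come from two abstract facts.  Half a nonnegative bounded
    symmetric form b is convex and has gradient b u (form_convex, form_gateaux),
    and k * (beta + b u u / 2) ^ 2 is a polynomial of degree 4 along every line,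
    hence differentiable, and is convex for beta >= 0 because it is then an
    increasing convex function of b u u (quartic_expand, quartic_convex).  A
    convex function that has a Gateaux derivative at a point has there exactly
    one subgradient (gateaux_subdiff, gateaux_subdiff_unique).  Ub and Ua are of
    these two kinds, for the forms bending on V and ipH01 on H01.

    For the governing equation the action is varied along zeta(t) v(x), with
    zeta a test function on ]t1, t2[ and v in V.  Along such a variation the
    Lagrangian is a polynomial of degree 4 in the parameter
    (lagrangian_expand), so the directional derivative is the integral of its
    linear coefficient (action_expand).  Stationarity, the prescription for the
    damping work and the definition of the second time derivative then say that
    the integral of zeta(t) G(t) v vanishes for every zeta, where G(t) in V' is
    the residual of the equation.  The fundamental lemma of the calculus of
    variations gives G(t) v = 0 for almost every t, for each fixed v
    (balance_of_stationarity).  To choose the exceptional null set independently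
    of v, the values of G are approximated by a sequence of functionals, the
    norm of each of which is nearly reached at countably many v
    (dual_ae_zero).

    The expansion of the action is meaningful only if the quartic axial energy
    is integrable in time, while y is merely in L^2(0, T; V).  Two facts make
    up for this.  The position is essentially bounded in H, because its
    derivative lies in L^2(0, T; H) (position_bounded); and the interpolation
    inequality |u'|^2 <= C |u|_H |u|_V holds on V (interpolation), by
    integration by parts on every uncracked piece and estimates of the boundary
    terms.  Together they bound |y'|^4 by a multiple of |y|_V^2.

    An element of a space is a function known only almost everywhere, and a
    function with values in such a space is measurable only as an almost
    everywhere limit of simple ones.  Scalar integrals are therefore handled for
    functions that agree almost everywhere with a Borel function (aeint);
    integral_ae_ext shows that the integral depends only on the class.  Weak
    derivatives, traces and integration by parts are all reduced to primitives
    of integrable functions (weak_deriv_primitive,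
    integration_by_parts_prim). *)

(** * Integrals of almost everywhere classes *)

Section AeExtensionality.
Import HBNNSimple.
Context d (T : measurableType d) (R : realType) (mu : {measure set T -> \bar R}).

(** A simple function below f is brought below g by setting it to 0 on the null
    set where f and g differ, which keeps its integral.  The integral of a
    nonnegative function is the supremum of these, so the argument
    applies to arbitrary functions. *)
Lemma le_sup_ae (f g : T -> \bar R) : (forall t, 0 <= g t)%E ->
  {ae mu, forall t, f t = g t} ->
  (ereal_sup [set sintegral mu h | h in [set h : {nnsfun T >-> R} |
     forall t, (h t)%:E <= f t]] <=
   ereal_sup [set sintegral mu h | h in [set h : {nnsfun T >-> R} |
     forall t, (h t)%:E <= g t]])%E.
Proof.
move=> g0 [N [mN N0 subN]]; apply: ge_ereal_sup => _ [h /= hf <-].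
apply: ereal_sup_ubound; exists (proj_nnsfun h (measurableC mN)) => /=.
  move=> t; rewrite /= /mindic indicE; have [tN|tN] := boolP (t \in ~` N).
    rewrite mulr1; have : f t = g t.
      apply: contrapT => fgt; move/set_mem: tN; apply; exact: subN.
    by move=> <-.
  by rewrite mulr0.
rewrite -!integralT_nnsfun; apply: ge0_ae_eq_integral => //.
- exact/measurable_EFinP.
- exact/measurable_EFinP.
- by move=> t _; rewrite lee_fin mulr_ge0.
- by move=> t _; rewrite lee_fin.
exists N; split => // t /= /not_implyP[_]; apply: contra_notP => tN.
by rewrite /mindic indicE mem_set //= mulr1.
Qed.

(** Typical integrands below are t |-> b (y t) v, which may fail to be measurable
    because y t is a representative chosen independently for each t. *)
Lemma integral_ae_ext (D : set T) (f g : T -> \bar R) :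
  {ae mu, forall t, D t -> f t = g t} ->
  (\int[mu]_(t in D) f t = \int[mu]_(t in D) g t)%E.
Proof.
move=> fg; rewrite /integral.
have fgD : {ae mu, forall t, (f \_ D) t = (g \_ D) t}.
  apply: filterS fg => t fgt; rewrite /patch; case: ifPn => // /set_mem.
  exact: fgt.
have gfD : {ae mu, forall t, (g \_ D) t = (f \_ D) t} by apply: filterS fgD.
congr (_ - _)%E; apply/eqP; rewrite eq_le; apply/andP; split;
  apply: le_sup_ae.
- by move=> t; exact: funepos_ge0.
- by apply: filterS fgD => t; rewrite !funeposE => ->.
- by move=> t; exact: funepos_ge0.
- by apply: filterS gfD => t; rewrite !funeposE => ->.
- by move=> t; exact: funeneg_ge0.
- by apply: filterS fgD => t; rewrite !funenegE => ->.
- by move=> t; exact: funeneg_ge0.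
- by apply: filterS gfD => t; rewrite !funenegE => ->.
Qed.

End AeExtensionality.

Section AeIntegral.
Context {R : realType}.
Notation mu := (@lebesgue_measure R).
Implicit Types (D E : set R) (f g h : R -> R).

Lemma ae_imp (P Q : R -> Prop) : (forall t, P t -> Q t) ->
  {ae mu, forall t, P t} -> {ae mu, forall t, Q t}.
Proof. by move=> PQ; apply: (@filterS _ _ (ae_filter_ringOfSetsType _)). Qed.

Lemma ae_imp2 (P Q S : R -> Prop) : (forall t, P t -> Q t -> S t) ->
  {ae mu, forall t, P t} -> {ae mu, forall t, Q t} -> {ae mu, forall t, S t}.
Proof. by move=> PQ; apply: (@filterS2 _ _ (ae_filter_ringOfSetsType _)). Qed.

Lemma ae_imp3 (P Q S U : R -> Prop) : (forall t, P t -> Q t -> S t -> U t) ->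
  {ae mu, forall t, P t} -> {ae mu, forall t, Q t} -> {ae mu, forall t, S t} ->
  {ae mu, forall t, U t}.
Proof. by move=> PQ; apply: (@filterS3 _ _ (ae_filter_ringOfSetsType _)). Qed.

Definition aeeq D f g := {ae mu, forall t, D t -> f t = g t}.

Lemma Rint_ext D f g : aeeq D f g ->
  \int[mu]_(t in D) f t = \int[mu]_(t in D) g t.
Proof.
move=> fg; congr fine; apply: integral_ae_ext.
by apply: ae_imp fg => t fgt /fgt ->.
Qed.

Lemma Rint_dom D E f : {ae mu, forall t, D t <-> E t} ->
  \int[mu]_(t in D) f t = \int[mu]_(t in E) f t.
Proof.
move=> DE; rewrite Rintegral_mkcond [RHS]Rintegral_mkcond; apply: Rint_ext.
apply: ae_imp DE => t DEt _; rewrite /patch.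
by have -> : (t \in D) = (t \in E) by apply/idP/idP => /set_mem /DEt /mem_set.
Qed.

Lemma aeeq_refl D f : aeeq D f f.
Proof. exact: aeW. Qed.

Lemma aeeq_sym D f g : aeeq D f g -> aeeq D g f.
Proof. by apply: ae_imp => t fg /fg. Qed.

Lemma aeeq_trans D g f h : aeeq D f g -> aeeq D g h -> aeeq D f h.
Proof. by apply: ae_imp2 => t fg gh Dt; rewrite fg// gh. Qed.

Lemma aeeq_sub D E f g : E `<=` D -> aeeq D f g -> aeeq E f g.
Proof. by move=> ED; apply: ae_imp => t fg /ED/fg. Qed.

Lemma eq_aeeq D f g : (forall t, D t -> f t = g t) -> aeeq D f g.
Proof. by move=> fg; apply: aeW. Qed.

(** Agreement with a Borel function outside a null set; this is the
    measurability that strongly measurable vector-valued functions provide for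
    their scalar images. *)
Definition aemeas D f := exists2 h, measurable_fun setT h & aeeq D f h.

Definition aeint D f := exists h,
  [/\ measurable_fun setT h, mu.-integrable D (EFin \o h) & aeeq D f h].

Lemma aemeas_ext D f g : aeeq D f g -> aemeas D g -> aemeas D f.
Proof. by move=> fg [h mh gh]; exists h => //; exact: aeeq_trans gh. Qed.

Lemma aemeas_meas D f : measurable D -> measurable_fun D f -> aemeas D f.
Proof.
move=> mD mf; exists (f \_ D).
  by apply/(measurable_restrictT f mD).
by apply: eq_aeeq => t Dt; rewrite patchT// inE.
Qed.

Lemma aemeasT D f : measurable_fun setT f -> aemeas D f.
Proof. by move=> mf; exists f => //; exact: aeeq_refl. Qed.

Lemma aemeas_cst D (r : R) : aemeas D (fun=> r).
Proof. by apply: aemeasT; exact: measurable_cst. Qed.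

Lemma aemeas_sub D E f : E `<=` D -> aemeas D f -> aemeas E f.
Proof. by move=> ED [h mh fh]; exists h => //; exact: aeeq_sub fh. Qed.

Lemma aemeasD D f g : aemeas D f -> aemeas D g ->
  aemeas D (fun t => f t + g t).
Proof.
move=> [f' mf ff'] [g' mg gg']; exists (fun t => f' t + g' t).
  exact: measurable_funD.
by apply: ae_imp2 ff' gg' => t ft gt Dt; rewrite ft// gt.
Qed.

Lemma aemeasM D f g : aemeas D f -> aemeas D g ->
  aemeas D (fun t => f t * g t).
Proof.
move=> [f' mf ff'] [g' mg gg']; exists (fun t => f' t * g' t).
  exact: measurable_funM.
by apply: ae_imp2 ff' gg' => t ft gt Dt; rewrite ft// gt.
Qed.

Lemma aemeasZ D (r : R) f : aemeas D f -> aemeas D (fun t => r * f t).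
Proof. by move=> mf; apply: aemeasM => //; exact: aemeas_cst. Qed.

Lemma aemeas_norm D f : aemeas D f -> aemeas D (fun t => `|f t|).
Proof.
move=> [f' mf ff']; exists (fun t => `|f' t|).
  exact: measurableT_comp.
by apply: ae_imp ff' => t ft Dt; rewrite ft.
Qed.

Lemma aemeasX D f n : aemeas D f -> aemeas D (fun t => f t ^+ n).
Proof.
move=> mf; elim: n => [|n IH]; first exact: aemeas_cst.
by apply: aemeas_ext (aemeasM mf IH); apply: eq_aeeq => t _; rewrite exprS.
Qed.

Lemma aeint_ext D f g : aeeq D f g -> aeint D g -> aeint D f.
Proof.
by move=> fg [h [mh ih gh]]; exists h; split => //; exact: aeeq_trans gh.
Qed.

Lemma aeint_integrable D f : measurable D -> mu.-integrable D (EFin \o f) ->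
  aeint D f.
Proof.
move=> mD /[dup] iF /measurable_int /measurable_EFinP mf; exists (f \_ D); split.
- by apply/(measurable_restrictT f mD).
- by apply: eq_integrable iF => // t tD; rewrite /= patchT.
- by apply: eq_aeeq => t Dt; rewrite patchT// inE.
Qed.

Lemma aeint_aemeas D f : aeint D f -> aemeas D f.
Proof. by move=> [h [mh _ fh]]; exists h. Qed.

Lemma aeint_sub D E f : measurable D -> measurable E -> E `<=` D ->
  aeint D f -> aeint E f.
Proof.
move=> mD mE ED [h [mh ih fh]]; exists h; split => //.
  exact: integrableS ih.
exact: aeeq_sub fh.
Qed.

Lemma aeintD D f g : measurable D -> aeint D f -> aeint D g ->
  aeint D (fun t => f t + g t).
Proof.
move=> mD [f' [mf if' ff']] [g' [mg ig gg']]; exists (fun t => f' t + g' t).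
split; first exact: measurable_funD.
  by have := @integrableD _ _ _ mu _ mD _ _ if' ig; apply: eq_integrable.
by apply: ae_imp2 ff' gg' => t ft gt Dt; rewrite ft// gt.
Qed.

Lemma aeintZ D (r : R) f : measurable D -> aeint D f ->
  aeint D (fun t => r * f t).
Proof.
move=> mD [f' [mf if' ff']]; exists (fun t => r * f' t).
split; first by apply: measurable_funM => //; exact: measurable_cst.
  by have := @integrableZl _ _ _ mu _ mD r _ if'; apply: eq_integrable.
by apply: ae_imp ff' => t ft Dt; rewrite ft.
Qed.

Lemma aeintN D f : measurable D -> aeint D f -> aeint D (fun t => - f t).
Proof.
move=> mD /(aeintZ (-1) mD); apply: aeint_ext; apply: eq_aeeq => t _.
by rewrite mulN1r.
Qed.

Lemma aeintB D f g : measurable D -> aeint D f -> aeint D g ->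
  aeint D (fun t => f t - g t).
Proof. by move=> mD mf mg; apply: aeintD => //; exact: aeintN. Qed.

Lemma aeint_norm D f : measurable D -> aeint D f -> aeint D (fun t => `|f t|).
Proof.
move=> mD [f' [mf if' ff']]; exists (fun t => `|f' t|).
split; first exact: measurableT_comp.
  exact: integrable_norm.
by apply: ae_imp ff' => t ft Dt; rewrite ft.
Qed.

(** The Borel representative of f is set to 0 on the null set where the bound
    fails, so that the domination holds everywhere. *)
Lemma aeint_dom D f g : measurable D -> aemeas D f -> aeint D g ->
  {ae mu, forall t, D t -> `|f t| <= g t} -> aeint D f.
Proof.
move=> mD [f' mf ff'] [g' [mg ig gg']] fg.
have [N [mN N0 subN]] :
    {ae mu, forall t, D t -> `|f' t| <= g' t /\ f t = f' t}.
  apply: ae_imp3 ff' gg' fg => t ft gt fgt Dt.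
  by rewrite -ft// -gt//; split => //; exact: fgt.
exists (fun t => f' t * \1_(~` N) t); split.
- by apply: measurable_funM => //; exact: measurable_indic (measurableC mN).
- apply: le_integrable (integrable_abse ig) => //.
    apply/measurable_EFinP; apply: measurable_funTS.
    by apply: measurable_funM => //; exact: measurable_indic (measurableC mN).
  move=> t Dt /=; rewrite indicE normr_id; case: (boolP (t \in ~` N)).
    move=> /set_mem tN; rewrite /= mulr1 lee_fin (le_trans _ (ler_norm _))//.
    have : D t -> `|f' t| <= g' t /\ f t = f' t.
      by apply: contrapT => tn; apply: tN; exact: subN.
    by case/(_ Dt).
  by rewrite /= mulr0 normr0 lee_fin.
exists N; split => // t /= /not_implyP[Dt]; apply: contra_notP => tN.
rewrite indicE mem_set //= mulr1.
have : D t -> `|f' t| <= g' t /\ f t = f' t.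
  by apply: contrapT => tn; apply: tN; exact: subN.
by case/(_ Dt).
Qed.

Lemma RintD D f g : measurable D -> aeint D f -> aeint D g ->
  \int[mu]_(t in D) (f t + g t) =
  \int[mu]_(t in D) f t + \int[mu]_(t in D) g t.
Proof.
move=> mD [f' [mf if' ff']] [g' [mg ig gg']].
rewrite (Rint_ext ff') (Rint_ext gg') -RintegralD//; apply: Rint_ext.
by apply: ae_imp2 ff' gg' => t ft gt Dt; rewrite ft// gt.
Qed.

Lemma RintZ D (r : R) f : measurable D -> aeint D f ->
  \int[mu]_(t in D) (r * f t) = r * \int[mu]_(t in D) f t.
Proof.
move=> mD [f' [mf if' ff']].
rewrite (Rint_ext ff') -RintegralZl//; apply: Rint_ext.
by apply: ae_imp ff' => t ft Dt; rewrite ft.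
Qed.

Lemma RintN D f : measurable D -> aeint D f ->
  \int[mu]_(t in D) (- f t) = - \int[mu]_(t in D) f t.
Proof.
move=> mD iF; rewrite -[RHS]mulN1r -RintZ//; apply: eq_Rintegral => t _.
by rewrite mulN1r.
Qed.

Lemma RintB D f g : measurable D -> aeint D f -> aeint D g ->
  \int[mu]_(t in D) (f t - g t) =
  \int[mu]_(t in D) f t - \int[mu]_(t in D) g t.
Proof. by move=> mD mf mg; rewrite RintD ?RintN//; exact: aeintN. Qed.

Lemma Rintegral_zero D : \int[mu]_(t in D) (0 : R) = 0.
Proof. by rewrite /Rintegral integral0. Qed.

Lemma Rint_ge0 D f : {ae mu, forall t, D t -> 0 <= f t} ->
  0 <= \int[mu]_(t in D) f t.
Proof.
move=> f0; rewrite (@Rint_ext _ _ (fun t => `|f t|)); first exact: Rintegral_ge0.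
by apply: ae_imp f0 => t ft Dt; rewrite ger0_norm// ft.
Qed.

Lemma le_Rint D f g : measurable D -> aeint D f -> aeint D g ->
  {ae mu, forall t, D t -> f t <= g t} ->
  \int[mu]_(t in D) f t <= \int[mu]_(t in D) g t.
Proof.
move=> mD mf mg fg; rewrite -subr_ge0 -RintB//; apply: Rint_ge0.
by apply: ae_imp fg => t fgt /fgt; rewrite subr_ge0.
Qed.

Lemma Rint_norm D f : measurable D -> aeint D f ->
  `|\int[mu]_(t in D) f t| <= \int[mu]_(t in D) `|f t|.
Proof.
move=> mD /[dup] iF [f' [mf if' ff']]; rewrite (Rint_ext ff').
rewrite (@Rint_ext _ (fun t => `|f t|) (fun t => `|f' t|)).
  exact: le_normr_Rintegral.
by apply: ae_imp ff' => t ft Dt; rewrite ft.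
Qed.

Lemma le_Rint_sub D E f : measurable D -> measurable E -> E `<=` D ->
  aeint D f -> {ae mu, forall t, D t -> 0 <= f t} ->
  \int[mu]_(t in E) f t <= \int[mu]_(t in D) f t.
Proof.
move=> mD mE ED iF f0.
have -> : E = D `&` E by apply/seteqP; split => [t Et|t []//]; split => //; exact: ED.
rewrite Rintegral_mkcondr; apply: le_Rint => //.
  apply: (@aeint_dom _ _ (fun t => `|f t|)) => //; last 2 first.
  - exact: aeint_norm.
  - by apply: aeW => t _; rewrite /patch; case: ifP => //; rewrite normr0.
  apply: (@aemeas_ext _ _ (fun t => f t * \1_E t)).
    apply: eq_aeeq => t _; rewrite /patch indicE.
    by case: ifP; rewrite (mulr1, mulr0).
  by apply: aemeasM; [exact: aeint_aemeas|apply: aemeasT; exact: measurable_indic].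
by apply: ae_imp f0 => t ft Dt; rewrite /patch; case: ifP => //; rewrite ft.
Qed.

Lemma aeint_cst (a b r : R) : aeint `]a, b[ (fun=> r).
Proof.
apply: aeint_integrable => //; apply/integrableP; split.
  exact/measurable_EFinP/measurable_cst.
rewrite /= integral_cst//= lebesgue_measure_itv/=.
by case: ifP => _; rewrite ?mule0// -EFinD -EFinM ltry.
Qed.

Lemma Rint_cst (a b r : R) : a <= b -> \int[mu]_(t in `]a, b[) r = r * (b - a).
Proof.
move=> ab; rewrite Rintegral_cst//.
congr (_ * _); have /(congr1 fine) := @lebesgue_measure_itv R `]a, b[%R.
move=> /= ->; rewrite lte_fin; move: ab; rewrite le_eqVlt => /predU1P[->|->//].
by rewrite ltxx subrr.
Qed.

Lemma ae_neq (c : R) : {ae mu, forall t, t <> c}.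
Proof.
exists [set c]; split => //; first exact: lebesgue_measure_set1.
by move=> t /= /contrapT ->.
Qed.

Lemma Rint_itv_split (a b c : R) f : a <= b -> b <= c -> aeint `]a, c[ f ->
  \int[mu]_(t in `]a, c[) f t =
  \int[mu]_(t in `]a, b[) f t + \int[mu]_(t in `]b, c[) f t.
Proof.
move=> ab bc iF.
have sub1 : `]a, b[ `<=` `]a, c[.
  by move=> t /=; rewrite !in_itv/= => /andP[-> /lt_le_trans ->].
have sub2 : `]b, c[ `<=` `]a, c[.
  by move=> t /=; rewrite !in_itv/= => /andP[/(le_lt_trans ab) -> ->].
have [h [mh ih fh]] := iF.
rewrite (Rint_ext fh) (Rint_ext (aeeq_sub sub1 fh)) (Rint_ext (aeeq_sub sub2 fh)).
rewrite -Rintegral_setU//.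
- apply: Rint_dom; apply: ae_imp (ae_neq b) => t tb; split.
    rewrite /= !in_itv/= => /andP[at_ tc].
    by case: (ltgtP t b) => // [tb'|tb']; [left|right]; rewrite ?at_ ?tb'// tb' tc.
  by move=> [/sub1|/sub2].
- apply: integrableS ih => //; first exact: measurableU.
  by move=> t [/sub1|/sub2].
- rewrite disj_set2E; apply/eqP/seteqP; split => // t /= [].
  rewrite !in_itv/= => /andP[_ tb] /andP[bt _].
  by move: (lt_trans tb bt); rewrite ltxx.
Qed.

Definition sqint D f := aemeas D f /\ aeint D (fun t => f t ^+ 2).

Lemma L2_sqint D f : measurable D -> L2 D f -> sqint D f.
Proof.
by move=> mD [mf iF]; split; [exact: aemeas_meas|exact: aeint_integrable].
Qed.

Lemma sqint_ext D f g : aeeq D f g -> sqint D g -> sqint D f.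
Proof.
move=> fg [mg ig]; split; first exact: aemeas_ext mg.
by apply: aeint_ext ig; apply: ae_imp fg => t ft /ft ->.
Qed.

Lemma sqintM D f g : measurable D -> sqint D f -> sqint D g ->
  aeint D (fun t => f t * g t).
Proof.
move=> mD [mf if2] [mg ig2].
apply: (@aeint_dom _ _ (fun t => f t ^+ 2 + g t ^+ 2)) => //.
- exact: aemeasM.
- exact: aeintD.
apply: aeW => t _; rewrite normrM -[f t ^+ 2]real_normK ?num_real//.
rewrite -[g t ^+ 2]real_normK ?num_real//.
by have := sqr_ge0 (`|f t| - `|g t|); have := normr_ge0 (f t);
  have := normr_ge0 (g t); nra.
Qed.

Lemma sqintZ D (r : R) f : measurable D -> sqint D f ->
  sqint D (fun t => r * f t).
Proof.
move=> mD [mf if2]; split; first exact: aemeasZ.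
apply: aeint_ext (aeintZ (r ^+ 2) mD if2).
by apply: eq_aeeq => t _; rewrite exprMn.
Qed.

Lemma sqintD D f g : measurable D -> sqint D f -> sqint D g ->
  sqint D (fun t => f t + g t).
Proof.
move=> mD sf sg; have ifg := sqintM mD sf sg.
move: sf sg => [mf if2] [mg ig2]; split; first exact: aemeasD.
apply: aeint_ext (aeintD mD if2 (aeintD mD (aeintZ 2 mD ifg) ig2)).
by apply: eq_aeeq => t _; ring.
Qed.

Lemma sqint_cst (a b r : R) : sqint `]a, b[ (fun=> r).
Proof. by split; [exact: aemeas_cst|exact: aeint_cst]. Qed.

Lemma sqint_aeint (a b : R) f : sqint `]a, b[ f -> aeint `]a, b[ f.
Proof.
move=> sf; apply: aeint_ext (sqintM _ sf (sqint_cst a b 1)) => //.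
by apply: eq_aeeq => t _; rewrite mulr1.
Qed.

Lemma sqint_norm D f : sqint D f -> sqint D (fun t => `|f t|).
Proof.
move=> [mf if2]; split; first exact: aemeas_norm.
by apply: aeint_ext if2; apply: eq_aeeq => t _; rewrite real_normK ?num_real.
Qed.

Lemma sqint_sub D E f : measurable D -> measurable E -> E `<=` D ->
  sqint D f -> sqint E f.
Proof.
by move=> mD mE ED [mf if2]; split; [exact: aemeas_sub mf|exact: aeint_sub if2].
Qed.

(** The minimiser r = - B / C is used when C > 0; nonnegativity for all r excludes
    C < 0, and forces B = 0 when C = 0. *)
Lemma discriminant_le (A B C : R) :
  (forall r, 0 <= A + r * B *+ 2 + r ^+ 2 * C) -> B ^+ 2 <= A * C.
Proof.
move=> q0; have A0 := q0 0.
have [C0|C0|C0] := ltgtP C 0.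
- have [B0|B0] := eqVneq B 0.
    have := q0 ((A + 1) / (- C) + 1); rewrite B0 mulr0 mul0rn addr0.
    have : 0 <= (A + 1) / - C by apply: divr_ge0; nra.
    have : (A + 1) / - C * C = - (A + 1) by field; lra.
    by set y := _ / _; nra.
  have := q0 (- (B / C)).
  have -> : A + - (B / C) * B *+ 2 + (- (B / C)) ^+ 2 * C = A - B ^+ 2 / C.
    by field; lra.
  have := q0 (- (2 * (B / C))); have := q0 ((A + 1 + `|B|*+2) / - C + 1).
  have B1 : B <= `|B| by exact: ler_norm.
  have : 0 <= (A + 1 + `|B|*+2) / - C by apply: divr_ge0; have := normr_ge0 B; nra.
  have : (A + 1 + `|B|*+2) / - C * C = - (A + 1 + `|B|*+2) by field; lra.
  by set y := _ / _; nra.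
- have := q0 (- (B / C)).
  have -> : A + - (B / C) * B *+ 2 + (- (B / C)) ^+ 2 * C = A - B ^+ 2 / C.
    by field; lra.
  by rewrite subr_ge0 ler_pdivrMr.
- rewrite C0 mulr0; have [->|B0] := eqVneq B 0; first by rewrite expr0n.
  have := q0 (- (A + 1) / (B *+ 2)); rewrite C0 mulr0 addr0.
  have -> : - (A + 1) / (B *+ 2) * B *+ 2 = - (A + 1) by field.
  by move=> h; exfalso; lra.
Qed.

Lemma Cauchy_Schwarz D f g : measurable D -> sqint D f -> sqint D g ->
  (\int[mu]_(t in D) (f t * g t)) ^+ 2 <=
  \int[mu]_(t in D) (f t ^+ 2) * \int[mu]_(t in D) (g t ^+ 2).
Proof.
move=> mD sf sg; apply: discriminant_le => r.
have ifg := sqintM mD sf sg; have if2 := sf.2; have ig2 := sg.2.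
rewrite -mulrnAr -[_ *+ 2]mulr_natl mulrA -!RintZ// -?RintD//;
  [|by apply: aeintD => //; exact: aeintZ|exact: aeintZ|exact: aeintZ].
apply: Rint_ge0; apply: aeW => t _.
have -> : f t ^+ 2 + r * 2 * (f t * g t) + r ^+ 2 * g t ^+ 2 = (f t + r * g t) ^+ 2 by ring.
exact: sqr_ge0.
Qed.

End AeIntegral.

(** * Smooth functions and the fundamental lemma *)

Section SmoothFunctions.
Context {R : realType}.
Implicit Types (phi f g : R -> R).

Lemma smooth_is_derive phi (t : R) : smooth phi ->
  is_derive t 1 phi (derive1 phi t).
Proof. by move=> /(_ 0%N t) dphi; rewrite derive1E; exact: derivableP. Qed.

Lemma smooth_derive1 phi : smooth phi -> smooth (derive1 phi).
Proof. by move=> sphi n t; rewrite -derive1Sn; exact: sphi. Qed.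

Lemma is_derive_derive1 f f' : (forall t : R, is_derive t 1 f (f' t)) ->
  derive1 f = f'.
Proof. by move=> df; apply/funext => t; rewrite derive1E derive_val. Qed.

(** Smoothness by coinduction: a set of functions closed under differentiation
    consists of smooth functions.  Applied to an explicit family of functions,
    it avoids formulas for iterated derivatives. *)
Lemma smooth_coind (S : set (R -> R)) :
  (forall f, S f -> exists2 f', S f' & forall t : R, is_derive t 1 f (f' t)) ->
  forall f, S f -> smooth f.
Proof.
move=> HS f Sf n; elim: n f Sf => [|n IH] f /HS[f' Sf' df] t.
  by have [] := df t.
by rewrite derive1Sn (is_derive_derive1 df); exact: IH.
Qed.

Lemma smooth_cst (c : R) : smooth (fun=> c).
Proof.
apply: (@smooth_coind [set f | exists c, f = fun=> c]); last by exists c.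
by move=> _ [c' ->]; exists (fun=> 0); [exists 0|move=> t; exact: is_derive_cst].
Qed.

Lemma smoothD f g : smooth f -> smooth g -> smooth (fun t => f t + g t).
Proof.
move=> sf sg; apply: (@smooth_coind [set h | exists f g,
  [/\ smooth f, smooth g & h = fun t => f t + g t]]); last by exists f, g.
move=> _ [f1 [g1 [sf1 sg1 ->]]]; exists (fun t => derive1 f1 t + derive1 g1 t).
  exists (derive1 f1), (derive1 g1); split; [exact: smooth_derive1|exact: smooth_derive1|reflexivity].
move=> t; have df := smooth_is_derive t sf1; have dg := smooth_is_derive t sg1.
exact: is_deriveD.
Qed.

(** Derivatives of products are sums of products, so this family is closed under
    differentiation. *)
Inductive product_sum : (R -> R) -> Prop :=
| ProductSumM f g : smooth f -> smooth g -> product_sum (fun t => f t * g t)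
| ProductSumD f g : product_sum f -> product_sum g ->
    product_sum (fun t => f t + g t).

Lemma smoothM f g : smooth f -> smooth g -> smooth (fun t => f t * g t).
Proof.
move=> sf sg; apply: (@smooth_coind product_sum); last exact: ProductSumM.
move=> h; elim=> {h f g sf sg} [f g sf sg|f g _ [f' sf' df] _ [g' sg' dg]].
- exists (fun t => f t * derive1 g t + g t * derive1 f t).
    apply: ProductSumD; apply: ProductSumM; [exact: sf|exact: smooth_derive1|
      exact: sg|exact: smooth_derive1].
  move=> t; have df := smooth_is_derive t sf; have dg := smooth_is_derive t sg.
  exact: is_deriveM.
- exists (fun t => f' t + g' t); first exact: ProductSumD.
  by move=> t; exact: is_deriveD.
Qed.

Lemma smoothZ (r : R) f : smooth f -> smooth (fun t => r * f t).
Proof. by apply: smoothM; exact: smooth_cst. Qed.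

Lemma smooth_affine (c d : R) f : smooth f -> smooth (fun t => f (c * t + d)).
Proof.
move=> sf; apply: (@smooth_coind [set h | exists k f, smooth f /\
   h = fun t => k * f (c * t + d)]).
  move=> _ [k [g [sg ->]]]; exists (fun t => (k * c) * derive1 g (c * t + d)).
    exists (k * c), (derive1 g); split; [exact: smooth_derive1|reflexivity].
  move=> t; have dg := smooth_is_derive (c * t + d) sg.
  have da : is_derive t 1 (fun t : R => c * t + d) c.
    apply: (@is_derive_eq _ _ _ _ _ _ _ _
      (is_deriveD (is_deriveZ c (is_derive_id t (1 : R))) (is_derive_cst d t 1))).
    by rewrite addr0; exact: mulr1.
  have dc := @is_derive1_comp _ g (fun t : R => c * t + d) t _ _ dg da.
  apply: (@is_derive_eq _ _ _ _ _ _ _ _ (is_deriveZ k dc)).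
  by rewrite -[LHS]/(k * (derive1 g (c * t + d) * c)); ring.
exists 1, f; split => //.
by apply/funext => t; rewrite mul1r.
Qed.

Lemma smooth_primitive f F : smooth f ->
  (forall t : R, is_derive t 1 F (f t)) -> smooth F.
Proof.
move=> sf dF; apply: (@smooth_coind [set h | h = F \/ smooth h]); last by left.
move=> h [->|sh]; first by exists f; [right|exact: dF].
exists (derive1 h); first by right; exact: smooth_derive1.
by move=> t; exact: smooth_is_derive.
Qed.

Lemma smooth_continuous f : smooth f -> continuous f.
Proof.
by move=> sf t; apply/differentiable_continuous/derivable1_diffP; exact: (sf 0%N t).
Qed.

(** The functions p(1/t) exp(-1/t), extended by 0 to t <= 0.  They are closed under
    differentiation, and p = 1 is the standard smooth function vanishing for
    t <= 0. *)
Definition flat (p : {poly R}) (t : R) : R :=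
  if 0 < t then p.[t^-1] * expR (- t^-1) else 0.

Lemma poly_bound (p : {poly R}) : exists2 C : R, 0 <= C &
  forall s, 1 <= s -> `|p.[s]| <= C * s ^+ size p.
Proof.
exists (\sum_(i < size p) `|p`_i|); first exact: sumr_ge0.
move=> s s1; rewrite horner_coef (le_trans (ler_norm_sum _ _ _))// mulr_suml.
apply: ler_sum => i _; rewrite normrM ler_wpM2l// normrX ger0_norm ?(le_trans _ s1)//.
by rewrite ler_weXn2l// ltnW.
Qed.

(** exp(1/t) dominates the power size p + 2 of 1/t, two more than needed to
    compensate the polynomial. *)
Lemma flat_bound (p : {poly R}) : exists2 K : R, 0 <= K &
  forall t, t <= 1 -> `|flat p t| <= K * t ^+ 2.
Proof.
have [C C0 pC] := poly_bound p.
exists (C * ((size p).+2)`!%:R) => [|t t1]; first by rewrite mulr_ge0.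
rewrite /flat; case: ltP => t0; last by rewrite normr0 mulr_ge0 ?sqr_ge0// mulr_ge0.
rewrite normrM [`|expR _|]ger0_norm ?expR_ge0// expRN.
have s1 : 1 <= t^-1 by rewrite invf_ge1.
have := expR_ge1Dxn (size p).+1 (le_trans ler01 s1).
set N := (_)`!%:R; set s := t^-1 => h.
have N0 : 0 < N by rewrite ltr0n fact_gt0.
have s0 : 0 < s by apply: lt_le_trans s1.
have h' : s ^+ (size p).+2 / N <= expR s by apply: le_trans h; rewrite lerDr.
apply: (@le_trans _ _ (C * s ^+ size p * (N / s ^+ (size p).+2))).
  apply: ler_pM; [exact: normr_ge0|by rewrite invr_ge0 expR_ge0|exact: pC|].
  by rewrite -[N / _]invrK invf_div lef_pV2// posrE ?expR_gt0// divr_gt0// exprn_gt0.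
rewrite !exprS; have -> : t = s^-1 by rewrite /s invrK.
by rewrite le_eqVlt; apply/orP; left; apply/eqP; field; rewrite expf_neq0 ?gt_eqF.
Qed.

(** At the origin the derivative is 0 by the quadratic bound; elsewhere it is the
    chain rule, d/dt being - s ^ 2 d/ds in the variable s = 1/t. *)
Lemma is_derive_flat (p : {poly R}) (t : R) :
  is_derive t 1 (flat p) (flat ('X^2 * (p - p^`())) t).
Proof.
have [t0|t0|t0] := ltgtP t 0.
- have -> : flat ('X^2 * (p - p^`())) t = 0 by rewrite /flat ltNge ltW.
  apply: (@near_eq_is_derive _ _ _ (cst 0)) => //.
  near=> s; rewrite /flat ifF//; apply/negbTE; rewrite -leNgt ltW//.
  by near: s; exact: lt_nbhsl.
- have -> : flat ('X^2 * (p - p^`())) t =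
    p^`().[t^-1] * (- t ^- 2) * expR (- t^-1) + p.[t^-1] * (expR (- t^-1) * t ^- 2).
    rewrite /flat t0 hornerM hornerD hornerN hornerXn; set e := expR _.
    by rewrite exprVn; ring.
  apply: (@near_eq_is_derive _ _ _ (fun t : R => p.[t^-1] * expR (- t^-1) : R)).
    near=> s; rewrite /flat ifT//; near: s; exact: lt_nbhsr.
  have dV : is_derive t 1 (fun t : R => t^-1) (- t ^- 2).
    have tn0 : (id t : R) != 0 by rewrite gt_eqF.
    by apply: (is_derive_eq (is_deriveV tn0 (is_derive_id t (1 : R)))); exact: mulr1.
  have dp := @is_derive1_comp _ (horner p) (fun t : R => t^-1) t _ _ (is_derive_poly _ _) dV.
  have dN : is_derive t 1 (fun t : R => - t^-1) (t ^- 2).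
    by apply: (is_derive_eq (is_deriveN dV)); rewrite opprK.
  have de := @is_derive1_comp _ expR (fun t : R => - t^-1) t _ _ (is_derive_expR _) dN.
  apply: (@is_derive_eq _ _ _ _ _ _ _ _ (is_deriveM dp de)).
  by rewrite /GRing.scale/= addrC; congr (_ + _); rewrite mulrC.
- rewrite t0 /flat ltxx; have [K' K'0 pK'] := flat_bound p.
  (* positive, to be divided by below *)
  pose K := K' + 1; have K0 : 0 < K by rewrite ltr_wpDl.
  have pK y : y <= 1 -> `|flat p y| <= K * y ^+ 2.
    by move=> /pK' /le_trans; apply; rewrite ler_wpM2r ?sqr_ge0// lerDl.
  suff h : h^-1 *: (flat p (h *: 1 + 0) - flat p 0) @[h --> 0^'] --> (0 : R).
    apply: DeriveDef; first by apply/cvg_ex; exists 0.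
    by apply/cvg_lim.
  have p0 : flat p 0 = 0 by rewrite /flat ltxx.
  apply/cvgrPdist_le => e e0; near=> h.
  rewrite sub0r normrN addr0 p0 subr0 /GRing.scale/= mulr1 normrM normfV.
  have h0 : h != 0 by near: h; exact: nbhs_dnbhs_neq.
  have h0' : 0 < `|h| by rewrite normr_gt0.
  rewrite mulrC ler_pdivrMr//.
  have h1 : h <= 1 by apply: ltW; near: h; apply: nbhs_dnbhs; exact: lt_nbhsl.
  apply: (le_trans (pK _ h1)).
  rewrite -[h ^+ 2]real_normK ?num_real// expr2 mulrA ler_pM2r//.
  rewrite mulrC -ler_pdivlMr//.
  near: h; apply: nbhs_dnbhs.
  have eK : 0 < e / K by rewrite divr_gt0.
  apply/nbhs_ballP; exists (e / K) => //= y.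
  by rewrite /ball/= sub0r normrN => /ltW.
Unshelve. all: by end_near. Qed.

Lemma smooth_flat p : smooth (flat p).
Proof.
apply: (@smooth_coind [set h | exists p, h = flat p]); last by exists p.
move=> _ [q ->]; exists (flat ('X^2 * (q - q^`()))); first by eexists.
exact: is_derive_flat.
Qed.

Lemma flat1_ge0 t : 0 <= flat 1 t.
Proof. by rewrite /flat; case: ifP => // _; rewrite hornerE mul1r expR_ge0. Qed.

Lemma flat1_le1 t : flat 1 t <= 1.
Proof.
rewrite /flat; case: ifP => // t0; rewrite hornerE mul1r expR_le1 oppr_le0.
by rewrite invr_ge0 ltW.
Qed.

Lemma cvg_flat1 (r : R) : 0 < r -> flat 1 (n.+1%:R * r) @[n --> \oo] --> (1 : R).
Proof.
move=> r0; rewrite -[X in _ --> X]expR0.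
have -> : (fun n => flat 1 (n.+1%:R * r)) = (fun n => expR (- (r^-1 * (n.+1%:R)^-1))).
  apply/funext => n; rewrite /flat mulr_gt0// hornerE mul1r invfM.
  by rewrite mulrC.
apply: cvg_comp; last exact: continuous_expR.
rewrite -oppr0 -[X in - X](mulr0 r^-1); apply: cvgN; apply: cvgM; first exact: cvg_cst.
exact: cvg_harmonic.
Qed.

Lemma test_smooth (a b : R) phi : test_function a b phi -> smooth phi.
Proof. by case. Qed.

(** As n grows, these functions increase to the indicator of ]c, d[. *)
Definition smooth_bump (c d : R) (n : nat) (t : R) : R :=
  flat 1 (n.+1%:R * (t - c)) * flat 1 (n.+1%:R * (d - t)).

Lemma test_bump (a b c d : R) n : a < c -> d < b -> test_function a b (smooth_bump c d n).
Proof.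
move=> ac db; split.
  apply: smoothM.
    have := @smooth_affine n.+1%:R (- (n.+1%:R * c)) _ (smooth_flat (p := 1)).
    by congr smooth; apply/funext => t; rewrite mulrBr.
  have := @smooth_affine (- n.+1%:R) (n.+1%:R * d) _ (smooth_flat (p := 1)).
  by congr smooth; apply/funext => t; rewrite mulrBr addrC mulNr.
exists c, d; split => // t /negP; rewrite negb_and -!ltNge /smooth_bump /flat.
rewrite !pmulr_rgt0 ?ltr0n// !subr_gt0 => /orP[tc|dt].
  by rewrite ltNge (ltW tc)/= mul0r.
by rewrite [t < d]ltNge (ltW dt)/= mulr0.
Qed.

Lemma bump_ge0 c d n t : 0 <= smooth_bump c d n t.
Proof. by rewrite mulr_ge0 ?flat1_ge0. Qed.

Lemma bump_le1 c d n t : smooth_bump c d n t <= 1.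
Proof. by rewrite -[leRHS]mul1r ler_pM ?flat1_ge0 ?flat1_le1. Qed.

Lemma bump_eq0 c d n t : ~ (c < t < d) -> smooth_bump c d n t = 0.
Proof.
move=> /negP; rewrite negb_and -!leNgt /smooth_bump /flat.
rewrite !pmulr_rgt0 ?ltr0n// !subr_gt0 => /orP[tc|dt].
  by rewrite ltNge tc/= mul0r.
by rewrite [t < d]ltNge dt/= mulr0.
Qed.

Lemma bump_gt0 c d n t : c < t < d -> 0 < smooth_bump c d n t.
Proof.
move=> /andP[ct td]; rewrite mulr_gt0// /flat !pmulr_rgt0 ?ltr0n// subr_gt0.
  by rewrite ct hornerE mul1r expR_gt0.
by rewrite td hornerE mul1r expR_gt0.
Qed.

Lemma cvg_bump c d t : smooth_bump c d n t @[n --> \oo] --> (\1_`]c, d[ t : R).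
Proof.
rewrite indicE; have [tcd|tcd] := boolP (t \in `]c, d[%classic).
  move/set_mem: tcd => /=; rewrite in_itv/= => /andP[ct td].
  by rewrite -[X in _ --> X]mulr1; apply: cvgM; apply: cvg_flat1; rewrite subr_gt0.
apply: cvg_near_cst; apply: nearW => n; apply: bump_eq0.
by move: tcd => /negP; apply: contra_not => h; apply/mem_set; rewrite /= in_itv.
Qed.

End SmoothFunctions.

Section FundamentalLemma.
Context {R : realType}.
Notation mu := (@lebesgue_measure R).
Implicit Types (D : set R) (f g : R -> R).

Lemma cvg_Rint_dominated D (F : nat -> R -> R) f g : measurable D ->
  (forall n, measurable_fun setT (F n)) -> measurable_fun setT f ->
  mu.-integrable D (EFin \o g) ->
  (forall n t, D t -> `|F n t| <= g t) ->
  (forall t, D t -> F n t @[n --> \oo] --> f t) ->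
  (\int[mu]_(t in D) F n t) @[n --> \oo] --> \int[mu]_(t in D) f t.
Proof.
move=> mD mF mf ig Fg Ff.
have mE (h : R -> R) : measurable_fun setT h -> measurable_fun D (EFin \o h).
  by move=> mh; apply/measurable_EFinP; exact: measurable_funTS.
have FfE : {ae mu, forall t, D t -> (EFin \o F n) t @[n --> \oo] --> (EFin \o f) t}.
  by apply: aeW => t Dt; apply: cvg_EFin; [exact: nearW|exact: Ff].
have FgE : {ae mu, forall t n, D t -> (`|(EFin \o F n) t| <= (EFin \o g) t)%E}.
  by apply: aeW => t n Dt; rewrite /= lee_fin; exact: Fg.
have [if' _ h] := @dominated_convergence _ _ _ mu D mD (fun n => EFin \o F n)
  (EFin \o f) (EFin \o g) (fun n => mE _ (mF n)) (mE _ mf) FfE ig FgE.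
apply: fine_cvg; rewrite fineK; first exact: h.
exact: integrable_fin_num.
Qed.

(** The primitive of g is constant, so its derivative, which is g almost everywhere
    by the Lebesgue differentiation theorem, vanishes. *)
Lemma integral0_oo a b g : aeint `]a, b[ g ->
  (forall c d, a < c -> c < d -> d < b -> \int[mu]_(t in `]c, d[) g t = 0) ->
  aeeq `]a, b[ g (fun=> 0).
Proof.
move=> [h [mh ih gh]] g0.
have [ba|ab] := leP b a.
  apply: eq_aeeq => t /=; rewrite in_itv/= => /andP[at_ tb].
  by move: (lt_trans at_ tb); rewrite ltNge ba.
pose k := h \_ `]a, b[.
have ik : mu.-integrable setT (EFin \o k).
  rewrite /k -restrict_EFin.
  by have /(_ ih) := (@integrable_mkcond _ _ _ mu `]a, b[%classic (EFin \o h) (measurable_itv _)).1.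
have ikS D : measurable D -> mu.-integrable D (EFin \o k).
  by move=> mD; apply: integrableS ik.
have lk : locally_integrable setT k.
  split => //; first by have /integrableP[/measurable_EFinP] := ik.
    exact: openT.
  move=> K _ cK; have /integrableP[_ +] := ikS K (compact_measurable cK).
  by [].
have := @FTC1Ny R k (fun y => ikS _ (measurable_itv _)) lk.
have kE t : a < t < b -> k t = h t.
  by move=> tab; rewrite /k patchT// inE /= in_itv.
suff H x : a < x < b -> derive1 (fun x => \int[mu]_(t in `]-oo, x]) k t) x = 0.
  apply: ae_imp2 gh => t gt [_ kt] /[dup] Dt; rewrite /= in_itv/= => tab.
  by rewrite gt// -kE// -kt H.
move=> /andP[ax xb]; rewrite derive1E.
set F := fun _ => _.
have FE y : a < y < b -> F y = F x.
  move=> /andP[ay yb].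
  wlog : x y ax xb ay yb / x < y.
    move=> W; case: (ltgtP x y) => [|yx|->//]; first exact: W.
    by apply/esym; exact: W.
  move=> xy; apply/eqP; rewrite -subr_eq0; apply/eqP.
  rewrite /F Rintegral_itvB ?bnd_simp ?ltW//; last exact: ikS.
  rewrite -[RHS](g0 x y)// (@Rint_dom _ _ `]x, y[).
    apply: (@Rint_ext _ `]x, y[ k g).
    apply: ae_imp gh => t gt /=; rewrite in_itv/= => /andP[xt ty].
    have tab : a < t < b by rewrite (lt_trans ax)//= (lt_trans ty).
    by rewrite kE// gt//= in_itv.
  apply: ae_imp (ae_neq y) => t ty; rewrite /= !in_itv/=.
  by rewrite [t <= y]le_eqVlt (introF eqP ty).
rewrite (@near_eq_derive _ _ _ F (cst (F x))); first by rewrite derive_cst.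
near=> y; rewrite /= FE//; apply/andP; split; near: y.
  exact: lt_nbhsr.
exact: lt_nbhsl.
Unshelve. all: by end_near. Qed.

(** The indicator of an interval ]c, d[ is a bounded limit of test functions, so the
    integral of g over ]c, d[ vanishes by dominated convergence. *)
Lemma fundamental_lemma a b g : aeint `]a, b[ g ->
  (forall phi, test_function a b phi ->
    \int[mu]_(t in `]a, b[) (g t * phi t) = 0) ->
  aeeq `]a, b[ g (fun=> 0).
Proof.
move=> ig g0; apply: integral0_oo => // c d ac cd db.
have [h [mh ih gh]] := ig.
have -> : \int[mu]_(t in `]c, d[) g t = \int[mu]_(t in `]a, b[) (h t * \1_`]c, d[ t).
  have -> : `]c, d[%classic = `]a, b[ `&` `]c, d[.
    apply/seteqP; split => t /=; rewrite !in_itv/=; last by case.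
    by move=> /andP[ct td]; rewrite ct td (lt_trans ac)//= (lt_trans td).
  rewrite Rintegral_mkcondr; apply: Rint_ext.
  apply: ae_imp gh => t gt Dt; rewrite /patch indicE.
  have -> : (t \in `]a, b[ `&` `]c, d[) = (t \in `]c, d[%classic).
    by rewrite in_setI (mem_set Dt).
  by case: ifP; rewrite (mulr1, mulr0)// gt.
have mb n : measurable_fun setT (@smooth_bump R c d n).
  apply: continuous_measurable_fun; apply: smooth_continuous.
  by have [] := @test_bump R a b c d n ac db.
have cv : (\int[mu]_(t in `]a, b[) (h t * smooth_bump c d n t)) @[n --> \oo] -->
    \int[mu]_(t in `]a, b[) (h t * \1_`]c, d[ t).
  apply: (@cvg_Rint_dominated _ _ _ (fun t => `|h t|)) => //.
  - by move=> n; exact: measurable_funM.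
  - by apply: measurable_funM => //; exact: measurable_indic.
  - exact: integrable_norm.
  - move=> n t _; rewrite normrM -[leRHS]mulr1 ler_wpM2l//.
    by rewrite ger0_norm ?bump_le1 ?bump_ge0.
  - by move=> t _; apply: cvgM; [exact: cvg_cst|exact: cvg_bump].
rewrite -(cvg_lim _ cv)//; apply/cvg_lim => //; apply: cvg_near_cst.
apply: nearW => n; rewrite -(g0 (smooth_bump c d n)); last exact: test_bump.
by apply: Rint_ext; apply: ae_imp gh => t gt Dt; rewrite gt.
Qed.

End FundamentalLemma.

(** * Primitives and weak derivatives *)

Section Primitives.
Context {R : realType}.
Notation mu := (@lebesgue_measure R).
Implicit Types (D : set R) (f g : R -> R).

Definition prim (a : R) g (t : R) := \int[mu]_(s in `]a, t[) g s.

Lemma aeint_global D g : measurable D -> aeint D g -> exists k : R -> R,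
  [/\ measurable_fun setT k, mu.-integrable setT (EFin \o k),
      aeeq D g k & forall t, ~ D t -> k t = 0].
Proof.
move=> mD [h [mh ih gh]]; exists (h \_ D).
have iT : mu.-integrable setT (EFin \o h \_ D).
  rewrite -restrict_EFin.
  by have /(_ ih) := (@integrable_mkcond _ _ _ mu D (EFin \o h) mD).1.
split => //.
- by have /measurable_int/measurable_EFinP := iT.
- by apply: ae_imp gh => t gt Dt; rewrite patchT ?inE// gt.
- by move=> t Dt; rewrite patchN// notin_setE.
Qed.

Lemma sub_itvoo (a b c d : R) : a <= c -> d <= b -> `]c, d[ `<=` `]a, b[.
Proof.
move=> ac db t /=; rewrite !in_itv/= => /andP[/(le_lt_trans ac) -> td].
exact: lt_le_trans td db.
Qed.

Lemma aeint_itv (a b c d : R) g : a <= c -> d <= b -> aeint `]a, b[ g ->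
  aeint `]c, d[ g.
Proof. by move=> ac db; apply: aeint_sub => //; exact: sub_itvoo. Qed.

Lemma prim_ext (a b t : R) f g : t <= b -> aeeq `]a, b[ f g ->
  prim a f t = prim a g t.
Proof.
by move=> tb fg; apply: Rint_ext; apply: aeeq_sub fg; exact: sub_itvoo.
Qed.

Lemma prim_le (a t : R) g : t <= a -> prim a g t = 0.
Proof.
move=> ta; rewrite /prim (_ : `]a, t[%classic = set0) ?Rintegral_set0//.
apply/seteqP; split => // s /=; rewrite in_itv/= => /andP[/lt_trans as_] /as_.
by rewrite ltNge ta.
Qed.

Lemma prim_split (a b c t : R) g : a <= c -> c <= t -> t <= b -> aeint `]a, b[ g ->
  prim a g t = prim a g c + prim c g t.
Proof. by move=> ac ct tb ig; apply: Rint_itv_split => //; apply: aeint_itv ig. Qed.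

Lemma prim_continuous (a b : R) g : a <= b -> aeint `]a, b[ g ->
  {within `[a, b], continuous (prim a g)}.
Proof.
move=> ab /aeint_global[//|k [mk ik gk k0]].
have := @parameterized_integral_continuous R a b k ab
  (@integrableS _ _ _ mu _ _ _ measurableT (measurable_itv _) (@subsetT _ _) ik).
apply: subspace_eq_continuous => t /set_mem /=; rewrite in_itv/= => /andP[at_ tb].
rewrite /from_subspace/= /parameterized_integral (prim_ext tb gk).
apply: Rint_dom; apply: ae_imp2 (ae_neq a) (ae_neq t) => s sa st.
rewrite /= !in_itv/= !le_eqVlt (introF eqP st) (negbTE (introN eqP (nesym sa))).
by [].
Qed.

Lemma prim_norm (a b t : R) g : a <= b -> t <= b -> aeint `]a, b[ g ->
  `|prim a g t| <= \int[mu]_(s in `]a, b[) `|g s|.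
Proof.
move=> ab tb ig; apply: le_trans (Rint_norm _ (aeint_itv (lexx a) tb ig)) _ => //.
apply: le_Rint_sub => //; first exact: sub_itvoo.
  exact: aeint_norm.
by apply: aeW => s _.
Qed.

Lemma aemeas_prim (a b : R) g : aeint `]a, b[ g -> aemeas `]a, b[ (prim a g).
Proof.
move=> ig; have [ab|ba] := ltP a b.
  apply: (@aemeas_sub _ `[a, b]); first exact: subset_itv_oo_cc.
  apply: aemeas_meas => //; apply: subspace_continuous_measurable_fun => //.
  by apply: prim_continuous => //; exact: ltW.
apply: aemeas_ext (aemeas_cst _ 0); apply: eq_aeeq => t /=; rewrite in_itv/=.
by move=> /andP[/lt_trans h] /h; rewrite ltNge ba.
Qed.

Lemma aeint_mul_prim (a b : R) f g : a <= b -> aeint `]a, b[ f -> aeint `]a, b[ g ->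
  aeint `]a, b[ (fun t => f t * prim a g t).
Proof.
move=> ab jf ig.
apply: (@aeint_dom _ _ _ (fun t => (\int[mu]_(s in `]a, b[) `|g s|) * `|f t|)) => //.
- by apply: aemeasM; [exact: aeint_aemeas|exact: aemeas_prim].
- by apply: aeintZ => //; exact: aeint_norm.
apply: aeW => t /=; rewrite in_itv/= => /andP[_ tb].
by rewrite normrM mulrC ler_wpM2r// prim_norm// ltW.
Qed.

Lemma aeint_prim (a b : R) g : aeint `]a, b[ g -> aeint `]a, b[ (prim a g).
Proof.
move=> ig; have [ab|ba] := ltP a b; last first.
  apply: aeint_ext (@aeint_cst _ a b 0); apply: eq_aeeq => t /=; rewrite in_itv/=.
  by move=> /andP[/lt_trans h] /h; rewrite ltNge ba.
apply: aeint_ext (aeint_mul_prim (ltW ab) (@aeint_cst _ a b 1) ig).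
by apply: eq_aeeq => t _; rewrite mul1r.
Qed.

Lemma RFubini (K : R -> R -> R) :
  (mu \x mu)%E.-integrable setT (fun z => (K z.1 z.2)%:E) ->
  \int[mu]_s (\int[mu]_t K s t) = \int[mu]_t (\int[mu]_s K s t).
Proof.
move=> iK; have := Fubini iK; rewrite /= => FK.
rewrite /Rintegral.
have -> : (\int[mu]_s (fine (\int[mu]_t (K s t)%:E))%:E =
    \int[mu]_s (\int[mu]_t (K s t)%:E))%E.
  apply: integral_ae_ext; apply: ae_imp (ae_integrable1 iK) => s ik _.
  by rewrite fineK//; exact: (integrable_fin_num measurableT ik).
rewrite FK; congr fine; apply: integral_ae_ext.
apply: ae_imp (ae_integrable2 iK) => s ik _.
by rewrite fineK//; exact: (integrable_fin_num measurableT ik).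
Qed.

Lemma integrable_triangle (f g : R -> R) :
  measurable_fun setT f -> mu.-integrable setT (EFin \o f) ->
  measurable_fun setT g -> mu.-integrable setT (EFin \o g) ->
  (mu \x mu)%E.-integrable setT
    (fun z => (f z.1 * g z.2 * \1_[set z : R * R | z.2 < z.1] z)%:E).
Proof.
move=> mf jf mg ig.
have mfg : measurable_fun setT (fun z : R * R => f z.1 * g z.2).
  by apply: measurable_funM; apply: measurableT_comp.
have mlt : measurable [set z : R * R | z.2 < z.1].
  have := @measurable_fun_ltr _ _ _ setT (snd : R * R -> R) (fst : R * R -> R)
    measurable_snd measurable_fst.
  move=> /(_ measurableT [set true]); rewrite setTI; apply => //.
have : (mu \x mu)%E.-integrable setT (fun z : R * R => (f z.1 * g z.2)%:E).
  apply/integrable12ltyP; first exact/measurable_EFinP.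
  have -> : (\int[mu]_x \int[mu]_y `|(f (x, y).1 * g (x, y).2)%:E|)%E =
    (\int[mu]_x (`|f x|%:E * \int[mu]_y (`|g y|)%:E))%E.
    apply: eq_integral => x _; rewrite -ge0_integralZl//.
    - by apply: eq_integral => y _; rewrite /= normrM EFinM.
    - by apply/measurable_EFinP; exact: measurableT_comp.
  have /integrableP[_ fy] := jf; have /integrableP[_ gy] := ig.
  rewrite ge0_integralZr//.
  - apply: lte_mul_pinfty => //; first exact: integral_ge0.
    by rewrite ge0_fin_numE//; exact: integral_ge0.
  - by apply/measurable_EFinP; exact: measurableT_comp.
  - exact: integral_ge0.
apply: le_integrable => //.
  by apply/measurable_EFinP; apply: measurable_funM => //; exact: measurable_indic.
move=> z _ /=; rewrite lee_fin normrM -[leRHS]mulr1 ler_wpM2l//.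
by rewrite indicE; case: (_ \in _); rewrite ?normr1 ?normr0.
Qed.

Lemma prim_global (a b : R) g : (forall t, ~ `]a, b[%classic t -> g t = 0) ->
  forall t, t <= b -> prim a g t = \int[mu]_s (g s * \1_[set s : R | s < t] s).
Proof.
move=> g0 t tb; rewrite /prim Rintegral_mkcond; apply: eq_Rintegral => s _.
rewrite /patch indicE; case: ifPn => [/set_mem/= | /negP h].
  by rewrite in_itv/= => /andP[as_ st]; rewrite mem_set// mulr1.
have [st|st] := boolP (s \in [set s : R | s < t]); last by rewrite mulr0.
rewrite g0 ?mul0r//= => /=; rewrite in_itv/= => /andP[as_ sb]; apply: h.
by apply/mem_set; rewrite /= in_itv/= as_; exact/set_mem.
Qed.

(** Both integrals are integrals of f(t) g(s), over the triangle s < t for the first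
    and over the triangle t < s for the second; their sum is the integral over
    the square by Fubini. *)
Lemma integration_by_parts_prim (a b : R) f g : a <= b ->
  aeint `]a, b[ f -> aeint `]a, b[ g ->
  \int[mu]_(t in `]a, b[) (f t * prim a g t) +
  \int[mu]_(t in `]a, b[) (g t * prim a f t) = prim a f b * prim a g b.
Proof.
move=> ab /[dup] jf /aeint_global[//|f' [mf' if' ff' f0]].
move=> /[dup] ig /aeint_global[//|g' [mg' ig' gg' g0]].
have aeF : aeint setT f' by exact: aeint_integrable.
have aeG : aeint setT g' by exact: aeint_integrable.
have aeI (u : R -> R) (A : set R) : measurable A -> aeint setT u ->
    aeint setT (fun t => u t * \1_A t).
  move=> mA iu; apply: (@aeint_dom _ _ _ (fun t => `|u t|)) => //.
  - apply: aemeasM; first exact: aeint_aemeas.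
    by apply: aemeasT; exact: measurable_indic.
  - exact: aeint_norm.
  - apply: aeW => t _; rewrite normrM -[leRHS]mulr1 ler_wpM2l// indicE.
    by case: (_ \in _); rewrite ?normr1 ?normr0.
pose T t s : R := \1_[set z : R * R | z.2 < z.1] (t, s).
have TE1 t s : T t s = \1_[set s | s < t] s.
  rewrite /T !indicE; congr (nat_of_bool _)%:R.
have TE2 t s : T t s = \1_[set t | s < t] t.
  rewrite /T !indicE; congr (nat_of_bool _)%:R.
have mT1 (t : R) : measurable [set s : R | s < t].
  by rewrite -set_itvNyo; exact: measurable_itv.
have mT2 (s : R) : measurable [set t : R | s < t].
  by rewrite -set_itvoy; exact: measurable_itv.
have -> : \int[mu]_(t in `]a, b[) (f t * prim a g t) =
    \int[mu]_t \int[mu]_s (f' t * g' s * T t s).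
  transitivity (\int[mu]_(t in `]a, b[) (f' t * prim a g' t)).
    apply: Rint_ext; apply: ae_imp ff' => t ft /[dup] Dt.
    rewrite /= in_itv/= => /andP[_ /ltW tb].
    by rewrite ft// (prim_ext tb gg').
  rewrite Rintegral_mkcond; apply: eq_Rintegral => t _.
  rewrite /patch; case: ifPn => [/set_mem Dt|/negP Dt]; last first.
    have -> : f' t = 0 by apply: f0 => h; apply: Dt; exact/mem_set.
    by under eq_Rintegral do rewrite !mul0r; rewrite Rintegral_zero.
  have /andP[_ /ltW tb] : a < t < b by move: Dt; rewrite /= in_itv.
  rewrite (prim_global g0 tb) -RintZ//; last exact: aeI.
  by apply: eq_Rintegral => s _; rewrite TE1 mulrA.
rewrite (RFubini (integrable_triangle mf' if' mg' ig')).
have -> : \int[mu]_s (\int[mu]_t (f' t * g' s * T t s)) =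
    \int[mu]_(s in `]a, b[) (prim a f b * g s - g s * prim a f s).
  transitivity (\int[mu]_(s in `]a, b[) (g' s * (prim a f' b - prim a f' s))).
    rewrite [RHS]Rintegral_mkcond; apply: eq_Rintegral => s _.
    rewrite /patch; case: ifPn => [/set_mem Ds|/negP Ds]; last first.
      have -> : g' s = 0 by apply: g0 => h; apply: Ds; exact/mem_set.
      by under eq_Rintegral do rewrite mulr0 mul0r; rewrite Rintegral_zero.
    have /andP[/ltW as_ /ltW sb] : a < s < b by move: Ds; rewrite /= in_itv.
    have aeF' : aeint `]a, b[ f' by apply: aeint_sub aeF.
    rewrite (prim_split as_ sb (lexx b) aeF') addrAC subrr add0r.
    have -> : prim s f' b = \int[mu]_t (f' t * \1_[set t | s < t] t).
      rewrite /prim Rintegral_mkcond; apply: eq_Rintegral => t _.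
      rewrite /patch indicE; case: ifPn => [/set_mem/= | /negP h].
        by rewrite in_itv/= => /andP[st tb]; rewrite mem_set// mulr1.
      have [st|st] := boolP (t \in [set t : R | s < t]); last by rewrite mulr0.
      rewrite f0 ?mul0r//= => /=; rewrite in_itv/= => /andP[at_ tb]; apply: h.
      by apply/mem_set; rewrite /= in_itv/= tb andbT; exact/set_mem.
    rewrite -RintZ//; last exact: aeI.
    by apply: eq_Rintegral => t _; rewrite TE2; ring.
  apply: Rint_ext; apply: ae_imp gg' => t gt /[dup] Dt.
  rewrite /= in_itv/= => /andP[_ /ltW tb].
  rewrite gt// (prim_ext tb ff') (prim_ext (lexx b) ff'); ring.
rewrite RintB//; [|exact: aeintZ|exact: aeint_mul_prim].
by rewrite subrK RintZ.
Qed.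

Lemma integration_by_parts_ae (a b c d : R) f g u v : a <= b ->
  aeint `]a, b[ f -> aeint `]a, b[ g ->
  aeeq `]a, b[ u (fun t => c + prim a f t) ->
  aeeq `]a, b[ v (fun t => d + prim a g t) ->
  \int[mu]_(t in `]a, b[) (f t * v t) + \int[mu]_(t in `]a, b[) (g t * u t) =
  (c + prim a f b) * (d + prim a g b) - c * d.
Proof.
move=> ab jf ig uE vE.
have -> : \int[mu]_(t in `]a, b[) (f t * v t) =
   d * prim a f b + \int[mu]_(t in `]a, b[) (f t * prim a g t).
  rewrite -RintZ// -RintD//; [|exact: aeintZ|exact: aeint_mul_prim].
  by apply: Rint_ext; apply: ae_imp vE => t vt Dt; rewrite vt//; ring.
have -> : \int[mu]_(t in `]a, b[) (g t * u t) =
   c * prim a g b + \int[mu]_(t in `]a, b[) (g t * prim a f t).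
  rewrite -RintZ// -RintD//; [|exact: aeintZ|exact: aeint_mul_prim].
  by apply: Rint_ext; apply: ae_imp uE => t ut Dt; rewrite ut//; ring.
rewrite addrACA integration_by_parts_prim//; ring.
Qed.

Lemma smooth_prim (a t : R) phi : smooth phi -> a <= t ->
  phi t = phi a + prim a (derive1 phi) t.
Proof.
move=> sphi; rewrite le_eqVlt => /predU1P[->|at_]; first by rewrite prim_le// addr0.
have cd : continuous (derive1 phi) by apply: smooth_continuous; exact: smooth_derive1.
have := @continuous_FTC2 R (derive1 phi) phi a t at_ (continuous_subspaceT cd).
have cphi : continuous phi by exact: smooth_continuous.
have dF : derivable_oo_LRcontinuous phi a t.
  split; first by move=> s _; exact: (sphi 0%N s).
    exact/cvg_at_right_filter/cphi.
  exact/cvg_at_left_filter/cphi.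
move=> /(_ dF (fun x _ => erefl)) /(congr1 fine) /= h.
rewrite addrC -[LHS](subrK (phi a)); congr (_ + _); rewrite -h.
rewrite /prim; apply: Rint_dom; apply: ae_imp2 (ae_neq a) (ae_neq t) => s sa st.
rewrite /= !in_itv/= !le_eqVlt (introF eqP st) (negbTE (introN eqP (nesym sa))).
by [].
Qed.

Lemma aeint_continuous (a b : R) f : continuous f -> aeint `]a, b[ f.
Proof.
move=> cf; apply: (@aeint_sub _ `[a, b]) => //; first exact: subset_itv_oo_cc.
apply: aeint_integrable => //; apply: continuous_compact_integrable.
  exact: segment_compact.
exact: continuous_subspaceT.
Qed.

Lemma aeint_smooth (a b : R) f : smooth f -> aeint `]a, b[ f.
Proof. by move=> sf; apply: aeint_continuous; exact: smooth_continuous. Qed.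

Lemma test_bounded (a b : R) phi : smooth phi ->
  exists2 M : R, 0 <= M & forall t, a <= t <= b -> `|phi t| <= M.
Proof.
move=> sphi; have [ab|ba] := leP a b; last first.
  exists 0 => // t /andP[/le_trans h] /h; by rewrite leNgt ba.
have cphi : {within `[a, b], continuous (fun t => `|phi t|)}.
  apply: continuous_subspaceT => t; apply: cvg_norm; exact: smooth_continuous.
have [c _ hc] := EVT_max ab cphi.
by exists `|phi c| => // t tab; apply: hc; rewrite in_itv.
Qed.

Lemma aeint_mul_smooth (a b : R) f phi : aeint `]a, b[ f -> smooth phi ->
  aeint `]a, b[ (fun t => f t * phi t).
Proof.
move=> jf sphi; have [M M0 hM] := test_bounded a b sphi.
apply: (@aeint_dom _ _ _ (fun t => M * `|f t|)) => //.
- apply: aemeasM; first exact: aeint_aemeas.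
  exact: aeint_aemeas (aeint_smooth _ _ sphi).
- by apply: aeintZ => //; exact: aeint_norm.
apply: aeW => t /=; rewrite in_itv/= => /andP[/ltW at_ /ltW tb].
by rewrite normrM mulrC ler_wpM2r// hM// at_.
Qed.

Lemma test_endpoints (a b : R) phi : test_function a b phi ->
  phi a = 0 /\ phi b = 0.
Proof.
move=> [_ [c [d [ac db h]]]]; split; apply: h => /andP[].
  by rewrite leNgt ac.
by move=> _; rewrite leNgt db.
Qed.

Lemma weak_deriv_prim (a b c : R) u g : a <= b -> aeint `]a, b[ g ->
  aeeq `]a, b[ u (fun t => c + prim a g t) -> weak_deriv a b u g.
Proof.
move=> ab ig uE phi tphi; have sphi := test_smooth tphi.
have [pa pb] := test_endpoints tphi.
have pE : aeeq `]a, b[ phi (fun t => phi a + prim a (derive1 phi) t).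
  apply: eq_aeeq => t; rewrite /= in_itv/= => /andP[/ltW at_ _].
  exact: smooth_prim.
have := integration_by_parts_ae ab (aeint_smooth a b (smooth_derive1 sphi)) ig pE uE.
rewrite -(smooth_prim sphi ab) pa pb !mul0r subrr.
by under eq_Rintegral do rewrite mulrC; move=> /eqP; rewrite addr_eq0 => /eqP.
Qed.

(** With zero integral, the primitive vanishes again to the right of the support. *)
Lemma test_primitive (a b : R) phi : test_function a b phi ->
  \int[mu]_(t in `]a, b[) phi t = 0 -> exists2 Phi, test_function a b Phi &
    derive1 Phi = phi.
Proof.
move=> /[dup] tphi [sphi [c [d [ac db phi0]]]] i0.
have iphi : mu.-integrable setT (EFin \o phi).
  have := @integrable_mkcond _ _ _ mu `[c, d]%classic (EFin \o phi) (measurable_itv _).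
  have ic : mu.-integrable `[c, d] (EFin \o phi).
    apply: continuous_compact_integrable; first exact: segment_compact.
    by apply: continuous_subspaceT; exact: smooth_continuous.
  move=> [/(_ ic) + _]; congr (is_true (mu.-integrable _ _)).
  apply/funext => t; rewrite /patch; case: ifPn => // /negP tcd /=.
  rewrite phi0// => h; apply: tcd; apply/mem_set; by rewrite /= in_itv.
pose Phi x := \int[mu]_(t in `]-oo, x]) phi t.
have dPhi (x : R) : is_derive x 1 Phi (phi x).
  have cphi : {for x, continuous phi} by exact: smooth_continuous.
  have x1 : x < x + 1 by rewrite ltrDl.
  have iphi' : mu.-integrable `]-oo, (x + 1)] (EFin \o phi).
    exact: (@integrableS _ _ _ mu _ _ _ measurableT (measurable_itv _) (@subsetT _ _) iphi).
  have [|dP dPE] := @continuous_FTC1 R phi -oo%O x (x + 1) x1 iphi' _ cphi.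
    exact: ltNyr.
  by apply: DeriveDef; [exact: dP|rewrite -derive1E dPE].
exists Phi; last exact: is_derive_derive1.
split; first exact: smooth_primitive sphi dPhi.
exists c, d; split => // t /negP; rewrite negb_and -!ltNge => /orP[tc|dt].
  rewrite /Phi -[RHS](Rintegral_zero `]-oo, t]); apply: eq_Rintegral => s /set_mem.
  rewrite /= in_itv/= => st; apply: phi0 => /andP[].
  by rewrite leNgt (le_lt_trans st).
rewrite /Phi -[RHS]i0 Rintegral_mkcond [RHS]Rintegral_mkcond.
apply: eq_Rintegral => s _; rewrite /patch.
have [cs|cs] := boolP (c <= s <= d); last first.
  by rewrite phi0; [case: ifP; case: ifP|exact/negP].
move/andP: cs => [cs sd]; rewrite !ifT//; apply/mem_set; rewrite /= in_itv/=.
  by rewrite (lt_le_trans ac)//= (le_lt_trans sd).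
by rewrite ltW// (le_lt_trans sd).
Qed.

Lemma smooth_Z_sub (c : R) f g : smooth f -> smooth g ->
  smooth (fun t => f t - c * g t).
Proof.
move=> sf sg; have := smoothD sf (smoothZ (r := - c) sg).
by congr smooth; apply/funext => t; rewrite mulNr.
Qed.

(** A test function phi becomes a derivative of a test function after subtraction of
    k psi, where psi is a fixed bump and k the quotient of the two integrals.  So
    u - c is orthogonal to all test functions for the right constant c. *)
Lemma du_Bois_Reymond (a b : R) u : a < b -> aeint `]a, b[ u ->
  (forall phi, test_function a b phi ->
    \int[mu]_(t in `]a, b[) (u t * derive1 phi t) = 0) ->
  exists c, aeeq `]a, b[ u (fun=> c).
Proof.
move=> ab iu u0.
(* any interval strictly inside ]a, b[ serves as the support of the bump *)
pose c0 := a + (b - a) / 3; pose d0 := b - (b - a) / 3.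
have ac0 : a < c0 by rewrite /c0; lra.
have db0 : d0 < b by rewrite /d0; lra.
have cd0 : c0 < d0 by rewrite /c0 /d0; lra.
pose psi := smooth_bump c0 d0 0; have tpsi : test_function a b psi by exact: test_bump.
have spsi := test_smooth tpsi.
pose m := \int[mu]_(t in `]a, b[) psi t.
have m0 : m != 0.
  apply/negP => /eqP m0.
  have z : aeeq `]a, b[ psi (fun=> 0).
    apply: integral0_oo; first exact: aeint_smooth.
    move=> c d ac cd db; apply/eqP; rewrite eq_le; apply/andP; split; last first.
      by apply: Rint_ge0; apply: aeW => t _; exact: bump_ge0.
    rewrite -m0; apply: le_Rint_sub => //.
    - by apply: sub_itvoo; exact: ltW.
    - exact: aeint_smooth.
    - by apply: aeW => t _; exact: bump_ge0.
  have : aeeq `]c0, d0[ (fun=> 1) (fun=> 0).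
    apply: ae_imp z => t zt /=; rewrite in_itv/= => tcd; exfalso.
    have := @bump_gt0 R c0 d0 0 t tcd; rewrite -/psi zt ?ltxx//=.
    by rewrite in_itv/=; move: tcd => /andP[]; lra.
  move=> /Rint_ext; rewrite Rintegral_zero Rint_cst; last exact: ltW.
  by rewrite /c0 /d0; lra.
pose c := (\int[mu]_(t in `]a, b[) (u t * psi t)) / m; exists c.
have -> : (fun=> c) = (fun t : R => 0 + c) by apply/funext => t; rewrite add0r.
suff : aeeq `]a, b[ (fun t => u t - c) (fun=> 0).
  by apply: ae_imp => t ut Dt; rewrite add0r -[LHS](subrK c) ut// add0r.
apply: fundamental_lemma.
  by apply: aeintB => //; exact: aeint_cst.
move=> phi tphi; have sphi := test_smooth tphi.
pose k := (\int[mu]_(t in `]a, b[) phi t) / m.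
have schi := smooth_Z_sub (c := k) sphi spsi.
have tchi : test_function a b (fun t => phi t - k * psi t).
  split=> //; move: tphi tpsi => [_ [c1 [d1 [ac1 db1 h1]]]] [_ [c2 [d2 [ac2 db2 h2]]]].
  exists (Num.min c1 c2), (Num.max d1 d2); split.
  - by rewrite lt_min ac1.
  - by rewrite gt_max db1.
  - move=> t ht; rewrite h1 ?h2 ?mulr0 ?subrr//.
    + move=> /andP[x1 x2]; apply: ht.
      by rewrite ge_min x1 orbT le_max x2 orbT.
    + move=> /andP[x1 x2]; apply: ht.
      by rewrite ge_min x1 le_max x2.
have ipsi := aeint_smooth a b spsi; have iphi := aeint_smooth a b sphi.
have [|Phi tPhi dPhi] := test_primitive tchi.
  by rewrite RintB// ?RintZ//; [rewrite -/m /k divfK// subrr|exact: aeintZ].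
have := u0 _ tPhi; rewrite dPhi.
have iup := aeint_mul_smooth iu sphi; have ius := aeint_mul_smooth iu spsi.
under eq_Rintegral do rewrite mulrBr mulrCA.
rewrite RintB// ?RintZ//; last exact: aeintZ.
move=> /eqP; rewrite subr_eq0 => /eqP h.
under eq_Rintegral do rewrite mulrBl.
rewrite RintB// ?RintZ//; last exact: aeintZ.
rewrite h /k /c; ring.
Qed.

Lemma weak_deriv_unique (a b : R) u g h : aeint `]a, b[ g -> aeint `]a, b[ h ->
  weak_deriv a b u g -> weak_deriv a b u h -> aeeq `]a, b[ g h.
Proof.
move=> ig ih wg wh.
suff : aeeq `]a, b[ (fun t => g t - h t) (fun=> 0).
  by apply: ae_imp => t gh Dt; apply/eqP; rewrite -subr_eq0 gh.
apply: fundamental_lemma; first exact: aeintB.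
move=> phi tphi; have sphi := test_smooth tphi.
under eq_Rintegral do rewrite mulrBl.
rewrite RintB//; [|exact: aeint_mul_smooth|exact: aeint_mul_smooth].
by apply/eqP; rewrite subr_eq0 -eqr_opp -wg// wh.
Qed.

(** The function minus the primitive of its weak derivative has weak derivative 0. *)
Lemma weak_deriv_primitive (a b : R) u g : a < b -> aeint `]a, b[ u ->
  aeint `]a, b[ g -> weak_deriv a b u g ->
  exists c, aeeq `]a, b[ u (fun t => c + prim a g t).
Proof.
move=> ab iu ig wg; have ip := aeint_prim ig.
have [|phi tphi|c hc] := @du_Bois_Reymond a b (fun t => u t - prim a g t) ab.
- exact: aeintB.
- have sphi := smooth_derive1 (test_smooth tphi).
  under eq_Rintegral do rewrite mulrBl.
  rewrite RintB//; [|exact: aeint_mul_smooth|exact: aeint_mul_smooth].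
  have := @weak_deriv_prim a b 0 (prim a g) g (ltW ab) ig _ phi tphi.
  move=> ->; last by apply: eq_aeeq => t _; rewrite add0r.
  by rewrite wg// subrr.
exists c; apply: ae_imp hc => t ht Dt.
by rewrite -[LHS](subrK (prim a g t)) ht.
Qed.

End Primitives.

(** * One-sided limits of almost everywhere classes *)

Section OneSidedLimits.
Context {R : realType}.
Notation mu := (@lebesgue_measure R).
Implicit Types (u g : R -> R).

(** The value of rlim is chosen among the numbers with this property. *)
Definition is_rlim u (z c : R) := forall e : R, 0 < e ->
  exists d : R, 0 < d /\ {ae mu, forall t, z < t < z + d -> `|u t - c| < e}.

Definition is_llim u (z c : R) := forall e : R, 0 < e ->
  exists d : R, 0 < d /\ {ae mu, forall t, z - d < t < z -> `|u t - c| < e}.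

(** A nonempty open interval is not a null set. *)
Lemma ae_itv_point (P : R -> Prop) (a b : R) : a < b -> {ae mu, forall t, P t} ->
  exists2 t, a < t < b & P t.
Proof.
move=> ab aeP; apply: contrapT => nP.
have : aeeq `]a, b[ (fun=> (1 : R)) (fun=> 0).
  apply: ae_imp aeP => t Pt /=; rewrite in_itv/= => tab; exfalso; apply: nP.
  by exists t.
move=> /Rint_ext; rewrite Rintegral_zero Rint_cst; last exact: ltW.
by move=> /eqP; rewrite mul1r subr_eq0 gt_eqF.
Qed.

Lemma rlim_unique u z c c' : is_rlim u z c -> is_rlim u z c' -> c = c'.
Proof.
move=> uc uc'; apply/eqP; rewrite -subr_eq0 -normr_eq0; apply/negPn/negP => n0.
have e0 : 0 < `|c - c'| / 2 by rewrite divr_gt0// lt_neqAle eq_sym n0/=.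
have [d [d0 h]] := uc _ e0; have [d' [d'0 h']] := uc' _ e0.
have dd : 0 < Num.min d d' by rewrite lt_min d0.
have [|t /andP[zt td] [H H']] := @ae_itv_point _ z (z + Num.min d d') _
   (ae_imp2 (fun t (a : _) (b : _) => conj a b) h h').
  by rewrite ltrDl.
have m1 : Num.min d d' <= d by rewrite ge_min lexx.
have m2 : Num.min d d' <= d' by rewrite ge_min lexx orbT.
have {}H : `|u t - c| < `|c - c'| / 2 by apply: H; rewrite zt/=; lra.
have {}H' : `|u t - c'| < `|c - c'| / 2 by apply: H'; rewrite zt/=; lra.
have := ler_normB (u t - c') (u t - c).
have -> : u t - c' - (u t - c) = c - c' by ring.
lra.
Qed.

Lemma llim_unique u z c c' : is_llim u z c -> is_llim u z c' -> c = c'.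
Proof.
move=> uc uc'; apply/eqP; rewrite -subr_eq0 -normr_eq0; apply/negPn/negP => n0.
have e0 : 0 < `|c - c'| / 2 by rewrite divr_gt0// lt_neqAle eq_sym n0/=.
have [d [d0 h]] := uc _ e0; have [d' [d'0 h']] := uc' _ e0.
have dd : 0 < Num.min d d' by rewrite lt_min d0.
have [|t /andP[zt td] [H H']] := @ae_itv_point _ (z - Num.min d d') z _
   (ae_imp2 (fun t (a : _) (b : _) => conj a b) h h').
  by rewrite ltrBlDr ltrDl.
have m1 : Num.min d d' <= d by rewrite ge_min lexx.
have m2 : Num.min d d' <= d' by rewrite ge_min lexx orbT.
have {}H : `|u t - c| < `|c - c'| / 2 by apply: H; rewrite td andbT; lra.
have {}H' : `|u t - c'| < `|c - c'| / 2 by apply: H'; rewrite td andbT; lra.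
have := ler_normB (u t - c') (u t - c).
have -> : u t - c' - (u t - c) = c - c' by ring.
lra.
Qed.

Lemma rlim_eq u z c : is_rlim u z c -> rlim u z = c.
Proof.
move=> uc; apply: rlim_unique (uc); rewrite /rlim.
case: xgetP => [y -> //|h]; by have := h c uc.
Qed.

Lemma llim_eq u z c : is_llim u z c -> llim u z = c.
Proof.
move=> uc; apply: llim_unique (uc); rewrite /llim.
case: xgetP => [y -> //|h]; by have := h c uc.
Qed.

Lemma is_rlim_prim (a b c : R) u g : a < b -> aeint `]a, b[ g ->
  aeeq `]a, b[ u (fun t => c + prim a g t) -> is_rlim u a c.
Proof.
move=> ab ig uE e e0.
have /(continuous_within_itvP _ ab)[_ + _] := prim_continuous (ltW ab) ig.
rewrite (prim_le _ (lexx a)) => /cvgrPdist_lt /(_ e e0).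
rewrite near_withinE => -[d /= d0 hd].
exists (Num.min d (b - a)); split; first by rewrite lt_min d0 subr_gt0.
apply: ae_imp uE => t ut /andP[at_ td].
have m1 : Num.min d (b - a) <= d by rewrite ge_min lexx.
have m2 : Num.min d (b - a) <= b - a by rewrite ge_min lexx orbT.
rewrite ut/=; last by rewrite in_itv/= at_/=; lra.
rewrite addrAC subrr add0r -normrN -sub0r; apply: hd => //=.
by rewrite ltr0_norm; lra.
Qed.

Lemma is_llim_prim (a b c : R) u g : a < b -> aeint `]a, b[ g ->
  aeeq `]a, b[ u (fun t => c + prim a g t) -> is_llim u b (c + prim a g b).
Proof.
move=> ab ig uE e e0.
have /(continuous_within_itvP _ ab)[_ _ +] := prim_continuous (ltW ab) ig.
move=> /cvgrPdist_lt /(_ e e0).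
rewrite near_withinE => -[d /= d0 hd].
exists (Num.min d (b - a)); split; first by rewrite lt_min d0 subr_gt0.
apply: ae_imp uE => t ut /andP[at_ td].
have m1 : Num.min d (b - a) <= d by rewrite ge_min lexx.
have m2 : Num.min d (b - a) <= b - a by rewrite ge_min lexx orbT.
rewrite ut/=; last by rewrite in_itv/= td andbT; lra.
rewrite distrC opprD addrACA subrr add0r; apply: hd => //=.
by rewrite gtr0_norm; lra.
Qed.

End OneSidedLimits.

(** * Dual spaces, bilinear forms and subdifferentials *)

Section NormedSpaces.
Context {R : realType}.
Implicit Types X : nspace R.

Definition subspace_elts X := elts X 0 /\
  forall (a : R) u v, elts X u -> elts X v -> elts X (a *: u + v).

(** The norm is only a seminorm on representatives: a representative of the class of
    0 has norm 0 without being 0. *)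
Definition prenormed X := [/\ subspace_elts X,
  forall u, elts X u -> 0 <= nrm u,
  forall u v, elts X u -> elts X v -> nrm (u + v) <= nrm u + nrm v &
  forall (a : R) u, elts X u -> nrm (a *: u) = `|a| * nrm u].

Section Subspace.
Variable X : nspace R.
Hypothesis sX : subspace_elts X.

Lemma subspaceD u v : elts X u -> elts X v -> elts X (u + v).
Proof. by move=> Xu Xv; rewrite -[u]scale1r; exact: sX.2. Qed.

Lemma subspaceZ (a : R) u : elts X u -> elts X (a *: u).
Proof. by move=> Xu; rewrite -[_ *: u]addr0; apply: sX.2 => //; exact: sX.1. Qed.

Lemma subspaceB u v : elts X u -> elts X v -> elts X (u - v).
Proof.
by move=> Xu Xv; apply: subspaceD => //; rewrite -scaleN1r; exact: subspaceZ.
Qed.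

Lemma subspace_sum (n : nat) (F : nat -> rep X) :
  (forall i, (i < n)%N -> elts X (F i)) -> elts X (\sum_(i < n) F i).
Proof.
elim: n => [|n IH] HF; first by rewrite big_ord0; exact: sX.1.
by rewrite big_ord_recr; apply: subspaceD; [apply: IH => i /ltnW; exact: HF|exact: HF].
Qed.

End Subspace.

Section PreNormed.
Variable X : nspace R.
Hypothesis nX : prenormed X.

Lemma prenormed_subspace : subspace_elts X. Proof. by case: nX. Qed.

Lemma prenormed_sub u v : elts X u -> elts X v -> nrm (u - v) = nrm (v - u).
Proof.
case: nX => sX _ _ nZ Xu Xv.
have -> : u - v = -1 *: (v - u) by rewrite scaleN1r opprB.
by rewrite nZ ?normrN1 ?mul1r//; exact: subspaceB.
Qed.

Lemma prenormed_dist u v : elts X u -> elts X v -> `|nrm u - nrm v| <= nrm (u - v).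
Proof.
case: (nX) => sX _ nD _ Xu Xv; rewrite ler_norml; apply/andP; split.
  have := nD _ _ (subspaceB sX Xv Xu) Xu; rewrite subrK prenormed_sub//; lra.
by have := nD _ _ (subspaceB sX Xu Xv) Xv; rewrite subrK; lra.
Qed.

Lemma prenormed_subD u v : elts X u -> elts X v -> nrm (u - v) <= nrm u + nrm v.
Proof.
case: nX => sX _ nD nZ Xu Xv; rewrite -scaleN1r; apply: le_trans (nD _ _ Xu _) _.
  exact: subspaceZ.
by rewrite nZ// normrN1 mul1r.
Qed.

Lemma dual0 f : elts (dual X) f -> f 0 = 0.
Proof.
move=> [flin _]; have [sX _ _ _] := nX.
by have := flin 1 _ _ sX.1 sX.1; rewrite scale1r addr0 mul1r => h; lra.
Qed.

Lemma dualZ f (a : R) u : elts (dual X) f -> elts X u -> f (a *: u) = a * f u.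
Proof.
move=> df Xu; have [sX _ _ _] := nX.
by have := df.1 a _ _ Xu sX.1; rewrite addr0 dual0// addr0.
Qed.

Lemma dualD f u v : elts (dual X) f -> elts X u -> elts X v -> f (u + v) = f u + f v.
Proof. by move=> df Xu Xv; have := df.1 1 _ _ Xu Xv; rewrite scale1r mul1r. Qed.

Lemma dualB f u v : elts (dual X) f -> elts X u -> elts X v -> f (u - v) = f u - f v.
Proof.
move=> df Xu Xv; rewrite dualD//; last by rewrite -scaleN1r; exact: subspaceZ prenormed_subspace _ _ _.
by rewrite -scaleN1r dualZ// mulN1r.
Qed.

Let dset (f : rep X -> R) := [set `|f u| | u in [set u | elts X u /\ nrm u <= 1]].

Lemma nrm0 : nrm (0 : rep X) = 0.
Proof. by case: nX => sX _ _ nZ; rewrite -(scale0r 0) nZ ?normr0 ?mul0r//; exact: sX.1. Qed.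

Lemma dset0 f : dset f `|f 0|.
Proof. by exists 0 => //; split; [exact: prenormed_subspace.1|rewrite nrm0]. Qed.

Lemma dset_bounded f : elts (dual X) f -> has_sup (dset f).
Proof.
move=> [_ [C hC]]; split; first by exists `|f 0|; exact: dset0.
exists `|C| => _ [u [Xu u1] <-]; apply: le_trans (hC u Xu) _.
have [_ n0 _ _] := nX; apply: (@le_trans _ _ (`|C| * nrm u)).
  by rewrite ler_wpM2r ?ler_norm// n0.
by rewrite -[leRHS]mulr1 ler_wpM2l.
Qed.

Lemma dual_le f u : elts (dual X) f -> elts X u ->
  `|f u| <= nrm (f : rep (dual X)) * nrm u.
Proof.
move=> df Xu; have [sX n0 _ nZ] := nX.
have [u0|u0] := eqVneq (nrm u) 0.
  by have [_ [C hC]] := df; have := hC u Xu; rewrite u0 !mulr0.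
have up : 0 < nrm u by rewrite lt_neqAle eq_sym u0 n0.
rewrite -ler_pdivrMr// -[_ / _]ger0_norm ?divr_ge0 ?n0//.
rewrite normf_div normr_id [`|nrm u|]ger0_norm ?n0//.
apply: (sup_upper_bound (dset_bounded df)); exists ((nrm u)^-1 *: u).
  split; first exact: subspaceZ.
  by rewrite nZ// ger0_norm ?invr_ge0 ?n0// mulVf.
by rewrite dualZ// normrM normfV [`|nrm u|]ger0_norm ?n0// mulrC.
Qed.

(** The supremum defining the dual norm is over a nonempty set, which contains
    |f 0|. *)
Lemma dual_nrm_le (f : rep X -> R) C : (forall u, elts X u -> nrm u <= 1 -> `|f u| <= C) ->
  nrm (f : rep (dual X)) <= C.
Proof.
move=> hC; apply: ge_sup; first by exists `|f 0|; exact: dset0.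
by move=> _ [u [Xu u1] <-]; exact: hC.
Qed.

Lemma prenormed_dual : prenormed (dual X).
Proof.
have [sX n0 _ nZ] := nX.
have lin : subspace_elts (dual X).
  split.
    split; first by move=> a u v _ _; rewrite /= mulr0 addr0.
    by exists 0 => u Xu; rewrite normr0 mul0r.
  move=> a f g df dg; split.
    move=> b u v Xu Xv; rewrite /= !fctE df.1// dg.1// /GRing.scale/=; ring.
  exists (`|a| * nrm (f : rep (dual X)) + nrm (g : rep (dual X))) => u Xu.
  rewrite !fctE /= (le_trans (ler_normD _ _))// mulrDl lerD//; last exact: dual_le.
  by rewrite normrM -mulrA ler_wpM2l//; exact: dual_le.
have pos f : elts (dual X) f -> 0 <= nrm (f : rep (dual X)).
  move=> df; apply: le_trans (normr_ge0 (f 0)) _.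
  by apply: (sup_upper_bound (dset_bounded df)); exact: dset0.
split => //.
- move=> f g df dg; apply: dual_nrm_le => u Xu u1.
  rewrite fctE (le_trans (ler_normD _ _))// lerD//.
    by apply: le_trans (dual_le df Xu) _; rewrite -[leRHS]mulr1 ler_wpM2l// pos.
  by apply: le_trans (dual_le dg Xu) _; rewrite -[leRHS]mulr1 ler_wpM2l// pos.
- have half a f : elts (dual X) f -> nrm (a *: f : rep (dual X)) <= `|a| * nrm (f : rep (dual X)).
    move=> df; apply: dual_nrm_le => u Xu u1; rewrite normrM ler_wpM2l//.
    by apply: le_trans (dual_le df Xu) _; rewrite -[leRHS]mulr1 ler_wpM2l// pos.
  move=> a f df; apply/eqP; rewrite eq_le half//=.
  have [->|a0] := eqVneq a 0.
    by rewrite normr0 mul0r pos//; exact: subspaceZ.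
  have := half a^-1 _ (subspaceZ lin a df).
  rewrite scalerA mulVf// scale1r normfV mulrC ler_pdivlMr ?normr_gt0//.
  by rewrite mulrC.
Qed.

End PreNormed.

(** Nonnegative symmetric bilinear forms.  The identities are required only on the
    elements of the space, since off them integrals and weak derivatives take
    default values. *)
Definition sform X (b : rep X -> rep X -> R) :=
  [/\ forall (a : R) u v w, elts X u -> elts X v -> elts X w ->
        b (a *: u + v) w = a * b u w + b v w,
      forall u v, elts X u -> elts X v -> b u v = b v u &
      forall u, elts X u -> 0 <= b u u].

Section Forms.
Variables (X : nspace R) (b : rep X -> rep X -> R).
Hypotheses (sX : subspace_elts X) (fb : sform b).

Lemma sform0l w : elts X w -> b 0 w = 0.
Proof.
case: fb => bl _ _ Xw; have := bl 1 _ _ _ sX.1 sX.1 Xw.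
by rewrite scale1r addr0 mul1r => h; lra.
Qed.

Lemma sformDl u v w : elts X u -> elts X v -> elts X w ->
  b (u + v) w = b u w + b v w.
Proof. by case: fb => bl _ _ Xu Xv Xw; have := bl 1 _ _ _ Xu Xv Xw; rewrite scale1r mul1r. Qed.

Lemma sformZl (a : R) u w : elts X u -> elts X w -> b (a *: u) w = a * b u w.
Proof.
by case: fb => bl _ _ Xu Xw; have := bl a _ _ _ Xu sX.1 Xw; rewrite addr0 sform0l// addr0.
Qed.

Lemma sformDr u v w : elts X u -> elts X v -> elts X w ->
  b w (u + v) = b w u + b w v.
Proof.
case: (fb) => _ bs _ Xu Xv Xw; rewrite bs//; last exact: subspaceD.
by rewrite sformDl// bs// [b v w]bs.
Qed.

Lemma sformZr (a : R) u w : elts X u -> elts X w -> b w (a *: u) = a * b w u.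
Proof.
case: (fb) => _ bs _ Xu Xw; rewrite bs//; last exact: subspaceZ.
by rewrite sformZl// bs.
Qed.

Lemma sform_expand (a : R) u v : elts X u -> elts X v ->
  b (u + a *: v) (u + a *: v) = b u u + a * b u v *+ 2 + a ^+ 2 * b v v.
Proof.
case: (fb) => _ bs _ Xu Xv; have Xav := subspaceZ sX a Xv.
rewrite sformDl// ?sformDr//; try exact: subspaceD.
by rewrite !sformZl// !sformZr// [b v u]bs//; ring.
Qed.

Lemma sform_CS u v : elts X u -> elts X v -> b u v ^+ 2 <= b u u * b v v.
Proof.
case: (fb) => _ _ b0 Xu Xv; apply: discriminant_le => r.
by rewrite -sform_expand//; apply: b0; apply: subspaceD => //; exact: subspaceZ.
Qed.

Lemma sform_CS_sqrt u v : elts X u -> elts X v ->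
  `|b u v| <= Num.sqrt (b u u) * Num.sqrt (b v v).
Proof.
move=> Xu Xv; case: (fb) => _ _ b0.
rewrite -sqrtrM ?b0// -sqrtr_sqr ler_wsqrtr//.
exact: sform_CS.
Qed.

Lemma sform_convex (r : R) u v : 0 <= r <= 1 -> elts X u -> elts X v ->
  b (r *: u + (1 - r) *: v) (r *: u + (1 - r) *: v) <= r * b u u + (1 - r) * b v v.
Proof.
move=> /andP[r0 r1] Xu Xv; case: (fb) => _ bs b0.
have Xru := subspaceZ sX r Xu; have Xrv := subspaceZ sX (1 - r) Xv.
rewrite sformDl// ?sformDr//; try exact: subspaceD.
rewrite !sformZl// !sformZr// [b v u]bs//.
have Xuv := subspaceD sX Xu (subspaceZ sX (-1) Xv).
have := b0 _ Xuv; rewrite sform_expand//.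
have : 0 <= r * (1 - r) by rewrite mulr_ge0// subr_ge0.
nra.
Qed.

End Forms.

Lemma sformD X b c : sform (X := X) b -> sform (X := X) c ->
  sform (X := X) (fun u v => b u v + c u v).
Proof.
move=> [bl bs b0] [cl cs c0]; split.
- by move=> a u v w Xu Xv Xw; rewrite bl// cl// mulrDr addrACA.
- by move=> u v Xu Xv; rewrite bs// cs.
- by move=> u Xu; rewrite addr_ge0 ?b0 ?c0.
Qed.

Lemma sform_squares X (n : nat) (w : nat -> R) (L : nat -> rep X -> R) :
  (forall i, (i < n)%N -> 0 <= w i) ->
  (forall i (a : R) u v, (i < n)%N -> elts X u -> elts X v ->
     L i (a *: u + v) = a * L i u + L i v) ->
  sform (X := X) (fun u v => \sum_(i < n) w i * (L i u * L i v)).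
Proof.
move=> w0 Ll; split.
- move=> a u v z Xu Xv Xz; rewrite mulr_sumr -big_split/=; apply: eq_bigr => i _.
  by rewrite Ll//; ring.
- by move=> u v _ _; apply: eq_bigr => i _; rewrite [L i u * _]mulrC.
- by move=> u _; apply: sumr_ge0 => i _; rewrite -expr2 mulr_ge0 ?w0 ?sqr_ge0.
Qed.

Lemma prenormed_form X b : subspace_elts X -> sform (X := X) b ->
  (forall u, nrm u = Num.sqrt (b u u)) -> prenormed X.
Proof.
move=> sX fb nE; have [_ _ b0] := fb; split => //.
- by move=> u Xu; rewrite nE sqrtr_ge0.
- move=> u v Xu Xv; rewrite !nE.
  rewrite -[leRHS]ger0_norm ?addr_ge0 ?sqrtr_ge0// -sqrtr_sqr ler_wsqrtr//.
  rewrite sqrrD !sqr_sqrtr ?b0//.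
  have := sform_expand sX fb 1 Xu Xv; rewrite scale1r expr1n !mul1r => ->.
  rewrite lerD2r lerD2l lerMn2r/=.
  exact: le_trans (ler_norm _) (sform_CS_sqrt sX fb Xu Xv).
- by move=> a u Xu; rewrite !nE sformZl// ?sformZr//;
    [rewrite mulrA -expr2 sqrtrM ?sqr_ge0// sqrtr_sqr|exact: subspaceZ].
Qed.

Definition convex_ineq X (phi : rep X -> R) := forall (r : R) u v,
  0 <= r <= 1 -> elts X u -> elts X v ->
  phi (r *: u + (1 - r) *: v) <= r * phi u + (1 - r) * phi v.

Lemma convex_onP X (phi : rep X -> R) : convex_ineq phi -> convex_on phi.
Proof.
move=> h t u v /set_mem Xu /set_mem Xv; rewrite convRE.
by apply: h => //; apply/andP; split.
Qed.

Section Gateaux.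
Variables (X : nspace R) (phi : rep X -> R) (u : rep X) (g : rep X -> R).
Hypotheses (nX : prenormed X) (Xu : elts X u) (cphi : convex_ineq phi).
Hypothesis dphi : is_gateaux phi u g.

Let sX := prenormed_subspace nX.

(** The difference quotients from u towards z are at most phi z - phi u by
    convexity, and so is their limit. *)
Lemma gateaux_subdiff : subdiff phi u g.
Proof.
have [dg hg] := dphi; split => // z Xz.
have Xzu := subspaceB sX Xz Xu.
rewrite addrC -lerBrDr -(cvg_lim _ (hg _ Xzu))//.
apply: limr_le; first by apply/cvg_ex; exists (g (z - u)); exact: hg.
near=> a; have a0 : 0 < a by near: a; exact: nbhs_right_gt.
have a1 : a <= 1 by near: a; exact: nbhs_right_le.
rewrite ler_pdivrMr//.
have -> : u + a *: (z - u) = a *: z + (1 - a) *: u.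
  by rewrite scalerBr scalerBl scale1r addrC -addrA [- _ + _]addrC.
have := @cphi a z u; rewrite ltW// a1 => /(_ isT Xz Xu); lra.
Unshelve. all: by end_near. Qed.

(** A subgradient is at most every difference quotient, hence at most the derivative
    in each direction; linearity applied to v and - v gives equality. *)
Lemma gateaux_subdiff_unique g' : subdiff phi u g' -> dual_eq g' g.
Proof.
have [dg hg] := dphi => -[dg' hg'].
have half v : elts X v -> g' v <= g v.
  move=> Xv; rewrite -(cvg_lim _ (hg _ Xv))//.
  apply: limr_ge; first by apply/cvg_ex; exists (g v); exact: hg.
  near=> a; have a0 : 0 < a by near: a; exact: nbhs_right_gt.
  rewrite ler_pdivlMr//.
  have Xav := subspaceZ sX a Xv.
  have := hg' _ (subspaceD sX Xu Xav); rewrite [u + _]addrC addrK (dualZ nX)//; lra.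
move=> v Xv; apply/eqP; rewrite eq_le half//=.
have := half _ (subspaceZ sX (-1) Xv); rewrite !(dualZ nX)//; lra.
Unshelve. all: by end_near. Qed.

End Gateaux.

Lemma dirderiv_poly X (phi : rep X -> R) u eta (l q2 q3 q4 : R) :
  (forall a : R, 0 < a -> phi (u + a *: eta) - phi u =
     a * l + a ^+ 2 * q2 + a ^+ 3 * q3 + a ^+ 4 * q4) ->
  is_dirderiv phi u eta l.
Proof.
move=> h; rewrite /is_dirderiv.
have hl : (fun a : R => l + a * q2 + a ^+ 2 * q3 + a ^+ 3 * q4) a @[a --> 0^'+] --> l.
  apply: cvg_at_right_filter.
  have {2}-> : l = (fun a : R => l + a * q2 + a ^+ 2 * q3 + a ^+ 3 * q4) 0.
    by rewrite /= !expr0n/= !mul0r !addr0.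
  apply: cvgD; last by apply: cvgMl; exact: exprn_continuous.
  apply: cvgD; last by apply: cvgMl; exact: exprn_continuous.
  by apply: cvgD; [exact: cvg_cst|apply: cvgMl; exact: cvg_id].
apply: cvg_trans hl; apply: near_eq_cvg; near=> a.
have a0 : 0 < a by near: a; exact: nbhs_right_gt.
by rewrite h//; field; rewrite gt_eqF.
Unshelve. all: by end_near. Qed.

Lemma dirderiv_unique X (phi : rep X -> R) u eta (l l' : R) :
  is_dirderiv phi u eta l -> is_dirderiv phi u eta l' -> l = l'.
Proof. by move=> h h'; rewrite -(cvg_lim _ h)// (cvg_lim _ h'). Qed.

Section QuadraticForm.
Variables (X : nspace R) (b : rep X -> rep X -> R) (C : R).
Hypotheses (nX : prenormed X) (fb : sform b) (C0 : 0 <= C).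
Hypothesis bC : forall u, elts X u -> b u u <= C * nrm u ^+ 2.
Let sX := prenormed_subspace nX.

Lemma form_bounded u v : elts X u -> elts X v -> `|b u v| <= C * nrm u * nrm v.
Proof.
move=> Xu Xv; have [_ _ b0] := fb; have [_ n0 _ _] := nX.
rewrite -[leRHS]ger0_norm; last by rewrite !mulr_ge0// n0.
rewrite -ler_sqr ?nnegrE// !real_normK ?num_real//.
apply: le_trans (sform_CS sX fb Xu Xv) _.
have -> : (C * nrm u * nrm v) ^+ 2 = (C * nrm u ^+ 2) * (C * nrm v ^+ 2) by ring.
by apply: ler_pM; [exact: b0|exact: b0|exact: bC|exact: bC].
Qed.

Lemma form_dual u : elts X u -> elts (dual X) (b u).
Proof.
move=> Xu; split.
  move=> a v w Xv Xw; rewrite (sformDr sX fb)// ?(sformZr sX fb)//; exact: subspaceZ.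
by exists (C * nrm u) => v Xv; exact: form_bounded.
Qed.

Lemma form_gateaux u : elts X u -> is_gateaux (fun v => 2^-1 * b v v) u (b u).
Proof.
move=> Xu; split; first exact: form_dual.
move=> v Xv; apply: (@dirderiv_poly _ _ _ _ _ (2^-1 * b v v) 0 0) => a a0.
by rewrite (sform_expand sX fb)//; field.
Qed.

Lemma form_convex : convex_ineq (X := X) (fun v => 2^-1 * b v v).
Proof.
move=> r u v r01 Xu Xv; have := sform_convex sX fb r01 Xu Xv; lra.
Qed.

(** Num.sqrt (b v v) is a seminorm, bounded by a multiple of the norm. *)
Lemma form_sqrt_dist u v : elts X u -> elts X v ->
  `|Num.sqrt (b u u) - Num.sqrt (b v v)| <= Num.sqrt C * nrm (u - v).
Proof.
move=> Xu Xv; have [_ n0 _ _] := nX; have Xuv := subspaceB sX Xu Xv.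
pose Y : nspace R := NSpace (elts X) (fun u => Num.sqrt (b u u)).
have nY : prenormed Y by apply: (@prenormed_form Y b).
have := @prenormed_dist Y nY u v Xu Xv; move=> /le_trans; apply => /=.
rewrite -[nrm _]ger0_norm ?n0// -sqrtr_sqr -sqrtrM// ler_wsqrtr//.
exact: bC.
Qed.

Lemma form_lsc (F : R -> R) : continuous F ->
  lsc_on (X := X) (fun v => F (Num.sqrt (b v v))).
Proof.
move=> cF u Xu e e0; have [_ n0 _ _] := nX.
have := cF (Num.sqrt (b u u)) => /cvgrPdist_lt /(_ e e0)/nbhs_ballP[d /= d0 hd].
have S0 := sqrtr_ge0 C.
exists (d / (Num.sqrt C + 1)); split; first by rewrite divr_gt0//; lra.
move=> v Xv; rewrite ltr_pdivlMr; last lra.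
move=> h; have : `|F (Num.sqrt (b u u)) - F (Num.sqrt (b v v))| < e.
  apply: hd; rewrite /ball/= distrC; apply: le_lt_trans (form_sqrt_dist Xv Xu) _.
  by apply: le_lt_trans h; have := n0 _ (subspaceB sX Xv Xu); nra.
by rewrite ltr_norml => /andP[]; lra.
Qed.

Lemma form_lsc_comp (G : R -> R) : continuous G ->
  lsc_on (X := X) (fun v => G (b v v)).
Proof.
move=> cG; have [_ _ b0] := fb.
have cF : continuous (fun s : R => G (s ^+ 2)).
  by move=> s; apply: continuous_comp; [exact: exprn_continuous|exact: cG].
move=> u Xu e e0; have [d [d0 hd]] := form_lsc cF Xu e0; exists d; split => //.
by move=> v Xv uv; have := hd v Xv uv; rewrite !sqr_sqrtr ?b0.
Qed.

End QuadraticForm.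

End NormedSpaces.

(** * The square of an affine function of a quadratic form *)

Section QuarticFunctional.
Context {R : realType}.
Variables (X : nspace R) (b : rep X -> rep X -> R) (C k beta : R).
Hypotheses (nX : prenormed X) (fb : sform b) (C0 : 0 <= C) (k0 : 0 <= k).
Hypothesis bC : forall u, elts X u -> b u u <= C * nrm u ^+ 2.
Let sX := prenormed_subspace nX.

Definition quartic (u : rep X) : R := k * (beta + 2^-1 * b u u) ^+ 2.

Definition quartic_grad (u : rep X) : rep (dual X) :=
  fun v => 2 * k * (beta + 2^-1 * b u u) * b u v.

Lemma quartic_grad_dual u : elts X u -> elts (dual X) (quartic_grad u).
Proof.
move=> Xu; have [lin [K hK]] := form_dual nX fb C0 bC Xu; split.
  by move=> a v w Xv Xw; rewrite /quartic_grad lin//; ring.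
exists (`|2 * k * (beta + 2^-1 * b u u)| * K) => v Xv.
by rewrite /quartic_grad normrM -[leRHS]mulrA; apply: ler_wpM2l => //; exact: hK.
Qed.

(** The exact expansion along a line gives the Gateaux derivative, and later the
    variation of the action without passing to a limit under the integral. *)
Lemma quartic_expand u v (a : R) : elts X u -> elts X v ->
  quartic (u + a *: v) = quartic u + a * quartic_grad u v +
   a ^+ 2 * (k * (b u v ^+ 2 + (beta + 2^-1 * b u u) * b v v)) +
   a ^+ 3 * (k * (b u v * b v v)) + a ^+ 4 * (k * (2^-1 * b v v) ^+ 2).
Proof.
move=> Xu Xv; rewrite /quartic /quartic_grad (sform_expand sX fb)//.
by field.
Qed.

Lemma quartic_gateaux u : elts X u -> is_gateaux quartic u (quartic_grad u).
Proof.
move=> Xu; split; first exact: quartic_grad_dual.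
move=> v Xv.
apply: (@dirderiv_poly _ _ _ _ _ _
  (k * (b u v ^+ 2 + (beta + 2^-1 * b u u) * b v v))
  (k * (b u v * b v v)) (k * (2^-1 * b v v) ^+ 2)) => a _.
by rewrite quartic_expand//; ring.
Qed.

(** For beta >= 0 the argument of the square is nonnegative, where squaring is
    increasing and convex. *)
Lemma quartic_convex : 0 <= beta -> convex_ineq (X := X) quartic.
Proof.
move=> beta0 r u v /[dup] r01 /andP[r0 r1] Xu Xv; have [_ _ b0] := fb.
have Xw : elts X (r *: u + (1 - r) *: v).
  by apply: (subspaceD sX); exact: (subspaceZ sX).
have := sform_convex sX fb r01 Xu Xv; have := b0 _ Xu; have := b0 _ Xv.
have := b0 _ Xw; rewrite /quartic.
move: (b _ _) (b u u) (b v v) => w p q w0 p0 q0 wle.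
have -> : r * (k * (beta + 2^-1 * p) ^+ 2) + (1 - r) * (k * (beta + 2^-1 * q) ^+ 2) =
  k * (r * (beta + 2^-1 * p) ^+ 2 + (1 - r) * (beta + 2^-1 * q) ^+ 2) by ring.
rewrite ler_wpM2l//.
apply: (@le_trans _ _ ((r * (beta + 2^-1 * p) + (1 - r) * (beta + 2^-1 * q)) ^+ 2)).
  rewrite lerXn2r ?nnegrE//; [lra| |lra].
  by rewrite addr_ge0// mulr_ge0// ?subr_ge0//; lra.
have : 0 <= r * (1 - r) by rewrite mulr_ge0// subr_ge0.
have := sqr_ge0 ((beta + 2^-1 * p) - (beta + 2^-1 * q)).
move: (beta + 2^-1 * p) (beta + 2^-1 * q) => y z h1 h2.
rewrite -subr_ge0.
have -> : r * y ^+ 2 + (1 - r) * z ^+ 2 - (r * y + (1 - r) * z) ^+ 2 =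
  (r * (1 - r)) * (y - z) ^+ 2 by ring.
exact: mulr_ge0.
Qed.

Lemma quartic_lsc : lsc_on (X := X) quartic.
Proof.
apply: (form_lsc_comp nX fb C0 bC (G := fun s : R => k * (beta + 2^-1 * s) ^+ 2)).
move=> s; apply: cvgMr.
apply: (@continuous_comp _ _ _ (fun s : R => beta + 2^-1 * s) (fun s : R => s ^+ 2)).
  by apply: cvgD; [exact: cvg_cst|apply: cvgMr; exact: cvg_id].
exact: exprn_continuous.
Qed.

End QuarticFunctional.

(** * Strongly measurable functions *)

Section BochnerTools.
Context {R : realType}.
Notation mu := (@lebesgue_measure R).
Implicit Types X Y : nspace R.

Definition ncvg X (v : nat -> rep X) (u : rep X) :=
  (forall n, elts X (v n)) /\ nrm (v n - u) @[n --> \oo] --> (0 : R).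

(** The function takes finitely many values, each on a measurable set. *)
Lemma simple_fun_measurable X (n : nat) (A : nat -> set R) (c : nat -> rep X) :
  (forall k, (k < n)%N -> measurable (A k)) -> forall Phi : rep X -> R,
  measurable_fun setT (fun t => Phi (\sum_(k < n) (\1_(A k) t : R) *: c k)).
Proof.
elim: n => [|n IH] mA Phi.
  by under eq_fun do rewrite big_ord0; exact: measurable_cst.
have mA' k : (k < n)%N -> measurable (A k) by move=> /ltnW; exact: mA.
have -> : (fun t => Phi (\sum_(k < n.+1) (\1_(A k) t : R) *: c k)) =
  (fun t => if t \in A n then Phi (\sum_(k < n) (\1_(A k) t : R) *: c k + c n)
            else Phi (\sum_(k < n) (\1_(A k) t : R) *: c k)).
  apply/funext => t; rewrite big_ord_recr/= [\1_(A n) t]indicE.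
  by case: (t \in A n); rewrite ?scale1r ?scale0r ?addr0.
apply: measurable_fun_ifT.
- apply: (@measurable_fun_bool _ _ _ _ true).
  rewrite setTI (_ : _ @^-1` _ = A n); first exact: mA.
  by apply/seteqP; split => t /=; [move/set_mem|move/mem_set].
- exact: IH mA' (fun z => Phi (z + c n)).
- exact: IH mA' Phi.
Qed.

Lemma simple_fun_measurable2 X Y (n : nat) (A : nat -> set R) (c : nat -> rep X)
    (s : R -> rep Y) :
  simple_into s -> (forall k, (k < n)%N -> measurable (A k)) ->
  forall Phi : rep X -> rep Y -> R,
  measurable_fun setT (fun t => Phi (\sum_(k < n) (\1_(A k) t : R) *: c k) (s t)).
Proof.
move=> [n' [A' [c' [hA' sE]]]] mA Phi.
elim: n mA Phi => [|n IH] mA Phi.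
  under eq_fun do rewrite big_ord0 sE.
  exact: (@simple_fun_measurable Y n' A' c' (fun k kn => (hA' k kn).1) (Phi 0)).
have mA' k : (k < n)%N -> measurable (A k) by move=> /ltnW; exact: mA.
have -> : (fun t => Phi (\sum_(k < n.+1) (\1_(A k) t : R) *: c k) (s t)) =
  (fun t => if t \in A n then Phi (\sum_(k < n) (\1_(A k) t : R) *: c k + c n) (s t)
            else Phi (\sum_(k < n) (\1_(A k) t : R) *: c k) (s t)).
  apply/funext => t; rewrite big_ord_recr/= [\1_(A n) t]indicE.
  by case: (t \in A n); rewrite ?scale1r ?scale0r ?addr0.
apply: measurable_fun_ifT.
- apply: (@measurable_fun_bool _ _ _ _ true).
  rewrite setTI (_ : _ @^-1` _ = A n); first exact: mA.
  by apply/seteqP; split => t /=; [move/set_mem|move/mem_set].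
- exact: IH mA' (fun z => Phi (z + c n)).
- exact: IH mA' Phi.
Qed.

Lemma simple_elts X (s : R -> rep X) t : subspace_elts X -> simple_into s -> elts X (s t).
Proof.
move=> sX [n [A [c [hA ->]]]].
apply: (subspace_sum sX (F := fun k => (\1_(A k) t : R) *: c k)) => k kn.
by apply: subspaceZ => //; have [] := hA k kn.
Qed.

(** The exceptional null set is contained in a measurable one, off which the limit
    is that of Borel functions. *)
Lemma aemeas_limit (D : set R) (F : nat -> R -> R) f : measurable D ->
  (forall n, measurable_fun setT (F n)) ->
  {ae mu, forall t, D t -> F n t @[n --> \oo] --> f t} -> aemeas D f.
Proof.
move=> mD mF [N [mN N0 subN]].
have DN t : D t -> ~ N t -> F n t @[n --> \oo] --> f t.
  move=> Dt Nt; have : D t -> F n t @[n --> \oo] --> f t.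
    by apply: contrapT => h; apply: Nt; exact: subN.
  exact.
exists (fun t => f t * \1_(D `\` N) t).
  apply: (@measurable_fun_cvg _ _ _ setT (fun n t => F n t * \1_(D `\` N) t)).
    move=> n; apply: measurable_funM => //; apply: measurable_indic.
    exact: measurableD.
  move=> t _; rewrite indicE; have [h|h] := boolP (t \in D `\` N).
    have [Dt Nt] := set_mem h.
    by under eq_fun do rewrite mulr1; rewrite mulr1; exact: DN.
  by under eq_fun do rewrite mulr0; rewrite mulr0; exact: cvg_cst.
exists N; split => // t /= /not_implyP[Dt]; apply: contra_notP => Nt.
by rewrite indicE mem_set ?mulr1.
Qed.

Section StronglyMeasurable.
Variables (T : R).
Let DT : set R := `]0, T[.
Let mDT : measurable DT. Proof. exact: measurable_itv. Qed.

Lemma ae_DT (P : R -> Prop) : {ae mu, forall t, 0 < t < T -> P t} ->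
  {ae mu, forall t, DT t -> P t}.
Proof. by apply: ae_imp => t h Dt; apply: h; move: Dt; rewrite /DT /= in_itv. Qed.

Lemma aemeas_strongly2 X Y (Phi : rep X -> rep Y -> R) (f : R -> rep X) (g : R -> rep Y) :
  prenormed X -> prenormed Y -> strongly_measurable T f -> strongly_measurable T g ->
  {ae mu, forall t, DT t -> elts X (f t)} -> {ae mu, forall t, DT t -> elts Y (g t)} ->
  (forall u v un vn, elts X u -> elts Y v -> ncvg un u -> ncvg vn v ->
     Phi (un n) (vn n) @[n --> \oo] --> Phi u v) ->
  aemeas DT (fun t => Phi (f t) (g t)).
Proof.
move=> nX nY [s [ss sf]] [s' [ss' sg]] ef eg cPhi.
apply: (aemeas_limit mDT (F := fun n t => Phi (s n t) (s' n t))).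
  move=> n; have [n1 [A [c [hA sE]]]] := ss n.
  have -> : (fun t => Phi (s n t) (s' n t)) =
     (fun t => Phi (\sum_(k < n1) (\1_(A k) t : R) *: c k) (s' n t)).
    by apply/funext => t; rewrite sE.
  exact: (@simple_fun_measurable2 X Y n1 A c (s' n) (ss' n) (fun k kn => (hA k kn).1) Phi).
apply: ae_imp2 (ae_imp2 (fun t a b => conj a b) ef eg)
  (ae_imp2 (fun t a b => conj a b) (ae_DT sf) (ae_DT sg)) => t [h1 h2] [h3 h4] Dt.
apply: cPhi; [exact: h1|exact: h2| |].
  split; last exact: h3.
  by move=> n; apply: simple_elts (ss n); exact: prenormed_subspace.
split; last exact: h4.
by move=> n; apply: simple_elts (ss' n); exact: prenormed_subspace.
Qed.

Lemma aemeas_strongly X (Phi : rep X -> R) (f : R -> rep X) :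
  prenormed X -> strongly_measurable T f ->
  {ae mu, forall t, DT t -> elts X (f t)} ->
  (forall u un, elts X u -> ncvg un u -> Phi (un n) @[n --> \oo] --> Phi u) ->
  aemeas DT (fun t => Phi (f t)).
Proof.
move=> nX sf ef cPhi.
apply: (aemeas_strongly2 (Phi := fun u _ => Phi u) nX nX sf sf ef ef).
by move=> u v un vn Xu _ cu _; exact: cPhi.
Qed.

Lemma ncvg_nrm X (u : rep X) un : prenormed X -> elts X u -> ncvg un u ->
  nrm (un n) @[n --> \oo] --> nrm u.
Proof.
move=> nX Xu [Xn cn]; apply/cvgrPdist_le => e e0.
have /cvgrPdist_le /(_ e e0) := cn; apply: filterS => n.
rewrite sub0r normrN; apply: le_trans; rewrite distrC.
by apply: le_trans (prenormed_dist nX (Xn n) Xu) (ler_norm _).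
Qed.

Lemma L2B_elts X (f : R -> rep X) : L2B T f -> {ae mu, forall t, DT t -> elts X (f t)}.
Proof. by move=> [/ae_DT]. Qed.

Lemma L2B_strong X (f : R -> rep X) : L2B T f -> strongly_measurable T f.
Proof. by case. Qed.

Lemma L2B_sqint X (f : R -> rep X) : prenormed X -> L2B T f ->
  sqint DT (fun t => nrm (f t)).
Proof.
move=> nX Lf; have [_ sf iF] := Lf; have ef := L2B_elts Lf.
have mf : aemeas DT (fun t => nrm (f t)).
  apply: (aemeas_strongly nX sf ef) => u un Xu; exact: ncvg_nrm.
split => //; have [h mh fh] := mf.
have fh2 : aeeq DT (fun t => nrm (f t) ^+ 2) (fun t => h t ^+ 2).
  by apply: ae_imp fh => t ft Dt; rewrite ft.
apply: aeint_ext (fh2) _; apply: aeint_integrable => //; apply/integrableP; split.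
  by apply/measurable_EFinP; apply: measurable_funTS; exact: measurable_funX.
rewrite (@integral_ae_ext _ _ _ mu DT _ (fun t => (nrm (f t) ^+ 2)%:E)) //.
by apply: ae_imp fh2 => t ft Dt; rewrite /= ft// ger0_norm ?sqr_ge0.
Qed.

(** Almost all values lie in the closure of a countable set; the sequence in the
    existential makes this usable without a metric on representatives. *)
Definition countably_valued X (f : R -> rep X) := exists2 d : nat -> rep X,
  (forall i, elts X (d i)) &
  {ae mu, forall t, DT t -> exists k : nat -> nat,
     nrm (d (k n) - f t) @[n --> \oo] --> (0 : R)}.

(** The countable set consists of all values that the approximating simple functions
    can take.  The n-th of them is determined by the subset of its measurable sets
    that contain the point, which is coded by a sequence of booleans. *)
Lemma strongly_countable X (f : R -> rep X) : subspace_elts X ->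
  strongly_measurable T f -> countably_valued f.
Proof.
move=> sX [s [ss sf]].
have /choice[N /choice[A /choice[c hc]]] := ss.
pose val (p : nat * seq bool) : rep X :=
  \sum_(k < N p.1) (nth false p.2 k)%:R *: c p.1 k.
have eval p : elts X (val p).
  apply: (subspace_sum sX (F := fun k => (nth false p.2 k)%:R *: c p.1 k)) => k kN.
  by apply: subspaceZ => //; have [/(_ k kN)[]] := hc p.1.
exists (fun i => oapp val 0 (unpickle i)).
  by move=> i; case: (unpickle i) => [p|] /=; [exact: eval|exact: sX.1].
apply: ae_imp (ae_DT sf) => t st Dt.
(* the sequence of booleans records which of the sets A n k contain t *)
exists (fun n => pickle (n, mkseq (fun k => t \in A n k) (N n))).
move: (st Dt); apply: cvg_trans; apply: near_eq_cvg; apply: nearW => n /=.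
rewrite pickleK /= /val /=; congr (nrm (_ - _)); have [_ ->] := hc n.
apply: eq_bigr => k _; by rewrite nth_mkseq// indicE.
Qed.

Lemma countable_map X Y (F : rep X -> rep Y) (f : R -> rep X) :
  {ae mu, forall t, DT t -> elts X (f t)} ->
  (forall u, elts X u -> elts Y (F u)) ->
  (forall u un, elts X u -> ncvg un u -> nrm (F (un n) - F u) @[n --> \oo] --> (0 : R)) ->
  countably_valued f -> countably_valued (fun t => F (f t)).
Proof.
move=> ef eF cF [d ed df]; exists (fun i => F (d i)); first by move=> i; exact: eF.
apply: ae_imp2 ef df => t et dt Dt; have [k hk] := dt Dt; exists k.
by apply: (cF (f t) (fun n => d (k n)) (et Dt)); split.
Qed.

Lemma countable_add X (f g : R -> rep X) : prenormed X ->
  {ae mu, forall t, DT t -> elts X (f t)} -> {ae mu, forall t, DT t -> elts X (g t)} ->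
  countably_valued f -> countably_valued g -> countably_valued (fun t => f t + g t).
Proof.
move=> nX ef eg [d ed df] [d' ed' dg]; have sX := prenormed_subspace nX.
exists (fun i => oapp (fun p : nat * nat => d p.1 + d' p.2) 0 (unpickle i)).
  by move=> i; case: (unpickle i) => [p|] /=; [exact: subspaceD|exact: sX.1].
apply: ae_imp2 (ae_imp2 (fun t a b => conj a b) ef eg)
  (ae_imp2 (fun t a b => conj a b) df dg) => t [h1 h2] [h3 h4] Dt.
have [k hk] := h3 Dt; have [k' hk'] := h4 Dt.
exists (fun n => pickle (k n, k' n)).
under eq_fun do rewrite pickleK /=.
have lim0 : nrm (d (k n) - f t) + nrm (d' (k' n) - g t) @[n --> \oo] --> (0 : R).
  by rewrite -[X in _ --> X](addr0 0); exact: cvgD.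
apply: (squeeze_cvgr _ (cvg_cst 0) lim0); apply: nearW => n.
have e1 := subspaceB sX (ed (k n)) (h1 Dt).
have e2 := subspaceB sX (ed' (k' n)) (h2 Dt).
have -> : d (k n) + d' (k' n) - (f t + g t) = (d (k n) - f t) + (d' (k' n) - g t).
  by rewrite opprD addrACA.
have [_ n0 nD _] := nX; rewrite n0 ?nD//; exact: subspaceD.
Qed.

(** Only countably many null sets are used: for each d i near a value of G and each
    tolerance, choose a vector of the unit ball at
    which d i almost reaches its norm.  Where G
    vanishes at all these vectors, a d i close to G t has small norm, so G t has
    norm 0. *)
Lemma dual_ae_zero X (G : R -> rep (dual X)) : prenormed X ->
  {ae mu, forall t, DT t -> elts (dual X) (G t)} -> countably_valued G ->
  forall E : set R, E `<=` DT ->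
  (forall v, elts X v -> {ae mu, forall t, E t -> G t v = 0}) ->
  {ae mu, forall t, E t -> forall v, elts X v -> G t v = 0}.
Proof.
move=> nX eG [d ed dG] E ED G0; have [sX n0 _ _] := nX.
have /choice[v hv] : forall p : nat * nat, exists v, [/\ elts X v, nrm v <= 1 &
    nrm (d p.1) - p.2.+1%:R^-1 < `|d p.1 v|].
  move=> [i j] /=; have j0 : 0 < j.+1%:R^-1 :> R by rewrite invr_gt0.
  have [_ [v [Xv v1] <-] hv] := sup_adherent j0 (dset_bounded nX (ed i)).
  by exists v; split.
have [dn0] : (forall f, elts (dual X) f -> 0 <= nrm (f : rep (dual X))) /\
  subspace_elts (dual X) by have [] := prenormed_dual nX.
move=> sD; have ndD := prenormed_dual nX.
have Gv : {ae mu, forall t, forall i, E t -> G t (oapp v 0 (unpickle i)) = 0}.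
  apply: ae_foralln => i; apply: G0.
  by case: (unpickle i) => [p|] /=; [case: (hv p)|exact: sX.1].
apply: ae_imp3 eG dG Gv => t eGt dGt Gvt Et; have Dt := ED t Et.
have {}eGt := eGt Dt; have [k hk] := dGt Dt.
suff z : nrm (G t : rep (dual X)) <= 0.
  move=> u Xu; apply/eqP; rewrite -normr_le0; apply: le_trans (dual_le nX eGt Xu) _.
  by rewrite mulr_le0_ge0// n0.
apply/ler_addgt0Pr => e e0; rewrite add0r.
have e3 : 0 < e / 3 by rewrite divr_gt0.
have /cvgrPdist_le /(_ _ e3) [n0' _ hn] := hk.
have [j hj] : exists j : nat, j.+1%:R^-1 < e / 3.
  have /cvgrPdist_lt /(_ _ e3) [j _ hj] := @cvg_harmonic R.
  exists j; have := hj j (leqnn _); rewrite sub0r normrN => /(le_lt_trans _); apply.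
  exact: ler_norm.
have := hn n0' (leqnn _); rewrite sub0r normrN; set i := k n0' => di.
have eB := subspaceB sD (ed i) eGt.
rewrite ger0_norm ?dn0// in di.
have [Xv v1 hv'] := hv (i, j).
have Gtv : G t (v (i, j)) = 0 by have := Gvt (pickle (i, j)) Et; rewrite pickleK.
have h1 : `|d i (v (i, j))| <= e / 3.
  rewrite -[d i _]subr0 -Gtv; apply: (le_trans (dual_le nX eB Xv)).
  by apply: le_trans di; rewrite -[leRHS]mulr1 ler_wpM2l// dn0.
have h2 : nrm (G t : rep (dual X)) <= nrm (d i : rep (dual X)) + nrm (d i - G t : rep (dual X)).
  have := prenormed_dist ndD (ed i) eGt; rewrite ler_norml => /andP[h _].
  by move: h; lra.
have F (a b c d' j' : R) : b - j' < c -> c <= e / 3 -> a <= b + d' -> d' <= e / 3 ->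
    j' < e / 3 -> a <= e by lra.
exact: F hv' h1 h2 di hj.
Qed.

(** The function zeta is approximated at t by its value at the largest multiple of
    1 / (n + 1) below t. *)
Lemma L2B_separated X (zeta : R -> R) (c : rep X) : prenormed X -> 0 < T ->
  continuous zeta -> elts X c -> L2B T (fun t => zeta t *: c).
Proof.
move=> nX T0 cz Xc; have [sX n0 _ nZ] := nX.
split; first by apply: aeW => t _; exact: subspaceZ.
- pose A (n k : nat) : set R := `[k%:R / n.+1%:R, k.+1%:R / n.+1%:R[%classic.
  pose N n := (Num.truncn (T * n.+1%:R)).+1.
  pose s n t : rep X := \sum_(k < N n) (\1_(A n k) t : R) *: (zeta (k%:R / n.+1%:R) *: c).
  exists s; split.
    move=> n; exists (N n), (A n), (fun k => zeta (k%:R / n.+1%:R) *: c).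
    by split => // k _; split; [exact: measurable_itv|exact: subspaceZ].
  apply: aeW => t /andP[t0 tT].
  pose k n := Num.truncn (t * n.+1%:R).
  have kt n : (k n)%:R <= t * n.+1%:R < (k n).+1%:R.
    by apply: truncn_itv; rewrite mulr_ge0// ltW.
  have sE n : s n t = zeta ((k n)%:R / n.+1%:R) *: c.
    have n10 : 0 < n.+1%:R :> R by rewrite ltr0n.
    have kN : (k n < N n)%N.
      rewrite ltnS /k /N; apply: le_truncn.
      by rewrite ler_wpM2r// ltW.
    rewrite /s (bigD1 (Ordinal kN))//= big1 ?addr0.
      rewrite indicE mem_set ?scale1r// /A /= in_itv/=.
      by rewrite ler_pdivrMr// ltr_pdivlMr//; exact: kt.
    move=> i ik; rewrite indicE memNset ?scale0r// /A /= in_itv/=.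
    rewrite ler_pdivrMr// ltr_pdivlMr// => h; move/negP: ik; apply.
    by apply/eqP/val_inj => /=; rewrite /k (truncn_def h).
  have lim0 : nrm c * `|zeta ((k n)%:R / n.+1%:R) - zeta t| @[n --> \oo] --> (0 : R).
    rewrite -[X in _ --> X](mulr0 (nrm c)); apply: cvgMr.
    rewrite -[X in _ --> X](@normr0 R R); apply: cvg_norm.
    rewrite -[X in _ --> X](subrr (zeta t)); apply: cvgB; last exact: cvg_cst.
    apply: cvg_comp; last exact: cz.
    apply/cvgrPdist_le => e e0.
    have /cvgrPdist_le /(_ _ e0) := @cvg_harmonic R; apply: filterS => n.
    rewrite sub0r normrN => h; rewrite distrC; apply: le_trans h.
    have /andP[h1 h2] := kt n; have n10 : 0 < n.+1%:R :> R by rewrite ltr0n.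
    have F (y N' a : R) : 0 < N' -> a <= y * N' -> y * N' < a + 1 -> `|a / N' - y| <= `|N'^-1|.
      move=> N0; rewrite -ler_pdivrMr// -ltr_pdivlMr// mulrDl mul1r => ay ya.
      by rewrite [`|N'^-1|]gtr0_norm ?invr_gt0// distrC ger0_norm; lra.
    by apply: F n10 h1 _; rewrite natr1.
  apply: cvg_trans lim0; apply: near_eq_cvg; apply: nearW => n.
  by rewrite sE -scalerBl nZ// mulrC.
- have := @aeint_continuous R 0 T (fun t => (zeta t * nrm c) ^+ 2).
  have cc : continuous (fun t => (zeta t * nrm c) ^+ 2).
    move=> t; apply: (@continuous_comp _ _ _ (fun t => zeta t * nrm c) (fun s : R => s ^+ 2)).
      by apply: cvgMl; exact: cz.
    exact: exprn_continuous.
  move=> /(_ cc) [h [mh ih hE]].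
  rewrite (@integral_ae_ext _ _ _ mu DT _ (EFin \o h)).
    exact: (@integrable_lty _ _ _ mu DT mDT _ ih).
  apply: ae_imp hE => t ht Dt; rewrite /= -ht// nZ// !exprMn real_normK ?num_real//.
Qed.

End StronglyMeasurable.

End BochnerTools.

(** * Bounded bilinear pairings *)

Section Pairings.
Context {R : realType}.
Notation mu := (@lebesgue_measure R).
Implicit Types X Y : nspace R.

(** Used for b on H and between H and V, for A and B on V, and for the evaluation
    between V' and V. *)
Definition pairing X Y (F : rep X -> rep Y -> R) (C : R) :=
  [/\ 0 <= C, forall u v, elts X u -> elts Y v -> `|F u v| <= C * nrm u * nrm v,
      forall (a : R) u u' v, elts X u -> elts X u' -> elts Y v ->
        F (a *: u + u') v = a * F u v + F u' v &
      forall (a : R) u v v', elts X u -> elts Y v -> elts Y v' ->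
        F u (a *: v + v') = a * F u v + F u v'].

Lemma form_pairing X (b : rep X -> rep X -> R) C : prenormed X -> sform b -> 0 <= C ->
  (forall u, elts X u -> b u u <= C * nrm u ^+ 2) -> pairing (X := X) (Y := X) b C.
Proof.
move=> nX fb C0 bC; have [bl bs _] := fb; have sX := prenormed_subspace nX.
split => // [u v|a u v v' Xu Xv Xv']; first exact: (form_bounded nX fb C0 bC).
by rewrite bs ?bl// ?[b v' u]bs ?[b v u]bs//; apply: sX.2.
Qed.

Lemma dual_pairing X : prenormed X ->
  pairing (X := dual X) (Y := X) (fun f v => f v) 1.
Proof.
move=> nX; split => //; last by move=> a f v v' [flin _] Xv Xv'; exact: flin.
by move=> f v df Xv; rewrite mul1r; exact: dual_le.
Qed.

Section OnePairing.
Variables (X Y : nspace R) (F : rep X -> rep Y -> R) (C : R).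
Hypotheses (nX : prenormed X) (nY : prenormed Y) (pF : pairing F C).

Lemma pairing_dual u : elts X u -> elts (dual Y) (F u).
Proof.
move=> Xu; have [C0 bF _ Fr] := pF; split; first by move=> a v v' Yv Yv'; exact: Fr.
by exists (C * nrm u) => v Yv; exact: bF.
Qed.

Lemma pairing_dual_l v : elts Y v -> elts (dual X) (fun u => F u v).
Proof.
move=> Yv; have [C0 bF Fl _] := pF; split; first by move=> a u u' Xu Xu'; exact: Fl.
by exists (C * nrm v) => u Xu; rewrite mulrAC; exact: bF.
Qed.

Lemma pairing_cvg u v un vn : elts X u -> elts Y v -> ncvg un u -> ncvg vn v ->
  F (un n) (vn n) @[n --> \oo] --> F u v.
Proof.
move=> Xu Yv cu cv; have [C0 bF _ _] := pF; have [Xun un0] := cu; have [Yvn vn0] := cv.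
have sX := prenormed_subspace nX; have sY := prenormed_subspace nY.
have lim : C * nrm (un n - u) * nrm (vn n) + C * nrm u * nrm (vn n - v) @[n --> \oo] --> (0 : R).
  rewrite (_ : (0 : R) = C * 0 * nrm v + C * nrm u * 0); last by rewrite !mulr0 mul0r addr0.
  apply: cvgD; last exact: cvgMr.
  by apply: cvgM; [exact: cvgMr|exact: ncvg_nrm].
apply/cvgrPdist_le => e e0; move/cvgrPdist_le: lim => /(_ e e0); apply: filterS => n.
rewrite sub0r normrN => h; apply: le_trans h; apply: le_trans (ler_norm _).
have -> : F u v - F (un n) (vn n) = - (F (un n - u) (vn n) + F u (vn n - v)).
  rewrite (dualB nY (pairing_dual Xu))// (dualB nX (pairing_dual_l (Yvn n)))//; ring.
rewrite normrN; apply: le_trans (ler_normD _ _) _; apply: lerD; apply: bF => //.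
  exact: subspaceB.
exact: subspaceB.
Qed.

Variables (T : R).
Let DT : set R := `]0, T[.
Let mDT : measurable DT. Proof. exact: measurable_itv. Qed.

Lemma pairing_aeint f g : L2B T f -> L2B T g -> aeint DT (fun t => F (f t) (g t)).
Proof.
move=> Lf Lg; have [C0 bF _ _] := pF.
apply: (@aeint_dom _ DT _ (fun t => C * (nrm (f t) * nrm (g t)))) => //.
- apply: (aemeas_strongly2 nX nY (L2B_strong Lf) (L2B_strong Lg) (L2B_elts Lf) (L2B_elts Lg)).
  exact: pairing_cvg.
- by apply: aeintZ => //; apply: sqintM => //; exact: L2B_sqint.
- apply: ae_imp2 (L2B_elts Lf) (L2B_elts Lg) => t ft gt Dt.
  by rewrite mulrA; apply: bF; [exact: ft|exact: gt].
Qed.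

Lemma pairing_sqint f v : elts Y v -> L2B T f -> sqint DT (fun t => F (f t) v).
Proof.
move=> Yv Lf; have [C0 bF _ _] := pF; have [sY _ _ _] := nY.
have mF : aemeas DT (fun t => F (f t) v).
  apply: (aemeas_strongly (Phi := fun u => F u v) nX (L2B_strong Lf) (L2B_elts Lf)) => u un Xu cu.
  apply: (pairing_cvg (vn := fun=> v) Xu Yv cu); split => //.
  by under eq_fun do rewrite subrr nrm0//; exact: cvg_cst.
split => //; apply: (@aeint_dom _ DT _ (fun t => (C * nrm v * nrm (f t)) ^+ 2)) => //.
- exact: aemeasX.
- by apply: (sqintZ _ mDT (L2B_sqint nX Lf)).2.
- apply: ae_imp (L2B_elts Lf) => t ft Dt.
  rewrite normrX ler_sqr ?nnegrE//; first by rewrite mulrAC; apply: bF; [exact: ft|].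
  by have [_ n0 _ _] := nX; have [_ n0' _ _] := nY; rewrite !mulr_ge0// ?n0' ?n0//; exact: ft.
Qed.

Lemma pairing_countable f : {ae mu, forall t, DT t -> elts X (f t)} ->
  countably_valued T f -> countably_valued T (X := dual Y) (fun t => F (f t)).
Proof.
move=> ef; have [C0 bF Fl _] := pF; have sX := prenormed_subspace nX.
apply: (countable_map (F := F : rep X -> rep (dual Y)) ef); first exact: pairing_dual.
move=> u un Xu [Xun un0]; have [sD n0 _ _] := prenormed_dual nY.
have lim : C * nrm (un n - u) @[n --> \oo] --> (0 : R).
  by rewrite -[X in _ --> X](mulr0 C); exact: cvgMr.
apply: (squeeze_cvgr _ (cvg_cst 0) lim); apply: nearW => n.
rewrite n0/=; last by apply: (subspaceB sD); exact: pairing_dual.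
apply: dual_nrm_le => // v Yv v1.
have -> : (F (un n) - F u : rep (dual Y)) v = F (un n - u) v.
  by rewrite (dualB nX (pairing_dual_l Yv)).
have Xd := subspaceB sX (Xun n) Xu; apply: le_trans (bF _ _ Xd Yv) _.
by rewrite ler_piMr// mulr_ge0//; have [_ n0X _ _] := nX; exact: n0X.
Qed.

End OnePairing.

(** The integral in the definition of L2B is an extended real number that does not
    presuppose measurability; it is finite as soon as the class is square
    integrable. *)
Lemma L2B_intro X T (f : R -> rep X) : {ae mu, forall t, 0 < t < T -> elts X (f t)} ->
  strongly_measurable T f -> sqint `]0, T[ (fun t => nrm (f t)) -> L2B T f.
Proof.
move=> ef sf [_ [h [mh ih hE]]]; split => //.
rewrite (@integral_ae_ext _ _ _ mu `]0, T[%classic _ (EFin \o h)).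
  exact: (@integrable_lty _ _ _ mu `]0, T[%classic (measurable_itv _) _ ih).
by apply: ae_imp hE => t ht Dt; rewrite /= -ht.
Qed.

Lemma L2B_embed (L : lmodType R) (E1 E2 : set L) (n1 n2 : L -> R) (C T : R) (f : R -> L) :
  let X1 := NSpace E1 n1 in let X2 := NSpace E2 n2 in
  prenormed X1 -> prenormed X2 -> E1 `<=` E2 -> 0 <= C ->
  (forall u, E1 u -> n2 u <= C * n1 u) -> L2B T (X := X1) f -> L2B T (X := X2) f.
Proof.
move=> X1 X2 p1 p2 E12 C0 n12 Lf; have [ef [s [ss sf]] _] := Lf.
have mDT : measurable (`]0, T[%classic : set R) by exact: measurable_itv.
have [sX1 n1p _ _] := p1; have [sX2 n2p _ _] := p2.
have ef2 : {ae mu, forall t, 0 < t < T -> elts X2 (f t)}.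
  by apply: ae_imp ef => t ft Dt; apply: E12; exact: ft.
have sf2 : strongly_measurable T (X := X2) f.
  exists s; split.
    move=> n; have [k [A [c [hA sE]]]] := ss n; exists k, A, c; split => // i ik.
    by have [mA Ec] := hA i ik; split => //; exact: E12.
  apply: ae_imp2 ef sf => t ft st Dt; have e1 := ft Dt.
  have lim : C * n1 (s n t - f t) @[n --> \oo] --> (0 : R).
    by rewrite -[X in _ --> X](mulr0 C); apply: cvgMr; exact: st.
  apply: (squeeze_cvgr _ (cvg_cst 0) lim); apply: nearW => n.
  have e3 : E1 (s n t - f t) by apply: (subspaceB sX1) => //; exact: simple_elts (ss n).
  by rewrite [0 <= _]n2p ?n12//=; exact: E12.
apply: (L2B_intro ef2 sf2).
have mN : aemeas `]0, T[ (fun t => n2 (f t)).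
  by apply: (aemeas_strongly p2 sf2 (ae_DT ef2)) => u un Xu; exact: ncvg_nrm.
split => //; apply: (@aeint_dom _ _ _ (fun t => (C * n1 (f t)) ^+ 2)) => //.
- exact: aemeasX.
- by apply: (sqintZ _ mDT (L2B_sqint p1 Lf)).2.
- apply: ae_imp (ae_DT ef) => t ft Dt; rewrite ger0_norm ?sqr_ge0// ler_sqr ?nnegrE.
  + exact: n12 (ft Dt).
  + exact: n2p (E12 _ (ft Dt)).
  + by rewrite mulr_ge0//; exact: n1p (ft Dt).
Qed.

End Pairings.

(** * Hamilton's principle in abstract spaces *)

Section HamiltonPrinciple.
Context {R : realType} (L : lmodType R) (EV EH : set L) (nV nH : L -> R).
Notation mu := (@lebesgue_measure R).
Let V : nspace R := NSpace EV nV.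
Let H : nspace R := NSpace EH nH.
Variables (b B A : L -> L -> R) (CH CB CA K k beta : R) (T : R).
Hypotheses (nmV : prenormed V) (nmH : prenormed H) (EVH : EV `<=` EH).
Hypotheses (CH0 : 0 <= CH) (VH : forall u, EV u -> nH u <= CH * nV u).
Hypotheses (fb : sform (X := H) b) (nHE : forall u, nH u = Num.sqrt (b u u)).
Hypotheses (fB : sform (X := V) B) (CB0 : 0 <= CB)
  (BC : forall u, EV u -> B u u <= CB * nV u ^+ 2).
Hypotheses (fA : sform (X := V) A) (CA0 : 0 <= CA)
  (AC : forall u, EV u -> A u u <= CA * nV u ^+ 2).
Hypotheses (K0 : 0 <= K) (interp : forall u, EV u -> A u u <= K * nH u * nV u).
Hypotheses (T0 : 0 < T).

Let DT : set R := `]0, T[.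
Let mDT : measurable DT. Proof. exact: measurable_itv. Qed.
Let sV := prenormed_subspace nmV.
Let sH := prenormed_subspace nmH.
Let nmV' := prenormed_dual nmV.

Let nV0 u : EV u -> 0 <= nV u. Proof. by have [_ h _ _] := nmV; exact: h. Qed.
Let nH0 u : EH u -> 0 <= nH u. Proof. by have [_ h _ _] := nmH; exact: h. Qed.

Let bH u : EH u -> b u u <= 1 * nH u ^+ 2.
Proof. by move=> Eu; rewrite nHE sqr_sqrtr ?mul1r//; have [_ _ b0] := fb; exact: b0. Qed.

Let pHH : pairing (X := H) (Y := H) b 1. Proof. by apply: form_pairing => //; exact: bH. Qed.
Let pB : pairing (X := V) (Y := V) B CB. Proof. exact: form_pairing. Qed.
Let pA : pairing (X := V) (Y := V) A CA. Proof. exact: form_pairing. Qed.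
Let pHV : pairing (X := H) (Y := V) b CH.
Proof.
have [_ hb hl hr] := pHH; split => //.
- move=> u v Eu Ev; apply: le_trans (hb u v Eu (EVH Ev)) _; rewrite mul1r mulrC [leRHS]mulrAC.
  by apply: ler_wpM2r; [exact: nH0|exact: VH].
- by move=> a u u' v Eu Eu' Ev; apply: hl => //; exact: EVH.
- by move=> a u v v' Eu Ev Ev'; apply: hr => //; exact: EVH.
Qed.
Let pE := dual_pairing nmV.

(** Integration by parts in time, written in the order of factors used in the
    definition of distributional derivatives. *)
Lemma weak_deriv_smooth (z : R -> R) (c : R) : smooth z ->
  forall phi, test_function 0 T phi ->
  \int[mu]_(t in DT) (derive1 phi t * (z t * c)) =
  - \int[mu]_(t in DT) (phi t * (derive1 z t * c)).
Proof.
move=> sz phi tphi; have sz' := smooth_derive1 sz; have sphi := test_smooth tphi.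
have zp : aeeq DT z (fun t => z 0 + prim 0 (derive1 z) t).
  by apply: eq_aeeq => t; rewrite /DT/= in_itv/= => /andP[/ltW t0 _]; exact: smooth_prim.
have := weak_deriv_prim (ltW T0) (aeint_smooth 0 T sz') zp tphi => h.
have i1 : aeint DT (fun t => z t * derive1 phi t).
  by apply: aeint_smooth; exact: (smoothM sz (smooth_derive1 sphi)).
have i2 : aeint DT (fun t => derive1 z t * phi t) by apply: aeint_smooth; exact: (smoothM sz' sphi).
rewrite (_ : (fun t => derive1 phi t * (z t * c)) = (fun t => c * (z t * derive1 phi t))).
  rewrite (_ : (fun t => phi t * (derive1 z t * c)) = (fun t => c * (derive1 z t * phi t))).
    by rewrite (RintZ c mDT i1) (RintZ c mDT i2) h mulrN.
  by apply/funext => t; ring.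
by apply/funext => t; ring.
Qed.

Lemma separated_regular (zeta : R -> R) v : smooth zeta -> EV v ->
  [/\ L2B T (X := V) (fun t => zeta t *: v),
      L2B T (X := H) (fun t => derive1 zeta t *: v),
      L2B T (X := dual V) (fun t => derive1n 2 zeta t *: (b v : rep (dual V))),
      dist_deriv T (X := V) (fun t => b (zeta t *: v)) (fun t => b (derive1 zeta t *: v)) &
      dist_deriv T (X := V) (fun t => b (derive1 zeta t *: v))
        (fun t => derive1n 2 zeta t *: (b v : rep (dual V)))].
Proof.
move=> sz Ev; have sz' := smooth_derive1 sz; have sz2 := smooth_derive1 sz'.
have EvH := EVH Ev; have bd := pairing_dual pHV EvH; split.
- exact: (L2B_separated nmV T0 (smooth_continuous sz)).
- exact: (L2B_separated nmH T0 (smooth_continuous sz')).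
- exact: (L2B_separated nmV' T0 (smooth_continuous sz2)).
- move=> phi w tphi Ew; have := weak_deriv_smooth (b v w) sz tphi.
  under [in X in X -> _]eq_Rintegral do rewrite -(sformZl sH fb _ EvH (EVH Ew)).
  by under [in X in _ = - X -> _]eq_Rintegral do rewrite -(sformZl sH fb _ EvH (EVH Ew)).
- move=> phi w tphi Ew; have := weak_deriv_smooth (b v w) sz' tphi.
  by under [in X in X = _ -> _]eq_Rintegral do rewrite -(sformZl sH fb _ EvH (EVH Ew)).
Qed.

Variables (y v1 p : R -> L) (acc : R -> (L -> R)).
Hypotheses (Ly : L2B T (X := V) y) (Lv : L2B T (X := H) v1)
  (Lp : L2B T (X := H) p) (La : L2B T (X := dual V) acc).
Hypotheses (dy : dist_deriv T (X := V) (fun t => b (y t)) (fun t => b (v1 t)))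
  (dv : dist_deriv T (X := V) (fun t => b (v1 t)) acc).

Let LyH : L2B T (X := H) y.
Proof. exact: (L2B_embed nmV nmH EVH CH0 VH Ly). Qed.

(** For fixed E, the function b (y t) E has the integrable weak derivative
    b (v1 t) E, so it varies by at most 2 * N * nH E, where N is the integral of
    nH (v1 t).  For E running through the differences of a countable set dense in
    the values of y, one null set suffices; E may then tend to y t - y t0, which
    yields nH (y t - y t0) <= 2 * N. *)
Lemma position_bounded : exists2 M : R, 0 <= M & {ae mu, forall t, DT t -> nH (y t) <= M}.
Proof.
have [d ed dd] := strongly_countable sV (L2B_strong Ly).
pose N := \int[mu]_(t in DT) nH (v1 t).
have iN : aeint DT (fun t => nH (v1 t)) by apply: sqint_aeint; exact: (L2B_sqint nmH Lv).
have N0 : 0 <= N.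
  by apply: Rint_ge0; apply: ae_imp (L2B_elts Lv) => t vt Dt; exact: nH0 (vt Dt).
(* differences, because y t - y t0 is approximated by d i - d j *)
pose E (q : nat * nat) := d q.1 - d q.2.
have EE q : EV (E q) by exact: (subspaceB sV (ed _) (ed _)).
have primE q : exists c, aeeq DT (fun t => b (y t) (E q))
    (fun t => c + prim 0 (fun s => b (v1 s) (E q)) t).
  apply: weak_deriv_primitive => //.
  - by apply: sqint_aeint; exact: (pairing_sqint nmH nmV pHV (EE q) LyH).
  - by apply: sqint_aeint; exact: (pairing_sqint nmH nmV pHV (EE q) Lv).
  - move=> phi tphi; have := dy tphi (EE q).
    under eq_Rintegral do rewrite mulrC.
    by under [X in _ = - X -> _]eq_Rintegral do rewrite mulrC.
have pbound q t : DT t -> `|prim 0 (fun s => b (v1 s) (E q)) t| <= N * nH (E q).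
  move=> Dt; have tT : t <= T by move: Dt; rewrite /DT/= in_itv/= => /andP[_ /ltW].
  have ib : aeint DT (fun s => b (v1 s) (E q)).
    by apply: sqint_aeint; exact: (pairing_sqint nmH nmV pHV (EE q) Lv).
  apply: le_trans (prim_norm (ltW T0) tT ib) _.
  rewrite mulrC -RintZ//; apply: le_Rint => //; [exact: aeint_norm|exact: aeintZ|].
  apply: ae_imp (L2B_elts Lv) => s vs Ds; have [_ hb _ _] := pHH.
  by apply: le_trans (hb _ _ (vs Ds) (EVH (EE q))) _; rewrite mul1r mulrC.
have /choice[c hc] := primE.
have all : {ae mu, forall t, forall i, DT t -> b (y t) (E (odflt (0%N, 0%N) (unpickle i))) =
    c (odflt (0%N, 0%N) (unpickle i)) +
    prim 0 (fun s => b (v1 s) (E (odflt (0%N, 0%N) (unpickle i)))) t}.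
  by apply: ae_foralln => i; exact: hc.
pose good t := DT t -> [/\ EV (y t), forall q, b (y t) (E q) =
      c q + prim 0 (fun s => b (v1 s) (E q)) t &
    exists k : nat -> nat, nV (d (k n) - y t) @[n --> \oo] --> (0 : R)].
have ag : {ae mu, forall t, good t}.
  apply: ae_imp3 (L2B_elts Ly) all dd => t yt at' dt Dt; split; [exact: yt|..|exact: dt].
  by move=> q; have := at' (pickle q) Dt; rewrite pickleK.
have [t0 t0T g0] := ae_itv_point T0 ag.
have D0 : DT t0 by rewrite /DT/= in_itv.
have [E0 hE0 [k0 hk0]] := g0 D0.
exists (2 * N + nH (y t0)); first by rewrite addr_ge0 ?mulr_ge0//; exact: nH0 (EVH E0).
apply: ae_imp ag => t gt Dt; have [Et hEt [k' hk']] := gt Dt.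
have Ew := subspaceB sV Et E0; have EwH := EVH Ew.
have lim : nV (E (k' n, k0 n) - (y t - y t0)) @[n --> \oo] --> (0 : R).
  have l0 : nV (d (k' n) - y t) + nV (d (k0 n) - y t0) @[n --> \oo] --> (0 : R).
    by rewrite -[X in _ --> X](addr0 0); exact: cvgD.
  apply: (squeeze_cvgr _ (cvg_cst 0) l0); apply: nearW => n.
  have e1 := subspaceB sV (ed (k' n)) Et; have e2 := subspaceB sV (ed (k0 n)) E0.
  have -> : E (k' n, k0 n) - (y t - y t0) = (d (k' n) - y t) - (d (k0 n) - y t0).
    have F (a1 a2 a3 a4 : L) : (a1 - a2) - (a3 - a4) = (a1 - a3) - (a2 - a4).
      by rewrite !opprB addrACA [RHS]addrACA [- a3 - _]addrC.
    exact: F.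
  by rewrite [0 <= _](nV0 (subspaceB sV e1 e2)) (prenormed_subD nmV e1 e2).
have limH : ncvg (X := H) (fun n => E (k' n, k0 n)) (y t - y t0).
  split; first by move=> n; exact: EVH (EE _).
  have l0 : CH * nV (E (k' n, k0 n) - (y t - y t0)) @[n --> \oo] --> (0 : R).
    by rewrite -[X in _ --> X](mulr0 CH); exact: cvgMr.
  apply: (squeeze_cvgr _ (cvg_cst 0) l0); apply: nearW => n.
  have e1 := subspaceB sV (EE (k' n, k0 n)) Ew.
  by rewrite [0 <= _](nH0 (EVH e1)) VH.
suff : nH (y t - y t0) <= 2 * N.
  move=> h; have [_ _ nD _] := nmH; rewrite -(subrK (y t0) (y t)).
  by apply: le_trans (nD _ _ EwH (EVH E0)) _; rewrite lerD2r.
have le1 : b (y t - y t0) (y t - y t0) <= 2 * N * nH (y t - y t0).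
  have wcst : ncvg (X := H) (fun=> y t - y t0) (y t - y t0).
    by split => //; under eq_fun do rewrite subrr (nrm0 nmH); exact: cvg_cst.
  have c1 := pairing_cvg nmH nmH pHH EwH EwH wcst limH.
  have c2 : 2 * N * nH (E (k' n, k0 n)) @[n --> \oo] --> 2 * N * nH (y t - y t0).
    by apply: cvgMr; exact: (ncvg_nrm nmH EwH limH).
  apply: (ler_cvg_to c1 c2); apply: nearW => n; set q := (k' n, k0 n).
  have Eq := EE q; have dE := pairing_dual_l pHH (EVH Eq).
  rewrite (dualB nmH dE (EVH Et) (EVH E0)) hEt hE0.
  have F (c' p1 p2 M : R) : `|p1| <= M -> `|p2| <= M -> c' + p1 - (c' + p2) <= 2 * M.
    by rewrite !ler_norml => /andP[_ ?] /andP[? _]; lra.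
  by rewrite -mulrA; apply: F; exact: pbound.
have [n0|n0] := leP (nH (y t - y t0)) 0; first by apply: le_trans n0 _; rewrite mulr_ge0.
rewrite -(ler_pM2r n0); apply: le_trans le1.
by rewrite nHE -expr2 sqr_sqrtr//; have [_ _ b0] := fb; exact: b0.
Qed.

(** The interpolation inequality turns the bound of y in H into
    A (y t) (y t) <= K * M * nV (y t), whose square is integrable. *)
Lemma sqint_axial : sqint DT (fun t => A (y t) (y t)).
Proof.
have [M M0 yM] := position_bounded.
have mA : aemeas DT (fun t => A (y t) (y t)).
  by apply: aeint_aemeas; exact: (pairing_aeint nmV nmV pA Ly Ly).
split => //; apply: (@aeint_dom _ DT _ (fun t => (K * M * nV (y t)) ^+ 2)) => //.
- exact: aemeasX.
- by apply: (sqintZ _ mDT (L2B_sqint nmV Ly)).2.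
- apply: ae_imp2 (L2B_elts Ly) yM => t yt ytM Dt; have Vy := yt Dt.
  have [_ _ A0] := fA; have n0 := nV0 Vy.
  have n1 := nH0 (EVH Vy).
  rewrite normrX ler_sqr ?nnegrE ?mulr_ge0// ger0_norm ?A0//.
  apply: le_trans (interp Vy) _; apply: ler_wpM2r => //.
  by apply: ler_wpM2l => //; exact: ytM.
Qed.

(** Up to the factor 2 * k, the axial force at time t. *)
Definition stiffening t := beta + 2^-1 * A (y t) (y t).

Lemma sqint_stiffening : sqint DT stiffening.
Proof. by apply: sqintD => //; [exact: sqint_cst|apply: sqintZ => //; exact: sqint_axial]. Qed.

Definition lagrangian (y' v' : R -> L) t := 2^-1 * b (v' t) (v' t) - 2^-1 * B (y' t) (y' t) -
  quartic (X := V) A k beta (y' t) + b (p t) (y' t).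

Definition axial_force u v := quartic_grad (X := V) A k beta u v.

Lemma lagrangian_aeint : aeint DT (lagrangian y v1).
Proof.
apply: aeintD => //; last exact: (pairing_aeint nmH nmH pHH Lp LyH).
apply: aeintB => //; last by apply: aeintZ => //; exact: sqint_stiffening.2.
apply: aeintB => //; apply: aeintZ => //.
  exact: (pairing_aeint nmH nmH pHH Lv Lv).
exact: (pairing_aeint nmV nmV pB Ly Ly).
Qed.

Lemma aeint_axial_force v : EV v -> aeint DT (fun t => axial_force (y t) v).
Proof.
move=> Ev; apply: (@aeint_ext _ _ _ (fun t => (2 * k) * (stiffening t * A (y t) v))).
  by apply: eq_aeeq => t _; rewrite /axial_force /quartic_grad mulrA.
apply: aeintZ => //; apply: sqintM => //; first exact: sqint_stiffening.
exact: (pairing_sqint nmV nmV pA Ev Ly).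
Qed.

Let aeV v : EV v -> aeint DT (fun t => B (y t) v).
Proof. by move=> Ev; apply: sqint_aeint; exact: (pairing_sqint nmV nmV pB Ev Ly). Qed.
Let aeP v : EV v -> aeint DT (fun t => b (p t) v).
Proof. by move=> Ev; apply: sqint_aeint; exact: (pairing_sqint nmH nmV pHV Ev Lp). Qed.
Let aeW v : EV v -> aeint DT (fun t => b (v1 t) v).
Proof. by move=> Ev; apply: sqint_aeint; exact: (pairing_sqint nmH nmV pHV Ev Lv). Qed.
Let aeA v : EV v -> aeint DT (fun t => acc t v).
Proof. by move=> Ev; apply: sqint_aeint; exact: (pairing_sqint nmV' nmV pE Ev La). Qed.

(** The integrand of the first variation of the action in the direction
    zeta(t) v. *)
Definition variation1 (zeta : R -> R) v t := b (v1 t) v * derive1 zeta t -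
  (B (y t) v + axial_force (y t) v - b (p t) v) * zeta t.

Lemma lagrangian_expand (zeta : R -> R) v : smooth zeta -> EV v ->
  exists g2 g3 g4 : R -> R, [/\ aeint DT (variation1 zeta v), aeint DT g2,
    aeint DT g3, aeint DT g4 & forall a : R, aeeq DT
    (lagrangian (fun t => y t + a *: (zeta t *: v))
                (fun t => v1 t + a *: (derive1 zeta t *: v)))
    (fun t => lagrangian y v1 t + (a * variation1 zeta v t + (a ^+ 2 * g2 t +
       (a ^+ 3 * g3 t + a ^+ 4 * g4 t))))].
Proof.
move=> sz Ev; have sz' := smooth_derive1 sz.
have s2 := smoothM sz sz; have s3 := smoothM s2 sz; have s4 := smoothM s3 sz.
exists (fun t => 2^-1 * b v v * (derive1 zeta t * derive1 zeta t) -
   (2^-1 * B v v + k * (A (y t) v ^+ 2 + stiffening t * A v v)) * (zeta t * zeta t)).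
exists (fun t => - (k * A v v) * A (y t) v * (zeta t * zeta t * zeta t)).
exists (fun t => - (k * (2^-1 * A v v) ^+ 2) * (zeta t * zeta t * zeta t * zeta t)).
have qA := pairing_sqint nmV nmV pA Ev Ly.
split.
- apply: aeintB => //; apply: aeint_mul_smooth => //; first exact: aeW.
  by apply: aeintB => //; [apply: aeintD => //; [exact: aeV|exact: aeint_axial_force]|exact: aeP].
- apply: (aeintB mDT).
    by apply: aeint_mul_smooth; [exact: aeint_cst|exact: smoothM].
  apply: aeint_mul_smooth; last exact: s2.
  apply: aeintD => //; first exact: aeint_cst.
  apply: aeintZ => //; apply: aeintD => //; first exact: qA.2.
  apply: (@aeint_ext _ _ _ (fun t => A v v * stiffening t)).
    by apply: eq_aeeq => t _; rewrite mulrC.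
  by apply: aeintZ => //; apply: sqint_aeint; exact: sqint_stiffening.
- by apply: aeint_mul_smooth => //; apply: aeintZ => //; exact: sqint_aeint.
- by apply: aeint_mul_smooth => //; exact: aeint_cst.
move=> a; apply: ae_imp3 (L2B_elts Ly) (L2B_elts Lv) (L2B_elts Lp) => t yt vt pt Dt.
have Ey := yt Dt; have Ew := vt Dt; have Ep := pt Dt; rewrite /lagrangian.
have EvH := EVH Ev; have Ez := subspaceZ sV (zeta t) Ev.
have EzH := subspaceZ sH (derive1 zeta t) EvH.
rewrite (sform_expand sH fb a Ew EzH) (sformZl sH fb _ EvH EzH) !(sformZr sH fb _ EvH)//.
rewrite (sform_expand sV fB a Ey Ez) (sformZl sV fB _ Ev Ez) !(sformZr sV fB _ Ev)//.
rewrite (quartic_expand k beta nmV fA a Ey Ez) /quartic_grad (sformZl sV fA _ Ev Ez) !(sformZr sV fA _ Ev)//.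
rewrite (sformDr sH fb (EVH Ey) _ Ep); last by apply: (subspaceZ sH); exact: EVH Ez.
rewrite (sformZr sH fb _ (EVH Ez) Ep) (sformZr sH fb _ EvH Ep).
rewrite /variation1 /stiffening /axial_force /quartic_grad.
move: (b _ _) (b _ _) (b _ _) (b _ _) (b _ _) (B _ _) (B _ _) (B _ _) (A _ _) (A _ _) (A _ _) (derive1 zeta t) (zeta t) (quartic _ _ _ _).
by move=> *; field.
Qed.

Variables (cd t1 t2 : R).
Hypotheses (t10 : 0 <= t1) (t12 : t1 < t2) (t2T : t2 <= T).
Let E : set R := `]t1, t2[.
Let mE : measurable E. Proof. exact: measurable_itv. Qed.
Let ED : E `<=` DT. Proof. exact: sub_itvoo. Qed.

Lemma Rint_closed_itv (f : R -> R) :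
  \int[mu]_(t in `[t1, t2]) f t = \int[mu]_(t in E) f t.
Proof.
apply: Rint_dom; apply: ae_imp2 (ae_neq t1) (ae_neq t2) => t n1 n2.
rewrite /E/= !in_itv/=; split => /andP[h1 h2]; last by rewrite !ltW.
by rewrite !lt_neqAle h1 h2 !andbT; apply/andP; split; apply/eqP => //; exact: nesym.
Qed.

Lemma action_expand (zeta : R -> R) v : smooth zeta -> EV v ->
  exists q2 q3 q4 : R, forall a : R,
    \int[mu]_(t in `[t1, t2]) lagrangian (fun t => y t + a *: (zeta t *: v))
                (fun t => v1 t + a *: (derive1 zeta t *: v)) t -
    \int[mu]_(t in `[t1, t2]) lagrangian y v1 t =
    a * \int[mu]_(t in E) variation1 zeta v t + a ^+ 2 * q2 + a ^+ 3 * q3 + a ^+ 4 * q4.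
Proof.
move=> sz Ev; have [g2 [g3 [g4 [i1 i2 i3 i4 hg]]]] := lagrangian_expand sz Ev.
exists (\int[mu]_(t in E) g2 t), (\int[mu]_(t in E) g3 t), (\int[mu]_(t in E) g4 t) => a.
rewrite !Rint_closed_itv (Rint_ext (aeeq_sub ED (hg a))).
have sub f : aeint DT f -> aeint E f by exact: aeint_sub.
have j0 := sub _ lagrangian_aeint.
have j1 := aeintZ a mE (sub _ i1); have j2 := aeintZ (a ^+ 2) mE (sub _ i2).
have j3 := aeintZ (a ^+ 3) mE (sub _ i3); have j4 := aeintZ (a ^+ 4) mE (sub _ i4).
have j34 := aeintD mE j3 j4; have j234 := aeintD mE j2 j34.
rewrite (RintD mE j0 (aeintD mE j1 j234)) (RintD mE j1 j234) (RintD mE j2 j34) (RintD mE j3 j4).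
rewrite !(RintZ _ mE (sub _ _))//; move: (Rintegral _ _ _) (Rintegral _ _ _) (Rintegral _ _ _) (Rintegral _ _ _) (Rintegral _ _ _) => *; ring.
Qed.

(** The left-hand side of the equation minus the load, as an element of V'.  The last
    two terms are written as images of elements of H so that they are separably
    valued as such. *)
Definition residual t : rep (dual V) :=
  acc t + (B (y t) : rep (dual V)) + (axial_force (y t) : rep (dual V)) +
  ((fun v => b ((- 1) *: p t) v) : rep (dual V)) +
  ((fun v => b (cd *: v1 t) v) : rep (dual V)).

Lemma residualE t v : EV v -> EH (p t) -> EH (v1 t) -> residual t v =
  acc t v + B (y t) v + axial_force (y t) v - b (p t) v + cd * b (v1 t) v.
Proof.
move=> Ev Ep Ew; have EvH := EVH Ev.
rewrite /residual -(mulN1r (b (p t) v)) -(sformZl sH fb _ Ep EvH).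
by rewrite -(sformZl sH fb _ Ew EvH).
Qed.

(** The map u |-> axial_force u is continuous from V to V', although it is not
    linear: it is a product of a continuous scalar function and a bounded linear
    map. *)
Lemma countable_axial : countably_valued T (X := dual V) (fun t => axial_force (y t)).
Proof.
have cy := strongly_countable sV (L2B_strong Ly).
apply: (countable_map (X := V) (Y := dual V) (F := fun u => axial_force u) (L2B_elts Ly)) => //.
  by move=> u Eu; exact: (quartic_grad_dual k beta nmV fA CA0 AC).
move=> u un Eu cu; have [Eun un0] := cu; have [sD n0 _ _] := nmV'.
have qd w : EV w -> elts (dual V) (axial_force w : rep (dual V)).
  by move=> Ew; exact: (quartic_grad_dual k beta nmV fA CA0 AC).
pose q w := beta + 2^-1 * A w w.
have cq : q (un n) @[n --> \oo] --> q u.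
  by apply: cvgD; [exact: cvg_cst|apply: cvgMr; exact: (pairing_cvg nmV nmV pA Eu Eu cu cu)].
have lim : `|2 * k| * (`|q (un n)| * (CA * nV (un n - u)) + `|q (un n) - q u| * (CA * nV u))
    @[n --> \oo] --> (0 : R).
  have -> : (0 : R) = `|2 * k| * (`|q u| * (CA * 0) + `|q u - q u| * (CA * nV u)).
    by rewrite subrr normr0 mul0r !mulr0 addr0 mulr0.
  apply: cvgMr; apply: cvgD.
    by apply: cvgM; [exact: cvg_norm|exact: cvgMr].
  by apply: cvgMl; apply: cvg_norm; apply: cvgB => //; exact: cvg_cst.
apply: (squeeze_cvgr _ (cvg_cst 0) lim); apply: nearW => n.
have Ed := subspaceB sV (Eun n) Eu.
have ed := subspaceB sD (qd _ (Eun n)) (qd _ Eu); rewrite [0 <= _](n0 _ ed)/=.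
apply: (dual_nrm_le nmV) => v Ev v1'.
have [_ hA _ _] := pA; have dA := pairing_dual_l pA Ev.
have e : (axial_force (un n) - axial_force u : rep (dual V)) v =
    2 * k * (q (un n) * A (un n - u) v + (q (un n) - q u) * A u v).
  rewrite (dualB nmV dA (Eun n) Eu).
  have -> : (axial_force (un n) - axial_force u : rep (dual V)) v =
     2 * k * q (un n) * A (un n) v - 2 * k * q u * A u v by [].
  by move: (q _) (q _) (A _ _) (A _ _) => *; ring.
rewrite e normrM ler_wpM2l//; apply: le_trans (ler_normD _ _) _; rewrite !normrM.
apply: lerD; apply: ler_wpM2l => //.
  apply: le_trans (hA _ _ Ed Ev) _; rewrite ler_piMr// mulr_ge0//; exact: nV0.
apply: le_trans (hA _ _ Eu Ev) _; rewrite ler_piMr// mulr_ge0//; exact: nV0.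
Qed.

Let La0 : {ae mu, forall t, DT t -> elts (dual V) (acc t)} := L2B_elts La.

Lemma residual_dual : {ae mu, forall t, DT t -> elts (dual V) (residual t)} /\
  countably_valued T residual.
Proof.
have sD := prenormed_subspace nmV'.
have eH (c : R) f : L2B T (X := H) f -> {ae mu, forall t, DT t -> elts H (c *: f t)}.
  by move=> Lf; apply: ae_imp (L2B_elts Lf) => t ft Dt; apply: (subspaceZ sH); exact: ft.
have cH (c : R) f : L2B T (X := H) f -> countably_valued T (X := H) (fun t => c *: f t).
  move=> Lf; apply: (countable_map (X := H) (Y := H) (F := fun u => c *: u) (L2B_elts Lf)).
  - by move=> u; exact: (subspaceZ sH).
  - move=> u un Eu [Eun un0].
    have lim : `|c| * nH (un n - u) @[n --> \oo] --> (0 : R).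
      by rewrite -[X in _ --> X](mulr0 `|c|); exact: cvgMr.
    apply: cvg_trans lim; apply: near_eq_cvg; apply: nearW => n.
    rewrite -scalerBr; have [_ _ _ nZ] := nmH; rewrite [RHS]nZ//.
    exact: (subspaceB sH (Eun n) Eu).
  - exact: strongly_countable sH (L2B_strong Lf).
have h1 : {ae mu, forall t, DT t -> elts (dual V) (B (y t) : rep (dual V))}.
  by apply: ae_imp (L2B_elts Ly) => t yt Dt; apply: (pairing_dual pB); exact: yt.
have h2 : {ae mu, forall t, DT t -> elts (dual V) (axial_force (y t) : rep (dual V))}.
  by apply: ae_imp (L2B_elts Ly) => t yt Dt; apply: (quartic_grad_dual k beta nmV fA CA0 AC); exact: yt.
have h3 (c : R) f : L2B T (X := H) f -> 
    {ae mu, forall t, DT t -> elts (dual V) ((fun v => b (c *: f t) v) : rep (dual V))}.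
  by move=> Lf; apply: ae_imp (eH c f Lf) => t ft Dt; apply: (pairing_dual pHV); exact: ft.
have c0 := strongly_countable sD (L2B_strong La).
have c1 := pairing_countable nmV nmV pB (L2B_elts Ly) (strongly_countable sV (L2B_strong Ly)).
have c2 := countable_axial.
have c3 (c : R) f (Lf : L2B T (X := H) f) := pairing_countable nmH nmV pHV (eH c f Lf) (cH c f Lf).
have add f g : {ae mu, forall t, DT t -> elts (dual V) (f t : rep (dual V))} ->
   {ae mu, forall t, DT t -> elts (dual V) (g t : rep (dual V))} ->
   {ae mu, forall t, DT t -> elts (dual V) (f t + g t : rep (dual V))}.
  by move=> ef eg; apply: ae_imp2 ef eg => t ft gt Dt; apply: (subspaceD sD); [exact: ft|exact: gt].
have a1 := add _ _ La0 h1; have a2 := add _ _ a1 h2.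
have a3 := add _ _ a2 (h3 (-1) p Lp); have a4 := add _ _ a3 (h3 cd v1 Lv).
split; first exact: a4.
apply: (countable_add nmV' a3 (h3 cd v1 Lv)); last exact: c3.
apply: (countable_add nmV' a2 (h3 (-1) p Lp)); last exact: c3.
apply: (countable_add nmV' a1 h2) => //.
exact: (countable_add nmV' La0 h1).
Qed.

(** The integrals over the two outer intervals vanish. *)
Lemma Rint_support (f : R -> R) : aeint DT f -> (forall t, ~ E t -> f t = 0) ->
  \int[mu]_(t in DT) f t = \int[mu]_(t in E) f t.
Proof.
move=> iF f0; have t2p : 0 <= t2 by apply: le_trans t10 _; exact: ltW.
have out a' b' : (forall t, a' < t < b' -> ~ (t1 < t < t2)) -> \int[mu]_(t in `]a', b'[) f t = 0.
  move=> h; rewrite -[RHS](@Rintegral_zero R `]a', b'[); apply: eq_Rintegral => t.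
  rewrite inE/= in_itv/= => /h nE; apply: f0.
  by rewrite /E/= in_itv/=.
rewrite (Rint_itv_split t2p t2T iF).
rewrite (Rint_itv_split t10 (ltW t12) (aeint_itv (lexx 0) t2T iF)).
have -> : \int[mu]_(t in `]0, t1[) f t = 0.
  by apply: out => t /andP[_ h] /andP[h' _]; move: (lt_trans h h'); rewrite ltxx.
have -> : \int[mu]_(t in `]t2, T[) f t = 0.
  by apply: out => t /andP[h _] /andP[_ h']; move: (lt_trans h h'); rewrite ltxx.
by rewrite add0r addr0.
Qed.

Lemma test_outside (zeta : R -> R) : test_function t1 t2 zeta -> forall t, ~ E t ->
  zeta t = 0 /\ derive1 zeta t = 0.
Proof.
move=> [sz [c [d [tc dt z0]]]] t nE.
have out s : s < c \/ d < s -> zeta s = 0.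
  by move=> h; apply: z0 => /andP[h1 h2]; case: h => h; [move: (lt_le_trans h h1)|move: (le_lt_trans h2 h)]; rewrite ltxx.
have h : t < c \/ d < t.
  have [h|h] := ltP t c; [by left|right].
  have [//|h'] := ltP d t; exfalso; apply: nE; rewrite /E/= in_itv/=.
  by rewrite (lt_le_trans tc h) (le_lt_trans h' dt).
split; first exact: out.
have e : \forall s \near t, zeta s = (fun=> 0) s.
  case: h => h.
    by have := lt_nbhsl h; apply: filterS => s hs; apply: out; left.
  by have := lt_nbhsr h; apply: filterS => s hs; apply: out; right.
by rewrite !derive1E (near_eq_derive _ e) ?derive_cst//; exact: oner_neq0.
Qed.

(** The term with the derivative of zeta is moved to the acceleration by the
    definition of the distributional derivative, for which zeta is also a test
    function on ]0, T[.  The integral of zeta times the residual at v then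
    vanishes for every test function zeta. *)
Lemma balance_of_stationarity :
  (forall zeta v, test_function t1 t2 zeta -> EV v ->
     \int[mu]_(t in E) variation1 zeta v t =
     cd * \int[mu]_(t in `[t1, t2]) (b (v1 t) v * zeta t)) ->
  {ae mu, forall t, E t -> forall v, EV v ->
     acc t v + B (y t) v + axial_force (y t) v + cd * b (v1 t) v = b (p t) v}.
Proof.
move=> stat; have [rD rc] := residual_dual.
have rz v : EV v -> {ae mu, forall t, E t -> residual t v = 0}.
  move=> Ev; pose g t := acc t v + (B (y t) v + axial_force (y t) v - b (p t) v) + cd * b (v1 t) v.
  have i0 : aeint DT (fun t => B (y t) v + axial_force (y t) v - b (p t) v).
    by apply: aeintB => //; [apply: aeintD => //; [exact: aeV|exact: aeint_axial_force]|exact: aeP].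
  have ig : aeint E g.
    apply: (@aeint_sub _ DT) => //; apply: aeintD => //; last by apply: aeintZ => //; exact: aeW.
    by apply: aeintD => //; exact: aeA.
  suff gz : aeeq E g (fun=> 0).
    apply: ae_imp3 gz (L2B_elts Lp) (L2B_elts Lv) => t gt pt vt Et.
    apply: etrans (gt Et); rewrite (residualE Ev (pt (ED Et)) (vt (ED Et))) /g.
    by move: (acc t v) (B _ _) (b _ _) (b _ _) (axial_force _ _) => *; ring.
  apply: fundamental_lemma ig _ => phi tphi.
  have sphi := tphi.1; have sphi' := smooth_derive1 sphi.
  have tT : test_function 0 T phi.
    split => //; have [_ [c [d [tc dt z0]]]] := tphi; exists c, d; split => //.
      exact: le_lt_trans t10 tc.
    exact: lt_le_trans dt t2T.
  (* the second time derivative, tested with phi as a test function on ]0, T[ *)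
have h1 := dv tT Ev.
  have iac := aeint_mul_smooth (aeA Ev) sphi; have iw' := aeint_mul_smooth (aeW Ev) sphi'.
  have iw := aeint_mul_smooth (aeW Ev) sphi; have i0' := aeint_mul_smooth i0 sphi.
  have sub f : aeint DT f -> aeint E f by exact: aeint_sub.
  have k1 : \int[mu]_(t in E) (b (v1 t) v * derive1 phi t) =
      - \int[mu]_(t in E) (acc t v * phi t).
    rewrite -(Rint_support iw'); last by move=> t /(test_outside tphi)[_ ->]; rewrite mulr0.
    rewrite -(Rint_support iac); last by move=> t /(test_outside tphi)[-> _]; rewrite mulr0.
    under eq_Rintegral do rewrite mulrC.
    by rewrite h1; congr (- _); apply: eq_Rintegral => t _; rewrite mulrC.
  have := stat phi v tphi Ev; rewrite Rint_closed_itv.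
  rewrite (RintB mE (sub _ iw') (sub _ i0')) k1 => k2.
  rewrite (_ : (fun t => g t * phi t) = (fun t => acc t v * phi t +
      ((B (y t) v + axial_force (y t) v - b (p t) v) * phi t + cd * (b (v1 t) v * phi t)))).
    have icd := aeintZ cd mE (sub _ iw).
    rewrite (RintD mE (sub _ iac) (aeintD mE (sub _ i0') icd)) (RintD mE (sub _ i0') icd).
    by rewrite (RintZ _ mE (sub _ iw)) -k2; move: (Rintegral _ _ _) (Rintegral _ _ _) => *; ring.
  by apply/funext => t; rewrite /g; move: (acc t v) (B _ _) (b _ _) (b _ _) (axial_force _ _) => *; ring.
have := dual_ae_zero nmV rD rc ED rz => rzero.
apply: ae_imp3 rzero (L2B_elts Lp) (L2B_elts Lv) => t rt pt vt Et v Ev.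
have := rt Et v Ev; rewrite (residualE Ev (pt (ED Et)) (vt (ED Et))).
by move: (acc t v) (B _ _) (b _ _) (b _ _) (axial_force _ _) => a1 a2 a3 a4 a5; lra.
Qed.

End HamiltonPrinciple.

(** * Sobolev functions on an interval *)

Section SobolevInterval.
Context {R : realType}.
Notation mu := (@lebesgue_measure R).
Implicit Types (a b c r : R) (u v g h : R -> R).

Lemma integrable_aeint (D : set R) g : measurable D -> measurable_fun D g ->
  aeint D g -> mu.-integrable D (EFin \o g).
Proof.
move=> mD mg [h [mh /integrableP[_ ih] gh]]; apply/integrableP; split.
  exact/measurable_EFinP.
rewrite (@integral_ae_ext _ _ _ mu D _ (fun t => `|(h t)%:E|%E))//.
by apply: ae_imp gh => t gt Dt; rewrite /= gt.
Qed.

Lemma sqint_L2 (D : set R) g : measurable D -> measurable_fun D g -> sqint D g ->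
  L2 D g.
Proof.
move=> mD mg [_ ig]; split => //; apply: integrable_aeint => //.
exact: measurable_funX.
Qed.

Lemma L2_lin (D : set R) r u v : measurable D -> L2 D u -> L2 D v ->
  L2 D (r *: u + v).
Proof.
move=> mD Lu Lv; apply: sqint_L2 => //.
  apply: measurable_funD; last by case: Lv.
  by apply: measurable_funM; [exact: measurable_cst|case: Lu].
by apply: sqintD => //; [apply: sqintZ => //|]; exact: L2_sqint.
Qed.

Lemma L2_aeint a b u : L2 `]a, b[ u -> aeint `]a, b[ u.
Proof. by move=> Lu; apply: sqint_aeint; exact: L2_sqint. Qed.

Lemma wderP a b u : sobolev1 a b u ->
  L2 `]a, b[ (wder a b u) /\ weak_deriv a b u (wder a b u).
Proof.
move=> [_ h].
exact: (@xgetPex _ (fun=> 0) [set g | L2 `]a, b[ g /\ weak_deriv a b u g] h).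
Qed.

Lemma wder_eq a b u g : sobolev1 a b u -> L2 `]a, b[ g -> weak_deriv a b u g ->
  aeeq `]a, b[ (wder a b u) g.
Proof.
move=> /wderP[Lw ww] Lg wg; apply: weak_deriv_unique ww wg; exact: L2_aeint.
Qed.

Lemma weak_deriv_ext a b u v g : aeeq `]a, b[ u v -> weak_deriv a b u g ->
  weak_deriv a b v g.
Proof.
move=> uv wg phi tphi; rewrite -wg//; apply: Rint_ext.
by apply: ae_imp uv => t ut Dt; rewrite ut.
Qed.

(** The sets from which the two derivatives are chosen coincide, so the chosen
    elements are equal and not only equal almost everywhere.  This is what makes
    the second derivative of a class well defined. *)
Lemma wder_ext a b u v : aeeq `]a, b[ u v -> wder a b u = wder a b v.
Proof.
move=> uv; rewrite /wder; congr xget; apply/seteqP; split => g /= [Lg wg];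
  split => //; apply: weak_deriv_ext wg => //; exact: aeeq_sym.
Qed.

Lemma weak_deriv_lin a b r u v g h : aeint `]a, b[ u -> aeint `]a, b[ v ->
  aeint `]a, b[ g -> aeint `]a, b[ h ->
  weak_deriv a b u g -> weak_deriv a b v h ->
  weak_deriv a b (r *: u + v) (r *: g + h).
Proof.
move=> iu iv ig ih wg wh phi tphi; have sphi := test_smooth tphi.
have sphi' := smooth_derive1 sphi.
have E w1 w2 (p : R -> R) : smooth p -> aeint `]a, b[ w1 -> aeint `]a, b[ w2 ->
   \int[mu]_(t in `]a, b[) ((r *: w1 + w2) t * p t) =
   r * \int[mu]_(t in `]a, b[) (w1 t * p t) + \int[mu]_(t in `]a, b[) (w2 t * p t).
  move=> sp i1 i2; rewrite -RintZ// -?RintD//.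
  - by apply: eq_Rintegral => t _; rewrite !fctE /GRing.scale/=; ring.
  - by apply: aeintZ => //; exact: aeint_mul_smooth.
  - exact: aeint_mul_smooth.
  - exact: aeint_mul_smooth.
by rewrite !E// wg// wh//; ring.
Qed.

Lemma sobolev1_lin a b r u v : sobolev1 a b u -> sobolev1 a b v ->
  sobolev1 a b (r *: u + v) /\
  aeeq `]a, b[ (wder a b (r *: u + v)) (r *: wder a b u + wder a b v).
Proof.
move=> Su Sv; have [Lu' wu] := wderP Su; have [Lv' wv] := wderP Sv.
have Lw := L2_lin r (measurable_itv _) Lu' Lv'.
have ww := weak_deriv_lin r (L2_aeint Su.1) (L2_aeint Sv.1) (L2_aeint Lu') (L2_aeint Lv') wu wv.
have S : sobolev1 a b (r *: u + v).
  split; first by apply: L2_lin => //; [exact: Su.1|exact: Sv.1].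
  by exists (r *: wder a b u + wder a b v).
by split => //; exact: wder_eq.
Qed.

Lemma sobolev1_ext a b u v : L2 `]a, b[ v -> aeeq `]a, b[ u v -> sobolev1 a b u ->
  sobolev1 a b v.
Proof.
move=> Lv uv [_ [g [Lg wg]]]; split => //; exists g; split => //.
exact: weak_deriv_ext wg.
Qed.

Lemma sobolev1_prim a b u : a < b -> sobolev1 a b u ->
  exists c, aeeq `]a, b[ u (fun t => c + prim a (wder a b u) t).
Proof.
move=> ab Su; have [Lu' wu] := wderP Su.
by apply: weak_deriv_primitive => //; apply: L2_aeint => //; exact: Su.1.
Qed.

Lemma prim_sobolev1 a b c u g : a <= b -> L2 `]a, b[ u -> L2 `]a, b[ g ->
  aeeq `]a, b[ u (fun t => c + prim a g t) ->
  sobolev1 a b u /\ aeeq `]a, b[ (wder a b u) g.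
Proof.
move=> ab Lu Lg uE.
have wg := weak_deriv_prim ab (L2_aeint Lg) uE.
have S : sobolev1 a b u by split => //; exists g.
by split => //; exact: wder_eq.
Qed.

Lemma sobolev1_rlim a b c u : a < b -> sobolev1 a b u ->
  aeeq `]a, b[ u (fun t => c + prim a (wder a b u) t) -> rlim u a = c.
Proof.
move=> ab Su uE; apply: rlim_eq; apply: is_rlim_prim uE => //.
by apply: L2_aeint; have [] := wderP Su.
Qed.

Lemma sobolev1_llim a b c u : a < b -> sobolev1 a b u ->
  aeeq `]a, b[ u (fun t => c + prim a (wder a b u) t) ->
  llim u b = c + prim a (wder a b u) b.
Proof.
move=> ab Su uE; apply: llim_eq; apply: is_llim_prim uE => //.
by apply: L2_aeint; have [] := wderP Su.
Qed.

(** The two one-sided limits of the definition exist and are the boundary values of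
    the representative by a primitive. *)
Lemma sobolev1_trace a b u : a < b -> sobolev1 a b u ->
  aeeq `]a, b[ u (fun t => rlim u a + prim a (wder a b u) t) /\
  llim u b = rlim u a + prim a (wder a b u) b.
Proof.
move=> ab Su; have [c uE] := sobolev1_prim ab Su.
by rewrite (sobolev1_rlim ab Su uE); split => //; exact: sobolev1_llim.
Qed.

Lemma trace_ext a b u v : a < b -> sobolev1 a b u -> aeeq `]a, b[ v u ->
  rlim v a = rlim u a /\ llim v b = llim u b.
Proof.
move=> ab Su vu; have [uE uL] := sobolev1_trace ab Su.
have vE := aeeq_trans vu uE.
have iw : aeint `]a, b[ (wder a b u) by apply: L2_aeint; have [] := wderP Su.
split; first by apply: rlim_eq; exact: is_rlim_prim vE.
by rewrite uL; apply: llim_eq; exact: is_llim_prim vE.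
Qed.

Lemma prim_lin a b t r g h : t <= b -> aeint `]a, b[ g -> aeint `]a, b[ h ->
  prim a (r *: g + h) t = r * prim a g t + prim a h t.
Proof.
move=> tb ig ih; have ig' := aeint_itv (lexx a) tb ig.
have ih' := aeint_itv (lexx a) tb ih.
by rewrite /prim -RintZ// -RintD//; exact: aeintZ.
Qed.

Lemma trace_lin a b r u v : a < b -> sobolev1 a b u -> sobolev1 a b v ->
  rlim (r *: u + v) a = r * rlim u a + rlim v a /\
  llim (r *: u + v) b = r * llim u b + llim v b.
Proof.
move=> ab Su Sv; have [uE uL] := sobolev1_trace ab Su.
have [vE vL] := sobolev1_trace ab Sv.
have iu : aeint `]a, b[ (wder a b u) by apply: L2_aeint; have [] := wderP Su.
have iv : aeint `]a, b[ (wder a b v) by apply: L2_aeint; have [] := wderP Sv.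
have E : aeeq `]a, b[ (r *: u + v) (fun t => (r * rlim u a + rlim v a) +
   prim a (r *: wder a b u + wder a b v) t).
  apply: ae_imp2 uE vE => t ut vt Dt.
  have tb : t <= b by move: Dt; rewrite /= in_itv/= => /andP[_ /ltW].
  rewrite (prim_lin r tb iu iv) -[LHS]/(r * u t + v t) (ut Dt) (vt Dt).
  by rewrite mulrDr addrACA.
have iw : aeint `]a, b[ (r *: wder a b u + wder a b v).
  by apply: aeintD => //; exact: aeintZ.
split; first by apply: rlim_eq; exact: is_rlim_prim E.
rewrite uL vL (llim_eq (is_llim_prim ab iw E)) (prim_lin r (lexx b) iu iv).
by rewrite mulrDr addrACA.
Qed.

Lemma sobolev2_lin a b r u v : sobolev2 a b u -> sobolev2 a b v ->
  sobolev2 a b (r *: u + v) /\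
  aeeq `]a, b[ (wder a b (wder a b (r *: u + v)))
    (r *: wder a b (wder a b u) + wder a b (wder a b v)).
Proof.
move=> [Su Su'] [Sv Sv']; have [S E] := sobolev1_lin r Su Sv.
have [S' E'] := sobolev1_lin r Su' Sv'.
split; last by rewrite (wder_ext E).
split; first exact: S.
apply: (sobolev1_ext _ (aeeq_sym E) S').
by have [] := wderP S.
Qed.

End SobolevInterval.

(** * Functions on the cracked interval *)

Section Pieces.
Context {R : realType} (m : nat) (x : nat -> R).
Notation mu := (@lebesgue_measure R).
Hypotheses (x0 : x 0%N = 0) (xm : x m.+1 = pi)
  (incr : forall i, (i <= m)%N -> x i < x i.+1).
Implicit Types (u v g h : R -> R).

Let I i : set R := `]x i, x i.+1[.
Let D : set R := `]0, pi[.

Lemma knots_le i j : (i <= j)%N -> (j <= m.+1)%N -> x i <= x j.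
Proof.
move=> ij jm; elim: j ij jm => [|j IH]; first by rewrite leqn0 => /eqP ->.
rewrite leq_eqVlt => /predU1P[->//|]; rewrite ltnS => ij jm.
by apply: le_trans (IH ij (ltnW jm)) _; apply: ltW; apply: incr.
Qed.

Lemma knots_ge0 i : (i <= m.+1)%N -> 0 <= x i.
Proof. by move=> im; rewrite -x0; exact: knots_le. Qed.

Lemma knots_lepi i : (i <= m.+1)%N -> x i <= pi.
Proof. by move=> im; rewrite -xm; exact: knots_le. Qed.

Lemma pi_pos : 0 < pi :> R.
Proof. by rewrite -xm -x0; apply: lt_le_trans (incr (leq0n m)) _; exact: knots_le. Qed.

Lemma piece_sub i : (i < m.+1)%N -> I i `<=` D.
Proof.
by move=> im; apply: sub_itvoo; [exact: knots_ge0 (ltnW im)|exact: knots_lepi].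
Qed.

Lemma piece_disjoint i j t : (i < m.+1)%N -> (j < m.+1)%N -> I i t -> I j t -> i = j.
Proof.
rewrite /I /= !in_itv/= => im jm /andP[it ti] /andP[jt tj].
have [ij|ji|//] := ltngtP i j.
  have := knots_le ij (ltnW jm); move=> h.
  by have := lt_trans ti (le_lt_trans h jt); rewrite ltxx.
have := knots_le ji (ltnW im); move=> h.
by have := lt_trans tj (le_lt_trans h it); rewrite ltxx.
Qed.

Lemma ae_not_knot n : {ae mu, forall t, forall i, (i <= n)%N -> t <> x i}.
Proof.
elim: n => [|n IH].
  by apply: ae_imp (ae_neq (x 0%N)) => t tx i; rewrite leqn0 => /eqP ->.
apply: ae_imp2 IH (ae_neq (x n.+1)) => t h tx i.
by rewrite leq_eqVlt => /predU1P[->//|]; rewrite ltnS; exact: h.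
Qed.

Lemma knot_or_piece t : D t -> (exists2 i, (i <= m)%N & t = x i) \/
  exists2 i, (i < m.+1)%N & I i t.
Proof.
rewrite /D /= in_itv/= => /andP[t0 tpi].
suff H n : (n <= m.+1)%N -> t < x n -> (exists2 i, (i <= m)%N & t = x i) \/
  exists2 i, (i < m.+1)%N & I i t by apply: (H m.+1) => //; rewrite xm.
elim: n => [|n IH] nm tn; first by move: tn; rewrite x0 ltNge ltW.
have [tn'|tn'|tn'] := ltgtP t (x n); first by apply: IH => //; exact: ltnW.
  by right; exists n => //; rewrite /I /= in_itv/= tn'.
by left; exists n.
Qed.

Lemma ae_pieces (P : R -> Prop) :
  (forall i, (i < m.+1)%N -> {ae mu, forall t, I i t -> P t}) ->
  {ae mu, forall t, D t -> P t}.
Proof.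
move=> HP.
suff H n : (n <= m.+1)%N ->
    {ae mu, forall t, forall i, (i < n)%N -> I i t -> P t}.
  apply: ae_imp2 (H m.+1 (leqnn _)) (ae_not_knot m) => t h1 h2 Dt.
  by have [[i im tx]|[i im It]] := knot_or_piece Dt; [case: (h2 i im)|exact: h1 It].
elim: n => [|n IH] nm; first by apply: aeW.
apply: ae_imp2 (IH (ltnW nm)) (HP n nm) => t h1 h2 i.
by rewrite ltnS leq_eqVlt => /predU1P[->//|]; exact: h1.
Qed.

Lemma aeeq_pieces u v : (forall i, (i < m.+1)%N -> aeeq (I i) u v) -> aeeq D u v.
Proof. exact: ae_pieces. Qed.

Lemma aeint_cat (a b c : R) g : a <= b -> b <= c -> aeint `]a, b[ g -> aeint `]b, c[ g ->
  aeint `]a, c[ g.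
Proof.
move=> ab bc /aeint_global[//|k [mk ik gk k0]] /aeint_global[//|l [ml il gl l0]].
exists (fun t => k t + l t); split; first exact: measurable_funD.
  have i2 := @integrableD _ _ _ mu setT measurableT _ _ ik il.
  exact: (@integrableS _ _ _ mu _ _ _ measurableT (measurable_itv _) (@subsetT _ _) i2).
apply: ae_imp3 gk gl (ae_neq b) => t kt lt tb /=; rewrite in_itv/= => /andP[at_ tc].
have [tb'|tb'|//] := ltgtP t b.
  rewrite l0 ?addr0; last by rewrite /= in_itv/= => /andP[/lt_trans h] _; have := h _ tb'; rewrite ltxx.
  by rewrite kt//= in_itv/= at_.
rewrite k0 ?add0r; last by rewrite /= in_itv/= => /andP[_ /lt_trans h]; have := h _ tb'; rewrite ltxx.
by rewrite lt//= in_itv/= tb'.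
Qed.

Lemma aeint_pieces_sum n g : (n <= m.+1)%N ->
  (forall i, (i < n)%N -> aeint (I i) g) ->
  aeint `]0, x n[ g /\
  \int[mu]_(t in `]0, x n[) g t = \sum_(i < n) \int[mu]_(t in I i) g t.
Proof.
elim: n => [|n IH] nm ig.
  rewrite big_ord0 x0 (_ : `]0, 0[%classic = set0); last first.
    by apply/seteqP; split => // t /=; rewrite in_itv/= => /andP[/lt_trans h /h]; rewrite ltxx.
  rewrite Rintegral_set0; split => //.
  exists (fun=> 0); split; [exact: measurable_cst|exact: integrable_set0|].
  by apply: eq_aeeq => t [].
have [i1 e1] := IH (ltnW nm) (fun i im => ig i (ltnW im)).
have xn := knots_ge0 (ltnW nm); have xn1 := ltW (incr nm).
have i2 := aeint_cat xn xn1 i1 (ig n (leqnn _)).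
by split => //; rewrite big_ord_recr/= (Rint_itv_split xn xn1 i2) e1.
Qed.

Lemma aeint_pieces g : (forall i, (i < m.+1)%N -> aeint (I i) g) -> aeint D g.
Proof. by move=> /(aeint_pieces_sum (leqnn m.+1))[]; rewrite xm. Qed.

Lemma Rint_pieces g : (forall i, (i < m.+1)%N -> aeint (I i) g) ->
  \int[mu]_(t in D) g t = \sum_(i < m.+1) \int[mu]_(t in I i) g t.
Proof. by move=> /(aeint_pieces_sum (leqnn m.+1))[]; rewrite xm. Qed.

Lemma aemeas_pieces g : (forall i, (i < m.+1)%N -> aemeas (I i) g) -> aemeas D g.
Proof.
move=> mg.
suff H n : (n <= m.+1)%N -> exists2 h, measurable_fun setT h &
    {ae mu, forall t, forall i, (i < n)%N -> I i t -> g t = h t}.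
  have [h mh gh] := H m.+1 (leqnn _); exists h => //; apply: aeeq_pieces => i im.
  by apply: ae_imp gh => t; exact.
elim: n => [|n IH] nm; first by exists (fun=> 0); [exact: measurable_cst|exact: aeW].
have [h mh gh] := IH (ltnW nm); have [k mk gk] := mg n nm.
exists (fun t => if t \in I n then k t else h t).
  apply: measurable_fun_ifT => //; apply: (@measurable_fun_bool _ _ _ _ true).
  rewrite setTI (_ : _ @^-1` _ = I n); first exact: measurable_itv.
  by apply/seteqP; split => t /=; [move/set_mem|move/mem_set].
apply: ae_imp2 gh gk => t h1 h2 i; rewrite ltnS leq_eqVlt => /predU1P[->|im] It.
  by rewrite mem_set// h2.
rewrite ifF; first exact: h1 It.
apply/negbTE/negP => /set_mem In.
have := piece_disjoint (ltn_trans im nm) nm It In => ?; subst i.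
by rewrite ltnn in im.
Qed.

Lemma sqint_pieces g : (forall i, (i < m.+1)%N -> sqint (I i) g) -> sqint D g.
Proof.
move=> sg; split; first by apply: aemeas_pieces => i /sg[].
by apply: aeint_pieces => i /sg[].
Qed.

Lemma measurable_pieces g : (forall i, (i < m.+1)%N -> measurable_fun (I i) g) ->
  measurable_fun D g.
Proof.
move=> mg; pose A n := [set t | exists2 i, (i < n)%N & I i t].
pose B n := [set t | exists2 i, (i < n)%N & t = x i].
have HA n : (n <= m.+1)%N -> measurable (A n) /\ measurable_fun (A n) g.
  elim: n => [|n IH] nm.
    rewrite (_ : A 0%N = set0); last by apply/seteqP; split => // t [].
    by split => //; exact: measurable_fun_set0.
  have -> : A n.+1 = A n `|` I n.
    apply/seteqP; split => t.
      by move=> [i]; rewrite ltnS leq_eqVlt => /predU1P[->|im]; [right|left; exists i].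
    by move=> [[i im It]|It]; [exists i => //; rewrite ltnS ltnW|exists n].
  have [m1 m2] := IH (ltnW nm).
  have mI : measurable (I n) by exact: measurable_itv.
  split; first exact: measurableU.
  by apply/measurable_funU => //; split => //; exact: mg.
have HB n : measurable (B n) /\ measurable_fun (B n) g.
  elim: n => [|n [m1 m2]].
    rewrite (_ : B 0%N = set0); last by apply/seteqP; split => // t [].
    by split => //; exact: measurable_fun_set0.
  have -> : B n.+1 = B n `|` [set x n].
    apply/seteqP; split => t.
      by move=> [i]; rewrite ltnS leq_eqVlt => /predU1P[->|im]; [right|left; exists i].
    by move=> [[i im It]|It]; [exists i => //; rewrite ltnS ltnW|exists n].
  split; first exact: measurableU.
  by apply/measurable_funU => //; split => //; exact: measurable_fun_set1.
have [mA fA] := HA m.+1 (leqnn _); have [mB fB] := HB m.+1.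
apply: (@measurable_funS _ _ _ _ (A m.+1 `|` B m.+1)); first exact: measurableU.
  move=> t /knot_or_piece[[i im ->]|[i im It]].
    by right; exists i.
  by left; exists i.
by apply/measurable_funU.
Qed.

(** The definition of L2 demands measurability of the function itself, not of its
    class, so the knots have to be added back as measurable sets. *)
Lemma L2_pieces g : (forall i, (i < m.+1)%N -> L2 (I i) g) -> L2 D g.
Proof.
move=> Lg; apply: sqint_L2; first exact: measurable_itv.
  by apply: measurable_pieces => i im; case: (Lg i im).
by apply: sqint_pieces => i im; exact: (L2_sqint (measurable_itv _) (Lg i im)).
Qed.

Lemma L2_piece g i : (i < m.+1)%N -> L2 D g -> L2 (I i) g.
Proof.
move=> im [mg ig]; split.
  exact: (measurable_funS (measurable_itv _) (@piece_sub i im) mg).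
exact: (@integrableS _ _ _ mu _ _ _ (measurable_itv _) (measurable_itv _) (@piece_sub i im) ig).
Qed.

Lemma sqint_piece g i : (i < m.+1)%N -> sqint D g -> sqint (I i) g.
Proof. by move=> im; exact: (sqint_sub (measurable_itv _) (measurable_itv _) (@piece_sub i im)). Qed.

Lemma ipHE u v : sqint D u -> sqint D v -> ipH m x u v = \int[mu]_(t in D) (u t * v t).
Proof.
move=> su sv; rewrite (@Rint_pieces (fun t => u t * v t))// => i im.
by apply: sqintM; [exact: measurable_itv|exact: sqint_piece|exact: sqint_piece].
Qed.

Lemma ipH_ext u v u' v' : aeeq D u u' -> aeeq D v v' -> ipH m x u v = ipH m x u' v'.
Proof.
move=> uu vv; apply: eq_bigr => i _; apply: Rint_ext.
apply: ae_imp2 uu vv => t ut vt It.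
have Dt : D t by exact: (@piece_sub i (ltn_ord i)).
by rewrite ut// vt.
Qed.

Lemma elts_spH u : elts (spH m x) u <-> L2 D u.
Proof.
split => [|Lu i im]; [exact: L2_pieces|exact: L2_piece].
Qed.

Lemma spH_sqint u : elts (spH m x) u -> sqint D u.
Proof. by move=> /elts_spH Lu; exact: (L2_sqint (measurable_itv _) Lu). Qed.

Lemma subspace_spH : subspace_elts (spH m x).
Proof.
split.
  apply/elts_spH; split; first exact: measurable_cst.
  have -> : (fun t : R => (((0 : R -> R) t) ^+ 2)%:E) = cst 0%E.
    by apply/funext => t; rewrite /= expr0n.
  exact: integrable0.
by move=> a u v /elts_spH Lu /elts_spH Lv; apply/elts_spH; exact: (L2_lin a (measurable_itv _) Lu Lv).
Qed.

Lemma ipH_lin (a : R) u v w : sqint D u -> sqint D v -> sqint D w ->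
  ipH m x (a *: u + v) w = a * ipH m x u w + ipH m x v w.
Proof.
move=> su sv sw.
have mD : measurable D by exact: measurable_itv.
rewrite !ipHE//; last by apply: sqintD => //; exact: sqintZ.
rewrite -RintZ//; last exact: sqintM.
rewrite -RintD//; [|by apply: aeintZ => //; exact: sqintM|exact: sqintM].
by apply: eq_Rintegral => t _; rewrite !fctE /GRing.scale/=; ring.
Qed.

Lemma ipHC u v : ipH m x u v = ipH m x v u.
Proof. by apply: eq_bigr => i _; apply: eq_Rintegral => t _; rewrite mulrC. Qed.

Lemma ipH_ge0 u : 0 <= ipH m x u u.
Proof.
apply: sumr_ge0 => i _; apply: Rint_ge0; apply: aeW => t _.
by rewrite -expr2 sqr_ge0.
Qed.

Lemma sform_ipH : sform (X := spH m x) (ipH m x).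
Proof.
split; [|by move=> u v _ _; exact: ipHC|by move=> u _; exact: ipH_ge0].
by move=> a u v w Hu Hv Hw; apply: ipH_lin; exact: spH_sqint.
Qed.

Lemma prenormed_spH : prenormed (spH m x).
Proof. exact: prenormed_form subspace_spH sform_ipH _. Qed.

End Pieces.

Local Opaque rlim llim wder Rintegral.

(** * The space V and its bilinear forms *)

Section CrackedV.
Context {R : realType} (m : nat) (x : nat -> R).
Notation mu := (@lebesgue_measure R).
Hypotheses (x0 : x 0%N = 0) (xm : x m.+1 = pi)
  (incr : forall i, (i <= m)%N -> x i < x i.+1).
Implicit Types (u v g h : R -> R).

Let I i : set R := `]x i, x i.+1[.
Let D : set R := `]0, pi[.
Local Notation V := (spV m x).
Let mI i : measurable (I i). Proof. exact: measurable_itv. Qed.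
Let mD : measurable D. Proof. exact: measurable_itv. Qed.
Local Notation pd := (pder m x).

Lemma pder_piece u i t : (i < m.+1)%N -> I i t -> pd u t = wder (x i) (x i.+1) u t.
Proof.
move=> im It; rewrite /pder (bigD1 (Ordinal im))//= indicE mem_set// mul1r.
rewrite big1 ?addr0// => j ji; rewrite indicE memNset ?mul0r// => Ij.
move/negP: ji; apply; apply/eqP/val_inj => /=.
exact: (piece_disjoint incr (ltn_ord j) im Ij It).
Qed.

Local Opaque pder ipH.

Lemma pder_aeeq u i : (i < m.+1)%N -> aeeq (I i) (pd u) (wder (x i) (x i.+1) u).
Proof. by move=> im; apply: eq_aeeq => t; exact: pder_piece. Qed.

Lemma pder2_aeeq u i : (i < m.+1)%N ->
  aeeq (I i) (pd (pd u)) (wder (x i) (x i.+1) (wder (x i) (x i.+1) u)).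
Proof.
by move=> im; rewrite -(wder_ext (pder_aeeq u im)); exact: pder_aeeq.
Qed.

Lemma spV_sobolev2 u i : elts V u -> (i < m.+1)%N -> sobolev2 (x i) (x i.+1) u.
Proof. by move=> [h _ _ _]; exact: h. Qed.

Lemma spV_L2 u : elts V u -> L2 D u.
Proof.
move=> Vu; apply: (L2_pieces x0 xm incr) => i im.
by have [[]] := spV_sobolev2 Vu im.
Qed.

Lemma spV_sqint u : elts V u -> sqint D u.
Proof. by move=> Vu; exact: (L2_sqint mD (spV_L2 Vu)). Qed.

Lemma spV_spH u : elts V u -> elts (spH m x) u.
Proof. by move=> Vu; apply/(elts_spH x0 xm incr); exact: spV_L2. Qed.

Lemma L2_ext_meas (E : set R) g h : measurable E -> (forall t, E t -> g t = h t) ->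
  L2 E h -> L2 E g.
Proof.
move=> mE gh [mh ih].
have gh' : {in E, g =1 h} by move=> t /set_mem; exact: gh.
split; first exact: (eq_measurable_fun h (fun t tE => esym (gh' t tE)) mh).
have : {in E, (fun t => (h t ^+ 2)%:E) =1 (fun t => (g t ^+ 2)%:E)} by move=> t /gh' ->.
by move=> e; exact: (@eq_integrable _ _ _ mu _ mE _ _ e ih).
Qed.

Lemma spV_L2_pder u : elts V u -> L2 D (pd u).
Proof.
move=> Vu; apply: (L2_pieces x0 xm incr) => i im.
apply: (L2_ext_meas (mI i)) (fun t => pder_piece u im) _.
by have [_ [Lw _]] := spV_sobolev2 Vu im.
Qed.

Lemma spV_sqint_pder u : elts V u -> sqint D (pd u).
Proof. by move=> Vu; exact: (L2_sqint mD (spV_L2_pder Vu)). Qed.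

Lemma spV_sqint_pder2 u : elts V u -> sqint D (pd (pd u)).
Proof.
move=> Vu; apply: (sqint_pieces x0 xm incr) => i im.
apply: sqint_ext (pder2_aeeq u im) _; apply: (L2_sqint (mI i)).
by have [_ /wderP[]] := spV_sobolev2 Vu im.
Qed.

Lemma spV_trace u i : elts V u -> (i < m.+1)%N ->
  aeeq (I i) u (fun t => rlim u (x i) + prim (x i) (pd u) t) /\
  llim u (x i.+1) = rlim u (x i) + prim (x i) (pd u) (x i.+1).
Proof.
move=> Vu im; have [Su _] := spV_sobolev2 Vu im.
have [uE uL] := sobolev1_trace (incr im) Su.
split.
  apply: ae_imp uE => t ut /[dup] It /ut ->; congr (_ + _).
  apply: prim_ext (aeeq_sym (pder_aeeq u im)).
  by move: It; rewrite /I /= in_itv/= => /andP[_ /ltW].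
by rewrite uL; congr (_ + _); exact: prim_ext (aeeq_sym (pder_aeeq u im)).
Qed.

Lemma sobolev1_pder u i : elts V u -> (i < m.+1)%N ->
  sobolev1 (x i) (x i.+1) (pd u).
Proof.
move=> Vu im; have [Su Su'] := spV_sobolev2 Vu im.
apply: (sobolev1_ext _ (aeeq_sym (pder_aeeq u im)) Su').
exact: (L2_piece x0 xm incr im (spV_L2_pder Vu)).
Qed.

Lemma spV_trace1 u i : elts V u -> (i < m.+1)%N ->
  aeeq (I i) (pd u) (fun t => rlim (pd u) (x i) + prim (x i) (pd (pd u)) t) /\
  llim (pd u) (x i.+1) = rlim (pd u) (x i) + prim (x i) (pd (pd u)) (x i.+1).
Proof.
move=> Vu im; have [uE uL] := sobolev1_trace (incr im) (sobolev1_pder Vu im).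
split.
  apply: ae_imp uE => t ut /[dup] It /ut ->; congr (_ + _).
  apply: prim_ext (aeeq_sym (pder_aeeq (pd u) im)).
  by move: It; rewrite /I /= in_itv/= => /andP[_ /ltW].
by rewrite uL; congr (_ + _); exact: prim_ext (aeeq_sym (pder_aeeq (pd u) im)).
Qed.

Lemma pder_lin (a : R) u v : elts V u -> elts V v ->
  aeeq D (pd (a *: u + v)) (a *: pd u + pd v).
Proof.
move=> Vu Vv; apply: (aeeq_pieces x0 xm) => i im.
have [_ E] := sobolev1_lin a (spV_sobolev2 Vu im).1 (spV_sobolev2 Vv im).1.
apply: ae_imp E => t Et It; rewrite (pder_piece _ im It) Et//.
by rewrite -[RHS]/(a * pder m x u t + pder m x v t) !(pder_piece _ im It).
Qed.

Lemma pder2_lin (a : R) u v : elts V u -> elts V v ->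
  aeeq D (pd (pd (a *: u + v))) (a *: pd (pd u) + pd (pd v)).
Proof.
move=> Vu Vv; apply: (aeeq_pieces x0 xm) => i im.
have [_ E] := sobolev2_lin a (spV_sobolev2 Vu im) (spV_sobolev2 Vv im).
apply: ae_imp3 E (pder2_aeeq (a *: u + v) im) (ae_imp2 (fun t a b => conj a b)
   (pder2_aeeq u im) (pder2_aeeq v im)) => t Et E1 [E2 E3] It.
rewrite (E1 It) (Et It).
by rewrite -[RHS]/(a * pder m x (pder m x u) t + pder m x (pder m x v) t) (E2 It) (E3 It).
Qed.

Lemma piece_aeeq u v i : (i < m.+1)%N -> aeeq D u v -> aeeq (I i) u v.
Proof. by move=> im; apply: aeeq_sub; exact: (piece_sub x0 xm incr im). Qed.

Lemma pder_trace_lin (a : R) u v i : elts V u -> elts V v -> (i < m.+1)%N ->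
  rlim (pd (a *: u + v)) (x i) = a * rlim (pd u) (x i) + rlim (pd v) (x i) /\
  llim (pd (a *: u + v)) (x i.+1) = a * llim (pd u) (x i.+1) + llim (pd v) (x i.+1).
Proof.
move=> Vu Vv im; have Su := sobolev1_pder Vu im; have Sv := sobolev1_pder Vv im.
have [S _] := sobolev1_lin a Su Sv.
have [-> ->] := trace_ext (incr im) S (piece_aeeq im (pder_lin a Vu Vv)).
exact: trace_lin (incr im) Su Sv.
Qed.

Lemma jump_pder_lin (a : R) u v i : elts V u -> elts V v -> (i < m)%N ->
  jump (pd (a *: u + v)) (x i.+1) =
  a * jump (pd u) (x i.+1) + jump (pd v) (x i.+1).
Proof.
move=> Vu Vv im; rewrite /jump.
have [-> _] := pder_trace_lin a Vu Vv (im : (i.+1 < m.+1)%N).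
have [_ ->] := pder_trace_lin a Vu Vv (ltnW im : (i < m.+1)%N).
by move: (rlim _ _) (rlim _ _) (llim _ _) (llim _ _) => r1 r2 l1 l2; ring.
Qed.

Lemma sobolev1_0 (a b : R) : sobolev1 a b (0 : R -> R) /\
  aeeq `]a, b[ (wder a b (0 : R -> R)) (0 : R -> R).
Proof.
have L0 : L2 `]a, b[ (0 : R -> R).
  split; first exact: measurable_cst.
  have -> : (fun t : R => (((0 : R -> R) t) ^+ 2)%:E) = cst 0%E.
    by apply/funext => t; rewrite /= expr0n.
  exact: integrable0.
have w0 : weak_deriv a b (0 : R -> R) (0 : R -> R).
  move=> phi _; under eq_Rintegral do rewrite mul0r.
  under [in RHS]eq_Rintegral do rewrite mul0r.
  by rewrite Rintegral_zero oppr0.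
have S : sobolev1 a b (0 : R -> R) by split; [exact: L0|exists 0; split].
by split; [exact: S|exact: wder_eq].
Qed.

Lemma subspace_spV : subspace_elts V.
Proof.
have is0 z : rlim (0 : R -> R) z = 0 /\ llim (0 : R -> R) z = 0.
  split; [apply: rlim_eq|apply: llim_eq] => e e0; exists 1; split => //;
    by apply: aeW => t _; rewrite subr0 normr0.
split.
  split; last by move=> i _; rewrite /jump (is0 _).1 (is0 _).2 subrr.
  - move=> i im; have [S E] := @sobolev1_0 (x i) (x i.+1).
    split; first exact: S.
    by apply: (sobolev1_ext _ (aeeq_sym E) S); have [] := wderP S.
  - exact: (is0 _).1.
  - exact: (is0 _).2.
move=> a u v Vu Vv; have [Su u0 upi uj] := Vu; have [Sv v0 vpi vj] := Vv.
have S1 i : (i < m.+1)%N -> sobolev1 (x i) (x i.+1) u by move=> /Su[].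
have S2 i : (i < m.+1)%N -> sobolev1 (x i) (x i.+1) v by move=> /Sv[].
split.
- by move=> i im; have [] := sobolev2_lin a (Su i im) (Sv i im).
- have [+ _] := trace_lin a (incr (leq0n m)) (S1 0%N isT) (S2 0%N isT).
  by rewrite x0 u0 v0 mulr0 addr0.
- have [_] := trace_lin a (incr (leqnn m)) (S1 m (leqnn _)) (S2 m (leqnn _)).
  by rewrite xm upi vpi mulr0 addr0.
- move=> i im; rewrite /jump.
  have [-> _] := trace_lin a (incr im) (S1 i.+1 im) (S2 i.+1 im).
  have [_ ->] := trace_lin a (incr (ltnW im)) (S1 i (ltnW im)) (S2 i (ltnW im)).
  have := uj i im; have := vj i im; rewrite /jump => /eqP; rewrite subr_eq0 => /eqP ->.
  by move=> /eqP; rewrite subr_eq0 => /eqP ->; rewrite subrr.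
Qed.

(** The inner product of V is the case w = 1, and the form of the bending energy the
    case w i = 1 / theta (i + 1). *)
Definition bending (w : nat -> R) u v : R := ipH m x (pder m x (pder m x u)) (pder m x (pder m x v)) +
  \sum_(i < m) w i * (jump (pder m x u) (x i.+1) * jump (pder m x v) (x i.+1)).

Lemma ipH_pder2_lin (a : R) u v z : elts V u -> elts V v -> elts V z ->
  ipH m x (pd (pd (a *: u + v))) (pd (pd z)) =
  a * ipH m x (pd (pd u)) (pd (pd z)) + ipH m x (pd (pd v)) (pd (pd z)).
Proof.
move=> Vu Vv Vz.
apply: etrans (ipH_ext x0 xm incr (pder2_lin a Vu Vv) (@aeeq_refl _ D (pd (pd z)))) _.
exact: (ipH_lin x0 xm incr a (spV_sqint_pder2 Vu) (spV_sqint_pder2 Vv) (spV_sqint_pder2 Vz)).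
Qed.

Lemma sform_curvature : sform (X := V)
  (fun u v => ipH m x (pder m x (pder m x u)) (pder m x (pder m x v))).
Proof.
split; first by move=> a u v z; exact: ipH_pder2_lin.
- by move=> u v _ _; exact: ipHC.
- by move=> u _; exact: ipH_ge0.
Qed.

Lemma sform_bending w : (forall i, (i < m)%N -> 0 <= w i) ->
  sform (X := V) (bending w).
Proof.
move=> w0; apply: sformD sform_curvature _.
apply: (sform_squares (X := V) (L := fun i u => jump (pder m x u) (x i.+1)) w0).
by move=> i a u v im Vu Vv; exact: jump_pder_lin.
Qed.

Lemma ipVE : ipV m x = bending (fun=> 1).
Proof.
apply/funext => u; apply/funext => v; rewrite /ipV /bending; congr (_ + _).
by apply: eq_bigr => i _; rewrite mul1r.
Qed.

Lemma sform_ipV : sform (X := V) (ipV m x).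
Proof. by rewrite ipVE; apply: sform_bending => i _; exact: ler01. Qed.

Lemma prenormed_spV : prenormed V.
Proof. exact: (prenormed_form subspace_spV sform_ipV). Qed.

Lemma spV_nrm2 u : elts V u -> nrm (u : rep V) ^+ 2 = ipV m x u u.
Proof. by move=> Vu; rewrite /= sqr_sqrtr//; have [_ _] := sform_ipV; exact. Qed.

Lemma bending_bounded w : (forall i, (i < m)%N -> 0 <= w i) ->
  exists2 C, 0 <= C & forall u, elts V u -> bending w u u <= C * nrm (u : rep V) ^+ 2.
Proof.
move=> w0; exists (1 + \sum_(i < m) w i).
  by rewrite addr_ge0// sumr_ge0// => i _; exact: w0.
move=> u Vu; rewrite spV_nrm2// /bending /ipV mulrDl mul1r -addrA lerD2l.
have H0 := ipH_ge0 m x (pd (pd u)).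
set J := \sum_(i < m) (jump _ _ * _).
have J0 : 0 <= J by apply: sumr_ge0 => i _; rewrite -expr2 sqr_ge0.
have S0 : 0 <= \sum_(i < m) w i by apply: sumr_ge0 => i _; exact: w0.
apply: (@le_trans _ _ ((\sum_(i < m) w i) * J)); last first.
  by rewrite mulrDr -[X in X <= _]add0r addrA lerD2r addr_ge0// mulr_ge0.
rewrite mulr_suml; apply: ler_sum => i _; rewrite ler_wpM2l ?w0//.
rewrite /J (bigD1 i)//= lerDl; apply: sumr_ge0 => j _; by rewrite -expr2 sqr_ge0.
Qed.

End CrackedV.

(** * Embeddings of V and the interpolation inequality *)

Section IntervalInequalities.
Context {R : realType}.
Notation mu := (@lebesgue_measure R).
Implicit Types (f g h u F : R -> R).

Lemma Cauchy_Schwarz_norm (D E : set R) f g : measurable D -> measurable E -> E `<=` D ->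
  sqint D f -> sqint D g ->
  \int[mu]_(t in E) `|f t * g t| <=
  Num.sqrt (\int[mu]_(t in D) (f t ^+ 2)) * Num.sqrt (\int[mu]_(t in D) (g t ^+ 2)).
Proof.
move=> mD mE ED sf sg; have sf' := sqint_norm sf; have sg' := sqint_norm sg.
have ifg : aeint D (fun t => `|f t * g t|).
  apply: aeint_ext (sqintM mD sf' sg'); apply: eq_aeeq => t _; exact: normrM.
apply: (@le_trans _ _ (\int[mu]_(t in D) `|f t * g t|)).
  by apply: le_Rint_sub => //; apply: aeW.
have f20 : 0 <= \int[mu]_(t in D) (f t ^+ 2) by apply: Rint_ge0; apply: aeW => t _; exact: sqr_ge0.
rewrite -sqrtrM//.
have i0 : 0 <= \int[mu]_(t in D) `|f t * g t| by apply: Rint_ge0; apply: aeW.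
rewrite -[leLHS]ger0_norm// -sqrtr_sqr ler_wsqrtr//.
have := Cauchy_Schwarz mD sf' sg'.
have -> : \int[mu]_(t in D) (`|f t| * `|g t|) = \int[mu]_(t in D) `|f t * g t|.
  by apply: eq_Rintegral => t _; rewrite normrM.
have E2 k : \int[mu]_(t in D) (`|k t| ^+ 2) = \int[mu]_(t in D) (k t ^+ 2).
  by apply: eq_Rintegral => t _; rewrite real_normK ?num_real.
by rewrite !E2.
Qed.

(** Integration by parts of F F', with F' = f. *)
Lemma trace_sq_diff (a b c : R) f F : a <= b -> sqint `]a, b[ f -> sqint `]a, b[ F ->
  aeeq `]a, b[ F (fun t => c + prim a f t) ->
  `|(c + prim a f b) ^+ 2 - c ^+ 2| <= 2 * \int[mu]_(t in `]a, b[) `|f t * F t|.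
Proof.
move=> ab sf sF FE; have jf := sqint_aeint sf.
have := integration_by_parts_ae ab jf jf FE FE.
have ifF : aeint `]a, b[ (fun t => f t * F t) by apply: sqintM.
rewrite -expr2 -expr2 => <-.
have := Rint_norm (measurable_itv _) ifF.
set z := \int[mu]_(t in `]a, b[) (f t * F t); move=> h.
have -> : z + z = 2 * z by ring.
by rewrite normrM ger0_norm// ler_pM2l.
Qed.

(** The previous bound, applied on ]a, t[ and averaged over t. *)
Lemma trace_sq_left (a b c : R) f F : a < b -> sqint `]a, b[ f -> sqint `]a, b[ F ->
  aeeq `]a, b[ F (fun t => c + prim a f t) ->
  c ^+ 2 <= (\int[mu]_(t in `]a, b[) (F t ^+ 2)) / (b - a) +
     2 * \int[mu]_(t in `]a, b[) `|f t * F t|.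
Proof.
move=> ab sf sF FE; set K := \int[mu]_(t in `]a, b[) `|f t * F t|.
have ifF : aeint `]a, b[ (fun t => f t * F t) by apply: sqintM.
have ba : 0 < b - a by rewrite subr_gt0.
have pt : {ae mu, forall t, `]a, b[%classic t -> c ^+ 2 <= F t ^+ 2 + 2 * K}.
  apply: ae_imp (FE) => t Ft /[dup] Dt; rewrite /= in_itv/= => /andP[at_ tb].
  have sub : `]a, t[ `<=` `]a, b[ by apply: sub_itvoo => //; exact: ltW.
  have sf' := sqint_sub (measurable_itv _) (measurable_itv _) sub sf.
  have sF' := sqint_sub (measurable_itv _) (measurable_itv _) sub sF.
  have FE' : aeeq `]a, t[ F (fun t => c + prim a f t).
    by apply: aeeq_sub sub _; exact: FE.
  have := trace_sq_diff (ltW at_) sf' sF' FE'; rewrite -(Ft Dt).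
  have : \int[mu]_(t in `]a, t[) `|f t * F t| <= K.
    by apply: le_Rint_sub => //; [exact: aeint_norm|apply: aeW].
  by rewrite ler_norml => hK /andP[h1 h2]; lra.
have iR : aeint `]a, b[ (fun t => F t ^+ 2 + 2 * K).
  by apply: aeintD => //; [exact: sF.2|exact: aeint_cst].
have := le_Rint (measurable_itv _) (@aeint_cst _ a b (c ^+ 2)) iR pt.
rewrite RintD//; [|exact: sF.2|exact: aeint_cst].
rewrite !Rint_cst ?(ltW ab)// -ler_pdivlMr// [X in _ <= X -> _]mulrDl mulfK ?gt_eqF//.
Qed.

(** Integration by parts of g ^ 2 = u' g; the four squares of boundary values are
    bounded by P and Q. *)
Lemma interpolation_piece (a b c e n P Q : R) u g h : a < b ->
  sqint `]a, b[ u -> sqint `]a, b[ g -> sqint `]a, b[ h ->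
  aeeq `]a, b[ u (fun t => c + prim a g t) ->
  aeeq `]a, b[ g (fun t => e + prim a h t) ->
  c ^+ 2 <= P -> (c + prim a g b) ^+ 2 <= P ->
  e ^+ 2 <= Q -> (e + prim a h b) ^+ 2 <= Q ->
  \int[mu]_(t in `]a, b[) `|h t * u t| <= n ->
  \int[mu]_(t in `]a, b[) (g t ^+ 2) <= 2 * Num.sqrt (P * Q) + n.
Proof.
move=> ab su sg sh uE gE cP dP eQ kQ hn.
have ig := sqint_aeint sg; have ih := sqint_aeint sh.
have := integration_by_parts_ae (ltW ab) ig ih uE gE.
have -> : \int[mu]_(t in `]a, b[) (g t * g t) = \int[mu]_(t in `]a, b[) (g t ^+ 2).
  by apply: eq_Rintegral => t _; rewrite expr2.
have ihu : aeint `]a, b[ (fun t => h t * u t) by apply: sqintM.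
have := Rint_norm (measurable_itv _) ihu; rewrite ler_norml => /andP[h1 h2].
have bnd (y z : R) : y ^+ 2 <= P -> z ^+ 2 <= Q -> `|y * z| <= Num.sqrt (P * Q).
  move=> yP zQ; rewrite -sqrtr_sqr ler_wsqrtr// exprMn ler_pM ?sqr_ge0//.
have := bnd _ _ dP kQ; have := bnd _ _ cP eQ.
rewrite !ler_norml => /andP[b1 b2] /andP[b3 b4] IB; lra.
Qed.

End IntervalInequalities.

Section Embeddings.
Context {R : realType} (m : nat) (x : nat -> R).
Notation mu := (@lebesgue_measure R).
Hypotheses (x0 : x 0%N = 0) (xm : x m.+1 = pi)
  (incr : forall i, (i <= m)%N -> x i < x i.+1).
Implicit Types (u v g h : R -> R).

Let I i : set R := `]x i, x i.+1[.
Let D : set R := `]0, pi[.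
Local Notation V := (spV m x).
Local Notation H01 := (spH01 m x).
Let mI i : measurable (I i). Proof. exact: measurable_itv. Qed.
Let mD : measurable D. Proof. exact: measurable_itv. Qed.
Local Notation pd := (pder m x).
Let piD : 0 < pi :> R. Proof. exact: (pi_pos x0 xm incr). Qed.
Local Opaque pder ipH.

(** By induction on the knots: u has no jump there. *)
Lemma rlim_knot u i : elts V u -> (i <= m)%N -> rlim u (x i) = prim 0 (pd u) (x i).
Proof.
move=> Vu; have ip := sqint_aeint (spV_sqint_pder x0 xm incr Vu).
have [_ u0 _ uj] := Vu.
elim: i => [|i IH] im; first by rewrite x0 u0 prim_le.
have := uj i im; rewrite /jump => /eqP; rewrite subr_eq0 => /eqP ->.
have [_ ->] := spV_trace incr Vu (ltnW im : (i < m.+1)%N).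
rewrite IH ?(ltnW im)//; symmetry.
apply: prim_split ip.
- exact: (knots_ge0 x0 incr (i := i) (leqW (ltnW im))).
- exact: (ltW (incr (ltnW im))).
- exact: (knots_lepi xm incr (i := i.+1) (leqW im)).
Qed.

(** The continuity of u at the knots makes it a primitive over the whole interval of
    its piecewise derivative; so u belongs to H01 and this derivative is the weak
    derivative on ]0, pi[. *)
Lemma prim_pder u : elts V u -> aeeq D u (prim 0 (pd u)) /\ prim 0 (pd u) pi = 0.
Proof.
move=> Vu; have ip := sqint_aeint (spV_sqint_pder x0 xm incr Vu).
split.
  apply: (aeeq_pieces x0 xm) => i im.
  have [uE _] := spV_trace incr Vu im.
  apply: ae_imp uE => t ut /[dup] It /ut ->; rewrite (rlim_knot Vu)//.
  have /andP[xt tx] : x i < t < x i.+1 by move: It; rewrite /I /= in_itv.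
  symmetry; apply: prim_split ip.
  - exact: (knots_ge0 x0 incr (ltnW im)).
  - exact: ltW.
  - apply: (le_trans (ltW tx)); exact: (knots_lepi xm incr).
have [_ _ upi _] := Vu.
have [_] := spV_trace incr Vu (leqnn m.+1).
rewrite xm upi (rlim_knot Vu)//.
have m0 := knots_ge0 x0 incr (leqnSn m).
have mp : x m <= pi by rewrite -xm; exact: (ltW (incr (leqnn m))).
by move=> E; have := prim_split m0 mp (lexx pi) ip; move=> ->; rewrite -E.
Qed.

Lemma spV_sobolev1 u : elts V u ->
  sobolev1 0 pi u /\ aeeq D (wder 0 pi u) (pd u).
Proof.
move=> Vu; have [uE _] := prim_pder Vu.
apply: (@prim_sobolev1 R 0 pi 0) => //.
- exact: ltW.
- exact: (spV_L2 x0 xm incr Vu).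
- exact: (spV_L2_pder x0 xm incr Vu).
- by apply: aeeq_trans uE _; apply: eq_aeeq => t _; rewrite add0r.
Qed.

Lemma spV_spH01 u : elts V u -> elts H01 u.
Proof. by move=> Vu; have [_ u0 upi _] := Vu; have [Su _] := spV_sobolev1 Vu. Qed.

Lemma spH01_sqint u : elts H01 u -> sqint D (wder 0 pi u).
Proof. by move=> [Su _ _]; apply: (L2_sqint mD); have [] := wderP Su. Qed.

Lemma subspace_spH01 : subspace_elts H01.
Proof.
have is0 z : rlim (0 : R -> R) z = 0 /\ llim (0 : R -> R) z = 0.
  split; [apply: rlim_eq|apply: llim_eq] => e e0; exists 1; split => //;
    by apply: aeW => t _; rewrite subr0 normr0.
split.
  split; [exact: (sobolev1_0 0 pi).1|exact: (is0 _).1|exact: (is0 _).2].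
move=> a u v [Su u0 upi] [Sv v0 vpi].
have [S _] := sobolev1_lin a Su Sv; have [t1 t2] := trace_lin a piD Su Sv.
split; first exact: S.
  by apply: etrans t1 _; rewrite u0 v0 mulr0 addr0.
by apply: etrans t2 _; rewrite upi vpi mulr0 addr0.
Qed.

Lemma sform_ipH01 : sform (X := H01) (ipH01 m x).
Proof.
split; [|by move=> u v _ _; exact: ipHC|by move=> u _; exact: ipH_ge0].
move=> a u v w Hu Hv Hw; have [Su _ _] := Hu; have [Sv _ _] := Hv.
have [_ E] := sobolev1_lin a Su Sv.
apply: etrans (ipH_ext x0 xm incr E (@aeeq_refl _ D _)) _.
exact: (ipH_lin x0 xm incr a (spH01_sqint Hu) (spH01_sqint Hv) (spH01_sqint Hw)).
Qed.

Lemma prenormed_spH01 : prenormed H01.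
Proof. exact: (prenormed_form subspace_spH01 sform_ipH01). Qed.

Lemma ipH01_spV u v : elts V u -> elts V v -> ipH01 m x u v = ipH m x (pd u) (pd v).
Proof.
move=> Vu Vv; have [_ E] := spV_sobolev1 Vu; have [_ E'] := spV_sobolev1 Vv.
exact: (ipH_ext x0 xm incr E E').
Qed.

Lemma ipH_sq u : sqint D u -> ipH m x u u = \int[mu]_(t in D) (u t ^+ 2).
Proof.
move=> su; apply: etrans (ipHE x0 xm incr su su) _.
by apply: eq_Rintegral => t _; rewrite expr2.
Qed.

Lemma sumr_prefix (F : nat -> R) i n : (i <= n)%N -> (forall j, 0 <= F j) ->
  \sum_(j < i) F j <= \sum_(j < n) F j.
Proof.
move=> im F0; rewrite -(subnKC im) big_split_ord/= lerDl.
by apply: sumr_ge0 => j _; exact: F0.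
Qed.

Lemma jump_le_nrm u i : elts V u -> (i < m)%N ->
  `|jump (pd u) (x i.+1)| <= nrm (u : rep V).
Proof.
move=> Vu im; rewrite -sqrtr_sqr; apply: ler_wsqrtr.
rewrite /ipV (bigD1 (Ordinal im))//= addrCA expr2 lerDl.
apply: addr_ge0; first exact: ipH_ge0.
by apply: sumr_ge0 => j _; rewrite -expr2 sqr_ge0.
Qed.

Lemma pder2_le_nrm u : elts V u ->
  Num.sqrt (\int[mu]_(t in D) (pd (pd u) t ^+ 2)) <= nrm (u : rep V).
Proof.
move=> Vu; apply: ler_wsqrtr; rewrite -(ipH_sq (spV_sqint_pder2 x0 xm incr Vu)).
by rewrite /ipV lerDl; apply: sumr_ge0 => j _; rewrite -expr2 sqr_ge0.
Qed.

Lemma nrmV_ge0 u : 0 <= nrm (u : rep V). Proof. exact: sqrtr_ge0. Qed.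

(** Between two points the derivative changes by the integral of the second derivative
    and by the jumps crossed, each of which is bounded by the norm of V. *)
Lemma pder_oscillation u : elts V u ->
  {ae mu, forall t, D t -> `|pd u t - rlim (pd u) (x 0%N)| <=
     (Num.sqrt pi + m%:R) * nrm (u : rep V)}.
Proof.
move=> Vu; have s2 := spV_sqint_pder2 x0 xm incr Vu.
have i2 : aeint D (fun t => `|pd (pd u) t|) by apply: (aeint_norm mD); exact: sqint_aeint.
have i2p i : (i < m.+1)%N -> aeint (I i) (fun t => `|pd (pd u) t|).
  by move=> im; apply: (aeint_sub mD (mI i) (piece_sub x0 xm incr im) i2).
have i2q i : (i < m.+1)%N -> aeint (I i) (pd (pd u)).
  move=> im; apply: (aeint_sub mD (mI i) (piece_sub x0 xm incr im)).
  exact: sqint_aeint.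
pose J i := `|jump (pd u) (x i.+1)|.
have knot i : (i <= m)%N -> `|rlim (pd u) (x i) - rlim (pd u) (x 0%N)| <=
    \int[mu]_(t in `]0, x i[) `|pd (pd u) t| + \sum_(j < i) J j.
  elim: i => [|i IH] im.
    rewrite subrr normr0 big_ord0 addr0; apply: Rint_ge0; exact: aeW.
  have iS := ltnW im : (i < m.+1)%N.
  have [_ e] := aeint_pieces_sum x0 incr (n := i.+1) iS
    (fun j ji => i2p j (leq_trans ji iS)).
  have [_ e'] := aeint_pieces_sum x0 incr (n := i) (ltnW iS)
    (fun j ji => i2p j (ltn_trans ji iS)).
  rewrite e !big_ord_recr/= -e'.
  have [_ L] := spV_trace1 x0 xm incr Vu iS.
  have jE : rlim (pd u) (x i.+1) = jump (pd u) (x i.+1) + llim (pd u) (x i.+1).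
    by rewrite /jump subrK.
  have := IH (ltnW im); have := Rint_norm (mI i) (i2q i iS).
  move: jE; rewrite L -/(prim (x i) (pd (pd u)) (x i.+1)) => ->.
  rewrite -/(J i).
  set y1 := \int[mu]_(t in _) _; set y2 := prim _ _ _; rewrite /J.
  set r1 := rlim _ (x i); set r2 := rlim _ (x 0%N); set j := jump _ _.
  set s := \sum_(j < i) _; set i1 := \int[mu]_(t in _) _.
  move: r1 r2 j s i1 y1 y2 => r1 r2 j s i1 y1 y2 h1 h2.
  have -> : j + (r1 + y2) - r2 = (r1 - r2) + (y2 + j) by ring.
  apply: (le_trans (ler_normD _ _)).
  by have := ler_normD y2 j; lra.
have CS : \int[mu]_(t in D) `|pd (pd u) t| <= Num.sqrt pi * nrm (u : rep V).
  have := Cauchy_Schwarz_norm mD mD (@subset_refl _ D) (sqint_cst 0 pi 1) s2.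
  have -> : \int[mu]_(t in D) (1 ^+ 2 : R) = pi.
    by under eq_Rintegral do rewrite expr1n; rewrite Rint_cst ?(ltW piD)// mul1r subr0.
  under eq_Rintegral do rewrite mul1r.
  move=> /le_trans; apply; apply: ler_wpM2l; first exact: sqrtr_ge0.
  exact: pder2_le_nrm.
have JS : \sum_(j < m) J j <= m%:R * nrm (u : rep V).
  rewrite mulr_natl -[X in _ *+ X]card_ord -sumr_const.
  by apply: ler_sum => j _; exact: jump_le_nrm.
apply: (ae_pieces x0 xm) => i im.
have [gE _] := spV_trace1 x0 xm incr Vu im.
apply: ae_imp gE => t gt /[dup] It /gt ->.
have /andP[xt tx] : x i < t < x i.+1 by move: It; rewrite /I /= in_itv.
have := knot i im.
have := prim_norm (ltW (incr im)) (ltW tx) (i2q i im).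
have xi0 := knots_ge0 x0 incr (ltnW im).
have E := Rint_itv_split xi0 (ltW (incr im)) (aeint_itv (lexx 0) (knots_lepi xm incr im) i2).
have : \int[mu]_(t in `]0, x i.+1[) `|pd (pd u) t| <= \int[mu]_(t in D) `|pd (pd u) t|.
  apply: le_Rint_sub => //; last exact: aeW.
  by apply: sub_itvoo => //; exact: (knots_lepi xm incr).
have F (y1 y2 y3 y4 y5 y6 y7 y8 y9 y10 : R) : `|y6| <= y4 ->
    `|y7 - y8| <= y3 + y5 -> y5 <= y2 -> y3 + y4 <= y1 -> y1 <= y9 ->
    y2 <= y10 -> `|y7 + y6 - y8| <= y9 + y10.
  move=> h1 h2 h3 h4 h5 h6; have -> : y7 + y6 - y8 = y6 + (y7 - y8) by ring.
  by apply: (le_trans (ler_normD _ _)); lra.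
rewrite E => h4 h1 h2; rewrite mulrDl.
have J0 j : 0 <= J j by exact: normr_ge0.
have h3 : \sum_(j < i) J j <= \sum_(j < m) J j .
  by apply: sumr_prefix J0; exact: im.
exact: F h1 h2 h3 h4 CS JS.
Qed.

(** The derivative has mean value 0, since u vanishes at both ends; its oscillation
    therefore bounds it. *)
Lemma pder_bound : exists2 C : R, 0 <= C & forall u, elts V u ->
  {ae mu, forall t, D t -> `|pd u t| <= C * nrm (u : rep V)}.
Proof.
pose S : R := Num.sqrt pi + m%:R.
have S0 : 0 <= S by rewrite addr_ge0// sqrtr_ge0.
exists (2 * S); first by rewrite mulr_ge0.
move=> u Vu; have osc := pder_oscillation Vu.
have [_ p0] := prim_pder Vu.
have ip : aeint D (pd u) := sqint_aeint (spV_sqint_pder x0 xm incr Vu).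
have ic r : aeint D (fun=> r) by exact: aeint_cst.
have : `|rlim (pd u) (x 0%N)| <= S * nrm (u : rep V).
  set r := rlim _ _; rewrite -/r in osc.
  have E : \int[mu]_(t in D) (pd u t - r) = - (r * pi).
    by rewrite (RintB mD ip (ic r)) -[\int[mu]_(t in D) pd u t]/(prim 0 (pd u) pi) p0 Rint_cst ?(ltW piD)// subr0 sub0r.
  have i1 : aeint D (fun t => pd u t - r) := aeintB mD ip (ic r).
  have := le_Rint mD (aeint_norm mD i1) (ic (S * nrm (u : rep V))) osc.
  rewrite Rint_cst ?(ltW piD)// subr0.
  move/(le_trans (Rint_norm mD i1)); rewrite E normrN normrM [`|pi|]gtr0_norm//.
  by rewrite ler_pM2r.
move=> hr; apply: ae_imp osc => t ht /ht; move: hr; rewrite -/S.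
move: (rlim _ _) (pd u t) (nrm _) => r y n h1 h2.
have -> : y = (y - r) + r by ring.
by apply: (le_trans (ler_normD _ _)); lra.
Qed.

Lemma Rint_sq_bound f C n : sqint D f -> 0 <= C -> 0 <= n ->
  {ae mu, forall t, D t -> `|f t| <= C * n} ->
  \int[mu]_(t in D) (f t ^+ 2) <= (C ^+ 2 * pi) * n ^+ 2.
Proof.
move=> sf C0 n0 fC.
have := le_Rint mD sf.2 (@aeint_cst R 0 pi ((C * n) ^+ 2)).
rewrite Rint_cst ?(ltW piD)// subr0 => h.
have -> : C ^+ 2 * pi * n ^+ 2 = (C * n) ^+ 2 * pi by ring.
apply: h; apply: ae_imp fC => t ft /ft {}ft.
by rewrite -real_normK ?num_real// lerXn2r// nnegrE ?mulr_ge0.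
Qed.

Lemma embedding_H01 : exists2 C : R, 0 <= C & forall u, elts V u ->
  ipH m x (pd u) (pd u) <= C * nrm (u : rep V) ^+ 2.
Proof.
have [C C0 hC] := pder_bound; exists (C ^+ 2 * pi).
  by rewrite mulr_ge0 ?sqr_ge0// ltW.
move=> u Vu; have s1 := spV_sqint_pder x0 xm incr Vu.
apply: le_trans (Rint_sq_bound s1 C0 (nrmV_ge0 u) (hC u Vu)).
by rewrite (ipH_sq s1).
Qed.

Lemma embedding_H : exists2 C : R, 0 <= C & forall u, elts V u ->
  ipH m x u u <= C * nrm (u : rep V) ^+ 2.
Proof.
have [C C0 hC] := pder_bound; exists ((C * pi) ^+ 2 * pi).
  by rewrite mulr_ge0 ?sqr_ge0// ltW.
move=> u Vu; have s0 := spV_sqint x0 xm incr Vu.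
have Cp : 0 <= C * pi by rewrite mulr_ge0// ltW.
have ip : aeint D (pd u) := sqint_aeint (spV_sqint_pder x0 xm incr Vu).
rewrite (ipH_sq s0); apply: Rint_sq_bound s0 Cp (nrmV_ge0 u) _.
have [uE _] := prim_pder Vu.
apply: ae_imp uE => t ut /[dup] Dt /ut ->.
have tpi : t <= pi by move: Dt; rewrite /D /= in_itv/= => /andP[_ /ltW].
apply: (le_trans (prim_norm (ltW piD) tpi ip)).
have := le_Rint mD (aeint_norm mD ip) (@aeint_cst R 0 pi (C * nrm (u : rep V))) (hC u Vu).
by rewrite Rint_cst ?(ltW piD)// subr0 => /le_trans; apply; rewrite mulrAC.
Qed.

(** With N and A the norms of u and g = u', and n a bound for that of h = u'':
    the values of u at the knots satisfy u ^ 2 <= 2 A N, those of g at the ends of each piece satisfy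
    g ^ 2 <= K A n, so on each piece the boundary terms u g are at most
    2 sqrt (2 K A ^ 2 N n).  By Young's inequality half of A ^ 2 is absorbed by the
    left-hand side. *)
Lemma interpolation_core (C1 n : R) (r : nat -> R) u g h :
  sqint D u -> sqint D g -> sqint D h -> 0 <= C1 ->
  aeeq D u (prim 0 g) ->
  (forall i, (i < m.+1)%N -> aeeq (I i) g (fun t => r i + prim (x i) h t)) ->
  Num.sqrt (\int[mu]_(t in D) (h t ^+ 2)) <= n ->
  Num.sqrt (\int[mu]_(t in D) (g t ^+ 2)) <= C1 * n ->
  \int[mu]_(t in D) (g t ^+ 2) <=
    2 * (m.+1%:R * (4 * m.+1%:R * (\sum_(i < m.+1) C1 / (x i.+1 - x i) + 4) + 1)) *
    Num.sqrt (\int[mu]_(t in D) (u t ^+ 2)) * n.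
Proof.
move=> su sg sh C10 uE gE hn gn.
pose K := \sum_(i < m.+1) C1 / (x i.+1 - x i) + 4.
have Li (i : 'I_m.+1) : 0 < x i.+1 - x i by rewrite subr_gt0 incr// -ltnS.
have K0 : 0 < K.
  by apply: ltr_wpDl => //; apply: sumr_ge0 => i _; rewrite divr_ge0// ltW.
have Kge i : (i < m.+1)%N -> C1 / (x i.+1 - x i) + 4 <= K.
  move=> im; rewrite lerD2r (bigD1 (Ordinal im))//= lerDl; apply: sumr_ge0 => j _.
  by rewrite divr_ge0// ltW.
rewrite -/K; move: (K) K0 Kge => {}K K0 Kge.
pose M : R := m.+1%:R; rewrite -/M.
have M0 : 0 < M by rewrite ltr0n.
set sN := Num.sqrt (\int[mu]_(t in D) (u t ^+ 2)).
have sN0 : 0 <= sN by exact: sqrtr_ge0.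
set A := \int[mu]_(t in D) (g t ^+ 2).
have A0 : 0 <= A by apply: Rint_ge0; apply: aeW => t _; exact: sqr_ge0.
pose sA := Num.sqrt A; have sA0 : 0 <= sA by exact: sqrtr_ge0.
have AE : A = sA ^+ 2 by rewrite sqr_sqrtr.
have n0 : 0 <= n by apply: le_trans hn; exact: sqrtr_ge0.
have hu E : measurable E -> E `<=` D -> \int[mu]_(t in E) `|h t * u t| <= sN * n.
  move=> mE ED; apply: (le_trans (Cauchy_Schwarz_norm mD mE ED sh su)).
  by rewrite mulrC; exact: (ler_wpM2l sN0 hn).
have hg E : measurable E -> E `<=` D -> \int[mu]_(t in E) `|h t * g t| <= sA * n.
  move=> mE ED; apply: (le_trans (Cauchy_Schwarz_norm mD mE ED sh sg)).
  by rewrite mulrC; exact: (ler_wpM2l sA0 hn).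
have gu E : measurable E -> E `<=` D -> \int[mu]_(t in E) `|g t * u t| <= sA * sN.
  by move=> mE ED; exact: (Cauchy_Schwarz_norm mD mE ED sg su).
have snn : 0 <= sA * n by rewrite mulr_ge0.
have knotP i : (i <= m.+1)%N -> prim 0 g (x i) ^+ 2 <= 2 * (sA * sN).
  move=> im; have xi0 := knots_ge0 x0 incr im; have xip := knots_lepi xm incr im.
  have sub : `]0, x i[ `<=` D by exact: sub_itvoo.
  have mE : measurable (`]0, x i[ : set R) by exact: measurable_itv.
  have := @trace_sq_diff R 0 (x i) 0 g u xi0 (sqint_sub mD mE sub sg)
     (sqint_sub mD mE sub su).
  have E : aeeq `]0, x i[ u (fun t => 0 + prim 0 g t).
    apply: aeeq_sub sub _; apply: aeeq_trans (uE) _; apply: eq_aeeq => t _.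
    by rewrite add0r.
  move=> /(_ E); rewrite add0r expr0n/= subr0 ger0_norm ?sqr_ge0//.
  move=> /le_trans; apply; rewrite ler_pM2l//; exact: gu.
have piece i : (i < m.+1)%N -> \int[mu]_(t in I i) (g t ^+ 2) <=
    2 * Num.sqrt (2 * (sA * sN) * (K * (sA * n))) + sN * n.
  move=> im; have sub := piece_sub x0 xm incr im.
  have xi0 := knots_ge0 x0 incr (ltnW im); have xip := knots_lepi xm incr im.
  have xii := incr im; have ig := sqint_aeint sg.
  have uEi : aeeq (I i) u (fun t => prim 0 g (x i) + prim (x i) g t).
    apply: ae_imp (uE) => t ut It; rewrite ut; last exact: sub.
    have /andP[xt tx] : x i < t < x i.+1 by move: It; rewrite /I /= in_itv.
    by apply: prim_split ig; [exact: xi0|exact: ltW|exact: le_trans (ltW tx) xip].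
  have eE : prim 0 g (x i) + prim (x i) g (x i.+1) = prim 0 g (x i.+1).
    by symmetry; apply: prim_split ig; [exact: xi0|exact: ltW|exact: xip].
  have sui := sqint_sub mD (mI i) sub su; have sgi := sqint_sub mD (mI i) sub sg.
  have shi := sqint_sub mD (mI i) sub sh.
  have L0 := Li (Ordinal im).
  have Q1 : r i ^+ 2 <= (C1 / (x i.+1 - x i) + 2) * (sA * n).
    apply: (le_trans (trace_sq_left xii shi sgi (gE i im))).
    rewrite [leRHS]mulrDl; apply: lerD; last by rewrite ler_pM2l//; exact: hg.
    apply: (@le_trans _ _ (A / (x i.+1 - x i))).
      rewrite ler_pM2r ?invr_gt0//; apply: le_Rint_sub sub sg.2 _ => //.
      by apply: aeW => t _; exact: sqr_ge0.
    rewrite [leRHS]mulrAC ler_pM2r ?invr_gt0// AE expr2 [leRHS]mulrCA.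
    exact: (ler_wpM2l sA0 gn).
  have Q2 : (r i + prim (x i) h (x i.+1)) ^+ 2 <= (C1 / (x i.+1 - x i) + 4) * (sA * n).
    have := trace_sq_diff (ltW xii) shi sgi (gE i im).
    have := hg _ (mI i) sub; rewrite ler_norml => h1 /andP[_ h2].
    have F (a1 a2 a3 a4 a5 : R) : a1 <= a5 -> a2 - a3 <= 2 * a1 ->
        a3 <= (a4 + 2) * a5 -> a2 <= (a4 + 4) * a5 by move=> *; lra.
    exact: F h1 h2 Q1.
  have p1 := knotP i (ltnW im).
  have p2 := knotP i.+1 im; rewrite -eE in p2.
  have p3 : r i ^+ 2 <= K * (sA * n).
    apply: (le_trans Q1); apply: ler_wpM2r => //.
    by apply: le_trans (Kge i im); rewrite lerD2l; lra.
  have p4 : (r i + prim (x i) h (x i.+1)) ^+ 2 <= K * (sA * n).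
    by apply: (le_trans Q2); apply: ler_wpM2r => //; exact: Kge.
  exact: (interpolation_piece xii sui sgi shi uEi (gE i im) p1 p2 p3 p4 (hu _ (mI i) sub)).
(* Young's inequality in the form that splits the square root below *)
have yng (y z : R) : 0 <= y -> 0 <= z -> Num.sqrt (y * z *+ 4) <= y + z.
  move=> y0 z0; rewrite -[leRHS]ger0_norm ?addr_ge0// -sqrtr_sqr ler_wsqrtr//.
  have -> : y * z *+ 4 = (y + z) ^+ 2 - (y - z) ^+ 2 by ring.
  by rewrite lerBlDr lerDl sqr_ge0.
have sq : Num.sqrt (2 * (sA * sN) * (K * (sA * n))) <= A / (4 * M) + 2 * M * K * (sN * n).
  have -> : 2 * (sA * sN) * (K * (sA * n)) = (A / (4 * M)) * (2 * M * K * (sN * n)) *+ 4.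
    by rewrite AE; field; rewrite gt_eqF.
  apply: yng; first by rewrite divr_ge0// mulr_ge0// ltW.
  by apply: mulr_ge0; [rewrite mulr_ge0 ?mulr_ge0// ltW|exact: mulr_ge0].
have : A <= M * (2 * (A / (4 * M) + 2 * M * K * (sN * n)) + sN * n).
  rewrite {1}/A (Rint_pieces x0 xm incr (g := fun t => g t ^+ 2)); last first.
    move=> i im; exact: (sqint_sub mD (mI i) (piece_sub x0 xm incr im) sg).2.
  set Z := 2 * _ + _; have -> : M * Z = \sum_(i < m.+1) Z.
    by rewrite sumr_const card_ord -mulr_natl.
  apply: ler_sum => i _; apply: (le_trans (piece i (ltn_ord i))).
  by rewrite lerD2r ler_pM2l.
have -> : M * (2 * (A / (4 * M) + 2 * M * K * (sN * n)) + sN * n) =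
   A / 2 + M * (4 * M * K + 1) * (sN * n) by field; rewrite gt_eqF.
have -> : 2 * (M * (4 * M * K + 1)) * sN * n = 2 * (M * (4 * M * K + 1) * (sN * n)) by ring.
move: (_ * (sN * n)) => y; lra.
Qed.

Lemma interpolation : exists2 C : R, 0 <= C & forall u, elts V u ->
  ipH m x (pd u) (pd u) <= C * nrm (u : rep (spH m x)) * nrm (u : rep V).
Proof.
have [C1 C10 hC1] := embedding_H01.
pose C2 := Num.sqrt C1; have C20 : 0 <= C2 by exact: sqrtr_ge0.
eexists; last first.
  move=> u Vu; have su := spV_sqint x0 xm incr Vu.
  have sg := spV_sqint_pder x0 xm incr Vu.
  have sh := spV_sqint_pder2 x0 xm incr Vu.
  have gn : Num.sqrt (\int[mu]_(t in D) (pd u t ^+ 2)) <= C2 * nrm (u : rep V).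
    rewrite -[nrm _]ger0_norm ?nrmV_ge0// -sqrtr_sqr -sqrtrM//; apply: ler_wsqrtr.
    by rewrite -(ipH_sq sg); exact: hC1.
  have := interpolation_core su sg sh C20 (prim_pder Vu).1
    (fun i im => (spV_trace1 x0 xm incr Vu im).1) (pder2_le_nrm Vu) gn.
  rewrite -(ipH_sq sg) -(ipH_sq su); exact.
rewrite mulr_ge0// mulr_ge0// addr_ge0// mulr_ge0// ?mulr_ge0// addr_ge0//.
apply: sumr_ge0 => i _; rewrite divr_ge0// subr_ge0 ltW// incr// -ltnS//.
Qed.

End Embeddings.

(** * The potential energies *)

Section PotentialEnergies.
Context {R : realType} (m : nat) (x theta : nat -> R).
Notation mu := (@lebesgue_measure R).
Hypotheses (x0 : x 0%N = 0) (xm : x m.+1 = pi)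
  (incr : forall i, (i <= m)%N -> x i < x i.+1).
Hypothesis theta0 : forall i, (0 < i <= m)%N -> 0 < theta i.
Local Notation V := (spV m x).
Local Notation H01 := (spH01 m x).
Local Opaque pder ipH.

Definition flex (i : nat) : R := (theta i.+1)^-1.

Let flex0 i : (i < m)%N -> 0 <= flex i.
Proof. by move=> im; rewrite invr_ge0 ltW// theta0. Qed.

Lemma UbE u : Ub (m := m) (x := x) theta u = 2^-1 * bending m x flex u u.
Proof.
rewrite /Ub /bending; congr (_ * (_ + _)); apply: eq_bigr => i _; congr (_ * _).
by rewrite -expr2 real_normK ?num_real.
Qed.

Let nV : prenormed V. Proof. exact: prenormed_spV x0 xm incr. Qed.
Let nH01 : prenormed H01. Proof. exact: prenormed_spH01 x0 xm incr. Qed.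
Let fb : sform (X := V) (bending m x flex).
Proof. exact: sform_bending x0 xm incr _ flex0. Qed.

Let UbE' : Ub (m := m) (x := x) theta = (fun u => 2^-1 * bending m x flex u u).
Proof. by apply/funext => u; exact: UbE. Qed.

Lemma Ub_convex_ineq : convex_ineq (X := V) (Ub (m := m) (x := x) theta).
Proof. rewrite UbE'; exact: form_convex nV fb. Qed.

Lemma Ub_gateaux u : elts V u ->
  is_gateaux (X := V) (Ub (m := m) (x := x) theta) u (bending m x flex u).
Proof.
have [C C0 hC] := bending_bounded x0 xm incr flex0.
rewrite UbE'; exact: form_gateaux nV fb C0 hC u.
Qed.

Lemma Ub_subdiff u : elts V u ->
  subdiff (X := V) (Ub (m := m) (x := x) theta) u (bending m x flex u).
Proof.
by move=> Vu; exact: gateaux_subdiff nV Vu Ub_convex_ineq (Ub_gateaux Vu).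
Qed.

Lemma Ub_lsc : lsc_on (X := V) (Ub (m := m) (x := x) theta).
Proof.
have [C C0 hC] := bending_bounded x0 xm incr flex0.
rewrite UbE'; apply: (form_lsc_comp nV fb C0 hC (G := fun s : R => 2^-1 * s)).
by move=> s; apply: cvgMr; exact: cvg_id.
Qed.

Lemma Ub_subdiff_map : subdiff_map (X := V) (Ub (m := m) (x := x) theta).
Proof.
move=> u Vu; exists (bending m x flex u); split; first exact: Ub_subdiff.
by move=> g'; apply: gateaux_subdiff_unique => //; exact: (Ub_gateaux Vu).
Qed.

Definition axial_grad (s : axial_model R) (u : rep H01) : rep (dual H01) :=
  match s with
  | Beam => fun=> 0
  | Arch beta => quartic_grad (X := H01) (ipH01 m x) (2 * pi)^-1 beta u
  end.

Let fH01 : sform (X := H01) (ipH01 m x). Proof. exact: sform_ipH01 x0 xm incr. Qed.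

Let bH01 (u : rep H01) : elts H01 u -> ipH01 m x u u <= 1 * nrm u ^+ 2.
Proof. by move=> Hu; rewrite mul1r /= sqr_sqrtr//; have [_ _] := fH01; exact. Qed.

Let ik0 : 0 <= (2 * pi : R)^-1.
Proof. by rewrite invr_ge0 mulr_ge0// ltW// (pi_pos x0 xm incr). Qed.

Let UaE beta : Ua (m := m) (x := x) (Arch beta) =
  quartic (X := H01) (ipH01 m x) (2 * pi)^-1 beta.
Proof. by []. Qed.

Lemma Ua_gateaux s u : elts H01 u ->
  is_gateaux (X := H01) (Ua (m := m) (x := x) s) u (axial_grad s u).
Proof.
move=> Hu; case: s => [|beta]; last first.
  by rewrite UaE; apply: (quartic_gateaux (C := 1)) => //; exact: nH01.
split; first split.
- by move=> a v w _ _; rewrite mulr0 addr0.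
- by exists 0 => v _; rewrite normr0 mul0r.
move=> v _; apply: (@dirderiv_poly _ _ _ _ _ _ 0 0 0) => a _.
by rewrite /= subr0 !mulr0 !addr0.
Qed.

Lemma Ua_convex_ineq s : axial_nonneg s ->
  convex_ineq (X := H01) (Ua (m := m) (x := x) s).
Proof.
case: s => [_|beta beta0]; last first.
  by rewrite UaE; apply: quartic_convex => //; exact: nH01.
by move=> r u v _ _ _; rewrite /= !mulr0 addr0.
Qed.

Lemma Ua_lsc s : lsc_on (X := H01) (Ua (m := m) (x := x) s).
Proof.
case: s => [|beta]; last first.
  by rewrite UaE; apply: (quartic_lsc (C := 1)) => //; exact: nH01.
by move=> u _ e e0; exists 1; split => // v _ _; rewrite /= sub0r oppr_lt0.
Qed.

Lemma Ua_subdiff s u : axial_nonneg s -> elts H01 u ->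
  subdiff (X := H01) (Ua (m := m) (x := x) s) u (axial_grad s u).
Proof.
move=> s0 Hu.
exact: gateaux_subdiff nH01 Hu (Ua_convex_ineq s0) (Ua_gateaux s Hu).
Qed.

Lemma Ua_subdiff_map s : axial_nonneg s ->
  subdiff_map (X := H01) (Ua (m := m) (x := x) s).
Proof.
move=> s0 u Hu; exists (axial_grad s u); split; first exact: Ua_subdiff.
by move=> g'; apply: gateaux_subdiff_unique => //; exact: (Ua_gateaux s Hu).
Qed.

End PotentialEnergies.

(** * The governing equation *)

Section CrackedBeam.
Context {R : realType} (m : nat) (x theta : nat -> R) (T cd : R) (s : axial_model R).
Notation mu := (@lebesgue_measure R).
Hypotheses (x0 : x 0%N = 0) (xm : x m.+1 = pi)
  (incr : forall i, (i <= m)%N -> x i < x i.+1).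
Hypothesis theta0 : forall i, (0 < i <= m)%N -> 0 < theta i.
Hypothesis T0 : 0 < T.
Variable p : R -> rep (spH m x).
Hypothesis Lp : L2B T (X := spH m x) p.
Local Notation V := (spV m x).
Local Notation H := (spH m x).
Local Notation H01 := (spH01 m x).
Local Notation W := (spW m x T).
Local Opaque pder ipH.

Let nV : prenormed V. Proof. exact: prenormed_spV x0 xm incr. Qed.
Let nH : prenormed H. Proof. exact: prenormed_spH x0 xm incr. Qed.
Let VH : elts V `<=` elts H. Proof. by move=> u; exact: (spV_spH x0 xm incr). Qed.
Let fH : sform (X := H) (ipH m x). Proof. exact: sform_ipH x0 xm incr. Qed.

Let flex0 i : (i < m)%N -> 0 <= flex theta i.
Proof. by move=> im; rewrite /flex invr_ge0 ltW// theta0. Qed.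

Let fB : sform (X := V) (bending m x (flex theta)).
Proof. exact: (sform_bending x0 xm incr flex0). Qed.

Let fA : sform (X := V) (ipH01 m x).
Proof.
have [l c g0] := sform_ipH01 x0 xm incr; have i u (Vu : elts V u) := spV_spH01 x0 xm incr Vu.
split; [move=> a u v w Vu Vv Vw; apply: l|move=> u v Vu Vv; apply: c|move=> u Vu; apply: g0]; exact: i.
Qed.

Definition axial_stiffness : R := if s is Arch _ then (2 * pi)^-1 else 0.
Definition axial_load : R := if s is Arch beta then beta else 0.

(** A beam is the case of stiffness 0, which makes the two models instances of one
    Lagrangian. *)
Lemma Ua_quartic u : Ua (m := m) (x := x) s u =
  quartic (X := V) (ipH01 m x) axial_stiffness axial_load u.
Proof. by rewrite /Ua /quartic /axial_stiffness /axial_load; case: s => // ; rewrite mul0r. Qed.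

Lemma axial_gradE u v : axial_grad (m := m) (x := x) s u v =
  axial_force (EV := elts V) (nV := @nrm R V) (ipH01 m x) axial_stiffness axial_load u v.
Proof.
rewrite /axial_grad /axial_force /quartic_grad /axial_stiffness /axial_load; case: s => //.
by rewrite mulr0 !mul0r.
Qed.

Lemma actionE t1 t2 (w : rep W) : action theta s p 0 t1 t2 w =
  \int[mu]_(t in `[t1, t2]) lagrangian (elts V) (@nrm R V) (ipH m x) (bending m x (flex theta)) (ipH01 m x)
     axial_stiffness axial_load p (pos w) (vel w) t.
Proof.
apply: eq_Rintegral => t _; rewrite /lagrangian -Ua_quartic /Tk /Wd /Wext UbE.
by rewrite oppr0 mul0r addr0.
Qed.

(** Variations along separated functions suffice.  The Gateaux derivative of the
    conservative action in such a direction is the first variation by the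
    expansion of the action, and the damping contribution is given by its
    prescription. *)
Lemma stationary_balance t1 t2 (w : rep W) : 0 <= t1 -> t1 < t2 -> t2 <= T ->
  stationary theta s p cd t1 t2 w ->
  {ae mu, forall t, t1 <= t <= t2 -> elts V (pos w t) /\
     balance (T := T) p cd w t (bending m x (flex theta) (pos w t))
       (axial_grad (m := m) (x := x) s (pos w t))}.
Proof.
move=> t10 t12 t2T [Ww [c [d [[dc hc] [dd hd] cd0]]]].
have [Ly Lv La dy dv] := Ww.
have [CH CH0 hCH] := embedding_H x0 xm incr.
have [CA CA0 hCA] := embedding_H01 x0 xm incr.
have [K K0 hK] := interpolation x0 xm incr.
have [CB CB0 hCB] := bending_bounded x0 xm incr flex0.
have hA u : elts V u -> ipH01 m x u u = ipH m x (pder m x u) (pder m x u).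
  by move=> Vu; exact: (ipH01_spV x0 xm incr Vu Vu).
have hCA' u : elts V u -> ipH01 m x u u <= CA * nrm (u : rep V) ^+ 2.
  by move=> Vu; rewrite (hA u Vu); exact: hCA.
have hK' u : elts V u -> ipH01 m x u u <= K * nrm (u : rep H) * nrm (u : rep V).
  by move=> Vu; rewrite (hA u Vu); exact: hK.
have hVH u : elts V u -> nrm (u : rep H) <= Num.sqrt CH * nrm (u : rep V).
  move=> Vu; have [_ n0 _ _] := nV.
  rewrite -[nrm (u : rep V)]ger0_norm ?n0// -sqrtr_sqr -sqrtrM//.
  by rewrite ler_wsqrtr//; exact: hCH.
have sC0 := sqrtr_ge0 CH.
have nHE (u : rep H) : nrm u = Num.sqrt (ipH m x u u) by [].
have bal := balance_of_stationarity (k := axial_stiffness) (beta := axial_load)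
  nV nH VH sC0 hVH fH nHE fB CB0 hCB fA CA0 hCA' K0 hK' T0
  Ly Lv Lp La dy dv (cd := cd) t10 t12 t2T.
have stat zeta v : test_function t1 t2 zeta -> elts V v ->
    \int[mu]_(t in `]t1, t2[) variation1 (elts V) (@nrm R V) (ipH m x) (bending m x (flex theta)) (ipH01 m x)
      axial_stiffness axial_load (pos w) (vel w) p zeta v t =
    cd * \int[mu]_(t in `[t1, t2]) (ipH m x (vel w t) v * zeta t).
  move=> tz Vv; have sz := test_smooth tz; have [z1 z2] := test_endpoints tz.
  have [r1 r2 r3 r4 r5] := separated_regular nV nH VH sC0 hVH fH nHE T0 sz Vv.
  have We : elts W (Defs.separated T zeta v).
    split; [exact: r1|exact: r2|exact: r3|exact: r4|exact: r5].
  have [q2 [q3 [q4 hq]]] := action_expand axial_stiffness axial_load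
    nV nH VH sC0 hVH fH nHE fB CB0 hCB fA CA0 hCA' K0 hK' T0 Ly Lv Lp dy t10 t2T sz Vv.
  have posE a : pos (w + a *: (Defs.separated T zeta v : rep W)) =
      (fun t => pos w t + a *: (zeta t *: v)) by [].
  have velE a : vel (w + a *: (Defs.separated T zeta v : rep W)) =
      (fun t => vel w t + a *: (derive1 zeta t *: v)) by [].
  have dir := dirderiv_unique (hc _ We) (dirderiv_poly (X := W)
    (phi := action theta s p 0 t1 t2) (u := w) (eta := Defs.separated T zeta v)
    (l := \int[mu]_(t in `]t1, t2[) variation1 (elts V) (@nrm R V) (ipH m x)
      (bending m x (flex theta)) (ipH01 m x) axial_stiffness axial_load (pos w) (vel w) p zeta v t)
    (q2 := q2) (q3 := q3) (q4 := q4) _).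
  have := cd0 _ We; rewrite (hd _ _ sz z1 z2 Vv) dir => [h|a _].

    by apply/eqP; rewrite -subr_eq0 -mulNr -h.
  by rewrite !actionE posE velE; exact: hq.
apply: ae_imp3 (bal stat) (ae_imp2 (fun t a b => conj a b) (ae_neq t1) (ae_neq t2)) (L2B_elts Ly).
move=> t ht [n1 n2] yt /andP[h1 h2].
have Et : `]t1, t2[%classic t.
  by rewrite /= in_itv/= !lt_neqAle h1 h2 !andbT; apply/andP; split; apply/eqP => //; exact: nesym.
split; first by apply: yt; exact: (sub_itvoo t10 t2T).
by move=> v Vv; rewrite axial_gradE; exact: ht.
Qed.

Lemma stationary_governing t1 t2 (w : rep W) : 0 <= t1 -> t1 < t2 -> t2 <= T ->
  stationary theta s p cd t1 t2 w ->
  {ae mu, forall t, t1 <= t <= t2 -> governing_equation theta s p cd w t}.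
Proof.
move=> t10 t12 t2T st; apply: ae_imp (stationary_balance t10 t12 t2T st) => t h tt.
have [Vy bal] := h tt; have Hy := spV_spH01 x0 xm incr Vy.
exists (bending m x (flex theta) (pos w t)), (axial_grad (m := m) (x := x) s (pos w t)); split.
- exact: (Ub_subdiff x0 xm incr theta0 Vy).
- exact: (Ua_gateaux x0 xm incr s Hy).
- by move=> s0; exact: (Ua_subdiff x0 xm incr s0 Hy).
- exact: bal.
Qed.

End CrackedBeam.

Theorem mainTheorem1 (R : realType) (m : nat) (x theta : nat -> R) (T cd : R)
    (s : axial_model R) (p : R -> rep (spH m x)) :
  x 0%N = 0 -> x m.+1 = pi -> (forall i, (i <= m)%N -> x i < x i.+1) ->
  (forall i, (0 < i <= m)%N -> 0 < theta i) ->
  0 < T -> 0 <= cd -> L2B T (X := spH m x) p ->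
  [/\ [/\ convex_on (X := spV m x) (Ub (m := m) (x := x) theta),
          lsc_on (X := spV m x) (Ub (m := m) (x := x) theta) &
          subdiff_map (X := spV m x) (Ub (m := m) (x := x) theta)],
      lsc_on (X := spH01 m x) (Ua (m := m) (x := x) s),
      axial_nonneg s ->
        convex_on (X := spH01 m x) (Ua (m := m) (x := x) s) /\
        subdiff_map (X := spH01 m x) (Ua (m := m) (x := x) s) &
      forall w : rep (spW m x T),
        (forall t1 t2 : R, 0 <= t1 -> t1 < t2 -> t2 <= T ->
           stationary theta s p cd t1 t2 w ->
           {ae @lebesgue_measure R, forall t : R, t1 <= t <= t2 ->
              governing_equation theta s p cd w t}) /\
        ((forall t1 t2 : R, 0 <= t1 -> t1 < t2 -> t2 <= T ->
            stationary theta s p cd t1 t2 w) ->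
         {ae @lebesgue_measure R, forall t : R, 0 <= t <= T ->
            governing_equation theta s p cd w t})].
Proof.
move=> x0 xm incr theta0 T0 _ Lp; split.
- split.
  + by apply: convex_onP; exact: Ub_convex_ineq.
  + exact: Ub_lsc.
  + exact: Ub_subdiff_map.
- exact: Ua_lsc.
- move=> s0; split; last exact: Ua_subdiff_map.
  by apply: convex_onP; exact: Ua_convex_ineq.
- move=> w; split=> [t1 t2 t10 t12 t2T|st]; first exact: stationary_governing.
  exact: (stationary_governing x0 xm incr theta0 T0 Lp (lexx 0) T0 (lexx T) (st 0 T (lexx 0) T0 (lexx T))).
Qed.
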